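(* Let $f:\mathbb{R}^d\to\mathbb{R}$ satisfy $f\in C^2(\mathbb{R}^d)$ and $\inf f>-\infty$. Let $\gamma\in C^1(\mathbb{R}_+;\mathbb{R}_+)$ satisfy $c\le\gamma(t)\le C$ for all $t\ge0$, for some constants $0<c\le C$, and let $0<\beta<\frac{2c}{C^2}$. Consider, for initial data $x_0,v_0\in\mathbb{R}^d$, the system $$\ddot x(t)+\gamma(t)\dot x(t)+\beta\nabla^2 f(x(t))\dot x(t)+\nabla f(x(t))=0,\ t>0,\qquad x(0)=x_0,\ \dot x(0)=v_0. \tag{ISEHD}$$ Then: (i) there exists a global solution $x\in C^2(\mathbb{R}_+;\mathbb{R}^d)$ of (ISEHD); (ii) $\nabla f\circ x\in L^2(\mathbb{R}_+;\mathbb{R}^d)$ and $\dot x\in L^2(\mathbb{R}_+;\mathbb{R}^d)$; (iii) if $x$ is bounded on $\mathbb{R}_+$, then $\lim_{t\to+\infty}\|\nabla f(x(t))\|=\lim_{t\to+\infty}\|\dot x(t)\|=0$ and $\lim_{t\to+\infty}f(x(t))$ exists; (iv) if in addition to (iii) $f$ is definable, then $\dot x\in L^1(\mathbb{R}_+;\mathbb{R}^d)$ and $x(t)$ converges as $t\to+\infty$ to a critical point of $f$.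
   Context: $\mathbb{R}_+=[0,+\infty[$. A function is called definable if it is definable in some o-minimal structure over $\mathbb{R}$ (e.g. semialgebraic functions). A critical point of $f$ is a point $u$ with $\nabla f(u)=0$. *)

(* Defs.v *)
From HB Require Import structures.
From mathcomp Require Import all_boot all_order all_algebra.
From mathcomp Require Import all_classical all_reals all_analysis.
From mathcomp Require mpoly.
Set Implicit Arguments. Unset Strict Implicit. Unset Printing Implicit Defensive.
Import Order.TTheory GRing.Theory Num.Theory.
Import numFieldNormedType.Exports.
Local Open Scope classical_set_scope.
Local Open Scope ring_scope.

Section Defs.
Variable R : realType.

Definition enorm (d : nat) (v : 'rV[R]_d) : R :=
  Num.sqrt (\sum_(i < d) v 0 i ^+ 2).

Definition ebasis (d : nat) (i : 'I_d) : 'rV[R]_d := delta_mx 0 i.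

Definition partial (d : nat) (i : 'I_d) (g : 'rV[R]_d -> R) (u : 'rV[R]_d) : R :=
  'D_(ebasis i) g u.

Definition grad (d : nat) (g : 'rV[R]_d -> R) (u : 'rV[R]_d) : 'rV[R]_d :=
  \row_i partial i g u.

Definition hessian (d : nat) (g : 'rV[R]_d -> R) (u : 'rV[R]_d) : 'M[R]_d :=
  \matrix_(i, j) partial j (partial i g) u.

Definition hess_app (d : nat) (g : 'rV[R]_d -> R) (u v : 'rV[R]_d) : 'rV[R]_d :=
  (hessian g u *m v^T)^T.

Definition C2 (d : nat) (g : 'rV[R]_d -> R) : Prop :=
  continuous g /\
  (forall i u, derivable g u (ebasis i)) /\
  (forall i, continuous (partial i g)) /\
  (forall i j u, derivable (partial i g) u (ebasis j)) /\
  (forall i j, continuous (partial j (partial i g))).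

(** g in C^1(R_+; V) (R_+ = [0,+oo[, one-sided at 0): g is derivable on
    ]0,+oo[, g is continuous on [0,+oo[ (right-continuous at 0), g' is
    continuous on ]0,+oo[ and extends continuously to 0. *)
Definition C1_Rplus (V : normedModType R) (g : R -> V) : Prop :=
  (forall t, 0 < t -> derivable g t 1) /\
  {within `[0, +oo[, continuous g} /\
  {within `]0, +oo[, continuous (derive1 g)} /\
  cvg ((derive1 g) t @[t --> 0^'+]).

Definition C2_Rplus (V : normedModType R) (g : R -> V) : Prop :=
  C1_Rplus g /\
  (forall t, 0 < t -> derivable (derive1 g) t 1) /\
  {within `]0, +oo[, continuous (derive1n 2 g)} /\
  cvg ((derive1n 2 g) t @[t --> 0^'+]).

Definition ISEHD_solution (d : nat) (f : 'rV[R]_d -> R) (gamma : R -> R)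
    (beta : R) (x0 v0 : 'rV[R]_d) (x : R -> 'rV[R]_d) : Prop :=
  C2_Rplus x /\
  x 0 = x0 /\
  (h^-1 *: (x h - x 0) @[h --> 0^'+] --> v0) /\
  (forall t, 0 < t ->
     derive1n 2 x t + gamma t *: derive1 x t + beta *: hess_app f (x t) (derive1 x t)
       + grad f (x t) = 0).

Definition Rplus : set R := `[0, +oo[.

Definition Lp_Rplus (p : nat) (d : nat) (u : R -> 'rV[R]_d) : Prop :=
  integrable (@lebesgue_measure R) Rplus (fun t => ((enorm (u t)) ^+ p)%:E).

(** o-minimal structure on (R, +, .) (van den Dries / Coste):
    S n is a family of subsets of R^n = 'rV_n such that
    - each S n is a boolean algebra of subsets;
    - S n contains the algebraic subsets of R^n (zero sets of polynomials);
    - A in S n implies A x R in S (n+1) and R x A in S (1+n);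
    - the projection to the first n coordinates of A in S (n+1) is in S n;
    - the elements of S 1 are exactly the finite unions of intervals
      (points being degenerate closed intervals). *)
Record o_minimal (S : forall n : nat, set (set 'rV[R]_n)) : Prop := {
  om_set0 : forall n, S n set0;
  om_setC : forall n A, S n A -> S n (~` A);
  om_setU : forall n A B, S n A -> S n B -> S n (A `|` B);
  om_alg : forall n (p : mpoly.mpoly n R),
    S n [set v : 'rV[R]_n | mpoly.meval (fun i => v 0 i) p = 0];
  om_prodr : forall n A, S n A -> S (n + 1)%N [set v : 'rV[R]_(n + 1) | A (lsubmx v)];
  om_prodl : forall n A, S n A -> S (1 + n)%N [set v : 'rV[R]_(1 + n) | A (rsubmx v)];
  om_proj : forall n A, S (n + 1)%N A ->
    S n [set u : 'rV[R]_n | exists a : 'rV[R]_1, A (row_mx u a)];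
  om_dim1 : forall A, S 1%N A ->
    exists s : seq (interval R), A = [set v : 'rV[R]_1 | exists2 I, I \in s & v 0 0 \in I]
}.

Definition definable (d : nat) (g : 'rV[R]_d -> R) : Prop :=
  exists S, o_minimal S /\
    S (d + 1)%N [set v : 'rV[R]_(d + 1) | g (lsubmx v) = rsubmx v 0 0].

End Defs.

(* Main.v *)
Require Import Defs.
From HB Require Import structures.
From mathcomp Require Import all_boot all_order all_algebra.
From mathcomp Require Import all_classical all_reals all_analysis.
From mathcomp Require Import measurable_realfun.
From mathcomp Require Import ring lra.
From mathcomp Require mpoly.
Import Order.TTheory GRing.Theory Num.Theory.
Import numFieldNormedType.Exports.
Local Open Scope classical_set_scope.
Local Open Scope ring_scope.
Import (canonicals, coercions) mpoly.
Set Implicit Arguments. Unset Strict Implicit. Unset Printing Implicit Defensive.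

(** With [y = x' + beta grad f(x)] the equation becomes the first order system
    [x' = y - beta grad f(x)], [y' = - gamma x' - grad f(x)], whose right-hand
    side is locally Lipschitz, and the energy [f(x) + |y|^2 / 2] decreases at a
    rate at least [(c/4) |x'|^2 + (beta/3) |grad f(x)|^2] because
    [beta gamma <= 2].  This bounds [|x(t) - x(0)|] by an affine function of
    [t]; truncating the gradient outside a ball growing with [t] makes the field
    globally Lipschitz without affecting the solution, so that Picard iteration
    converges on the whole line.  The dissipation also gives the [L^2] bounds
    and, for bounded [x], the limits (Barbalat).

    For definable [f] the length of a bounded trajectory is bounded without a
    Kurdyka-Lojasiewicz function.  On each energy level [l + s], [l] being the
    limit of the energy, let [X(s)] be the lexicographically least minimiser of
    the norm of the energy gradient in a large cube.  The curve [X] is definable,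
    hence its coordinates are monotone near [s = 0] and its variation [V] is
    bounded.  Since the energy changes by [s - s'] between [X(s')] and [X(s)],
    [V] grows at least at rate [1 / (2 |gradient|)], so the sum of [V] at the
    current energy and a multiple of the arclength is nonincreasing in time. *)

(** * Real induction *)

Section RealInduction.
Variable R : realType.
Implicit Types (P Q : R -> Prop) (a b s t u : R) (g : R -> R).

(** The variable [y] is forced by the regularity of [f]: a first order system in (x, x') contains
    the Hessian, which is continuous but perhaps not Lipschitz, whereas [y'] involves the gradient
    alone. The bound beta gamma <= 2 comes from beta C^2 < 2 c <= 2 C.

    Statements (ii)-(iv) concern every solution and not just the constructed one. A solution has
    only one-sided data at 0, so the estimates live on ]0, +oo[ and a separate argument bounds the
    energy near 0.

    Three points carry the length bound. With E the energy and grad E = (grad f(x), y), the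
    dissipation dominates a multiple of (|grad E| + |x'|) |x'|, so the energy drop pays for gradient
    times arclength. The levels just above the limit are nonempty in the cube because the trajectory
    itself crosses them. Finally [X] may jump: its coordinates are shown monotone near 0 without any
    continuity, since a function cannot have at every point of an interval a local extremum of one
    kind that is strict on one fixed side, and the variation [V] counts the jumps too. *)

Definition rgt P a := exists2 dl, 0 < dl & forall s, a < s < a + dl -> P s.
Definition lft P a := exists2 dl, 0 < dl & forall s, a - dl < s < a -> P s.

(** The supremum of the points up to which [P] holds belongs to that set by the left-limit clause,
    and the right-extension clause would go past it unless it equals [b]. No topology is asked of
    [P], which allows comparisons involving discontinuous functions. *)
Lemma real_ind a b P : a <= b -> P a ->
  (forall t, a <= t < b -> (forall u, a <= u <= t -> P u) -> rgt P t) ->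
  (forall t, a < t <= b -> (forall u, a <= u < t -> P u) -> P t) ->
  forall u, a <= u <= b -> P u.
Proof.
move=> ab Pa Pr Pl.
pose A := [set t | a <= t <= b /\ forall u, a <= u <= t -> P u].
have Aa : A a.
  split; first by rewrite lexx.
  by move=> u /le_anti <-.
have ubA : ubound A b by move=> t [/andP[]].
have hA : has_sup A by split; [exists a | exists b].
pose T := sup A.
have aT : a <= T by apply: sup_upper_bound.
have Tb : T <= b by apply: ge_sup => //; exists a.
have lT u : a <= u < T -> P u.
  move=> /andP[au uT]; have [t [_ At] ut] := sup_gt (ex_intro _ a Aa) uT.
  by apply: At; rewrite au ltW.
have PT : P T.
  move: aT; rewrite le_eqVlt => /predU1P[<- //|aT].
  by apply: Pl => //; rewrite aT.
have AT : A T.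
  split; first by rewrite aT.
  move=> u /andP[au]; rewrite le_eqVlt => /predU1P[-> //|uT].
  by apply: lT; rewrite au.
suff e : T = b by move=> u; rewrite -e; apply: AT.2.
apply/eqP; move: Tb; rewrite le_eqVlt => /predU1P[->//|Tb].
have [|dl dl0 hd] := Pr T _ AT.2; first by rewrite aT.
pose t := Num.min b (T + dl / 2).
have Tt : T < t by rewrite lt_min Tb ltrDl divr_gt0.
have /(sup_upper_bound hA) : A t; last by rewrite leNgt Tt.
split; first by rewrite (le_trans aT (ltW Tt)) ge_min lexx.
move=> u /andP[au ut]; have [uT|Tu] := leP u T; first by apply: AT.2; rewrite au.
apply: hd; rewrite Tu /=; move: ut; rewrite le_min => /andP[_ h].
by apply: le_lt_trans h _; rewrite ltrD2l ltr_pdivrMr // ltr_pMr // ltr1n.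
Qed.

Lemma rgtI P Q a : rgt P a -> rgt Q a -> rgt (fun s => P s /\ Q s) a.
Proof.
move=> [d1 d10 h1] [d2 d20 h2]; exists (Num.min d1 d2); first by rewrite lt_min d10.
by move=> s; rewrite -ltrBlDl lt_min => /and3P[a0 a1 a2];
  split; [apply: h1 | apply: h2]; rewrite a0 -ltrBlDl.
Qed.

Lemma locally_nondecreasing a b g :
  (forall s, a < s < b -> rgt (fun u => g s <= g u) s) ->
  (forall s, a < s < b -> lft (fun u => g u <= g s) s) ->
  forall s t, a < s -> s <= t -> t < b -> g s <= g t.
Proof.
move=> hr hl s t as_ st tb.
apply: (@real_ind s t (fun u => g s <= g u)) => //; last by rewrite st lexx.
- move=> u /andP[su ut] hu.
  have [|dl dl0 h] := hr u; first by apply/andP; split; lra.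
  exists dl => // v uv; apply: le_trans (h v uv); apply: hu.
  by rewrite su lexx.
- move=> u /andP[su ut] hu.
  have [|dl dl0 h] := hl u; first by apply/andP; split; lra.
  pose v := Num.max s (u - dl / 2).
  have sv : s <= v by rewrite le_max lexx.
  have vu : v < u by rewrite gt_max su; lra.
  apply: le_trans (h v _); first by apply: hu; rewrite sv.
  by rewrite vu andbT lt_max; apply/orP; right; lra.
Qed.

(** Around each [s] choose an interval with rational end points in which [W s t] holds for every
    other [t]. Two points with the same end points would be related both ways, so ]a, b[ would
    inject into the pairs of rationals, against its positive Lebesgue measure. *)
Lemma not_asym_near a b (W : R -> R -> Prop) : a < b ->
  (forall s t, s < t -> W s t -> W t s -> False) ->
  (forall s, a < s < b -> rgt (W s) s) ->
  (forall s, a < s < b -> lft (W s) s) -> False.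
Proof.
move=> ab hW hr hl.
pose I : set R := [set` `]a, b[%R].
have sep s : exists q : rat * rat, I s ->
    ratr q.1 < s < ratr q.2 /\ forall t, t != s -> ratr q.1 < t < ratr q.2 -> W s t.
  have [Is|nI] := pselect (I s); last by exists (0, 0).
  have Is' : a < s < b by move: Is; rewrite /I /= in_itv.
  have [d1 d10 h1] := hr s Is'; have [d2 d20 h2] := hl s Is'.
  have /rat_in_itvoo[q1] : s - d2 < s by lra.
  rewrite in_itv /= => /andP[q1l q1r].
  have /rat_in_itvoo[q2] : s < s + d1 by lra.
  rewrite in_itv /= => /andP[q2l q2r].
  exists (q1, q2) => _ /=; split; first by rewrite q1r.
  move=> t; rewrite neq_lt => /orP[ts|st] /andP[l r].
    by apply: h2; apply/andP; split => //; lra.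
  by apply: h1; apply/andP; split => //; lra.
have [F hF] := choice sep.
have cI : countable I.
  apply/countable_injP; exists (fun s => pickle (F s)).
  move=> s t; rewrite !inE => Is It /(pcan_inj pickleK) e.
  have [h1 h2] := hF _ Is; have [h3 h4] := hF _ It.
  apply/eqP/negPn/negP => st.
  have w1 : W s t by apply: h2; rewrite 1?eq_sym // e.
  have w2 : W t s by apply: h4; rewrite // -e.
  by move: st; rewrite neq_lt => /orP[|] st; [apply: hW st w1 w2 | apply: hW st w2 w1].
have := countable_lebesgue_measure0 cI.
rewrite lebesgue_measure_itv /= lte_fin ab -EFinB => -[] /eqP.
by rewrite subr_eq0 gt_eqF.
Qed.

End RealInduction.

(** * Functions with continuous partial derivatives *)

Section Differentiation.
Variable R : realType.

Lemma near_normP (V : normedModType R) (u : V) (P : V -> Prop) :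
  (\forall w \near u, P w) <-> (exists2 dl, 0 < dl & forall w, `|w - u| < dl -> P w).
Proof.
split.
  move=> /nbhs_ballP[dl dl0 h]; exists dl => // w hw; apply: h.
  by rewrite -ball_normE /= distrC.
move=> [dl dl0 h]; apply/nbhs_ballP; exists dl => // w.
by rewrite -ball_normE /= distrC; apply: h.
Qed.

Lemma mxnorm_ge_coord m n (v : 'M[R]_(m, n)) i j : `|v i j| <= `|v|.
Proof.
rewrite [leRHS]mx_normrE.
exact: (le_bigmax_cond _ (fun k : 'I_m * 'I_n => `|v k.1 k.2|) (isT : xpredT (i, j))).
Qed.

Lemma mxnorm_le m n (v : 'M[R]_(m, n)) r : 0 <= r ->
  (forall i j, `|v i j| <= r) -> `|v| <= r.
Proof.
by move=> r0 h; rewrite [leLHS]mx_normrE; apply: bigmax_le => // -[i j] _; apply: h.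
Qed.

Lemma mxnorm_lt m n (v : 'M[R]_(m, n)) r : 0 < r ->
  (forall i j, `|v i j| < r) -> `|v| < r.
Proof.
by move=> r0 h; rewrite [ltLHS]mx_normrE; apply: bigmax_lt => // -[i j] _; apply: h.
Qed.

Lemma is_derive_near (g : R -> R) (t l : R) : is_derive t 1 g l <->
  forall eps, 0 < eps -> \forall h \near 0, `|g (t + h) - g t - l * h| <= eps * `|h|.
Proof.
split.
  move=> [dg dgl] eps eps0.
  have : h^-1 *: ((g \o shift t) (h *: 1) - g t) @[h --> 0^'] --> l.
    by rewrite -dgl; apply: dg.
  move=> /cvgrPdist_le /(_ _ eps0); rewrite near_withinE; apply: filterS => h hh.
  have [->|h0] := eqVneq h 0; first by rewrite addr0 subrr mulr0 subrr normr0 mulr0.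
  have := hh h0; rewrite /= /GRing.scale /= mulr1 (addrC h t) => {}hh.
  rewrite -ler_pdivrMr ?normr_gt0 // -normf_div.
  by rewrite (_ : _ / h = - (l - h^-1 * (g (t + h) - g t))) ?normrN //; field.
move=> hg; have hc : h^-1 *: ((g \o shift t) (h *: 1) - g t) @[h --> 0^'] --> l.
  apply/cvgrPdist_le => eps eps0; rewrite near_withinE.
  apply: filterS (hg _ eps0) => h hh h0.
  rewrite /= /GRing.scale /= mulr1 (addrC h t).
  move: hh; rewrite -ler_pdivrMr ?normr_gt0 // -normf_div.
  by rewrite (_ : _ / h = - (l - h^-1 * (g (t + h) - g t))) ?normrN //; field.
by split; [apply: cvgP hc | apply: cvg_lim hc].
Qed.

Lemma is_derive_line d (g : 'rV[R]_d -> R) (v : 'rV[R]_d) i (s : R) : derivable g (v + s *: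
    ebasis R i) (ebasis R i) ->
  is_derive s 1 (fun s => g (v + s *: ebasis R i)) (partial i g (v + s *: ebasis R i)).
Proof.
move=> dg.
have e : (fun h : R => h^-1 *: (((fun s => g (v + s *: ebasis R i)) \o shift s) (h *: 1)
      - g (v + s *: ebasis R i))) =
    (fun h => h^-1 *: ((g \o shift (v + s *: ebasis R i)) (h *: ebasis R i)
      - g (v + s *: ebasis R i))).
  apply/funext => h /=; congr (_ *: (g _ - _)).
  by rewrite -[h *: 1]/(h * 1) mulr1 scalerDl addrCA.
by split; [rewrite /derivable e | rewrite /partial /derive e].
Qed.

Lemma MVT_line d (g : 'rV[R]_d -> R) (v : 'rV[R]_d) i (h : R) : (forall w, derivable g w (ebasis
    R i)) ->
  exists2 th, `|th| <= `|h| & g (v + h *: ebasis R i) - g v = partial i g (v + th *: ebasis R i)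
      * h.
Proof.
move=> dg; pose phi s := g (v + s *: ebasis R i).
have dphi (s : R) : is_derive s 1 phi (partial i g (v + s *: ebasis R i)) by exact: is_derive_line.
have cphi a b : {within `[a, b], continuous phi}.
  by apply: derivable_within_continuous => x _; apply: ex_derive.
have phi0 : phi 0 = g v by rewrite /phi scale0r addr0.
have [h0|h0] := leP 0 h.
  have [th] := MVT_segment h0 (fun x _ => dphi x) (cphi 0 h).
  rewrite in_itv /= phi0 subr0 => /andP[t0 th_] e; exists th => //.
  by rewrite !ger0_norm.
have [th] := MVT_segment (ltW h0) (fun x _ => dphi x) (cphi h 0).
rewrite in_itv /= phi0 sub0r => /andP[t0 th_] e; exists th.
  by rewrite !ler0_norm ?lerN2 // ltW.
by rewrite -/(phi h) -opprB e; ring.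
Qed.

(** Total differentiability from continuous partials: the increment is split along a staircase of
    coordinate segments from [u] to [w], and the mean value theorem applies to each of them. *)
Lemma C1_diff_near d (g : 'rV[R]_d -> R) (u : 'rV[R]_d) :
  (forall i w, derivable g w (ebasis R i)) -> (forall i, continuous (partial i g)) ->
  forall eps, 0 < eps -> \forall w \near u,
    `|g w - g u - \sum_i partial i g u * (w 0 i - u 0 i)| <= eps * \sum_i `|w 0 i - u 0 i|.
Proof.
move=> dg cg eps eps0.
have H : \forall w \near u, forall i, `|partial i g u - partial i g w| <= eps.
  apply: (@filter_forall _ _ (fun i w => `|partial i g u - partial i g w| <= eps) (nbhs u)
      (nbhs_filter u)) => i.
  by have /cvgrPdist_le /(_ _ eps0) := cg i u.
have [dl dl0 hdl] := (near_normP _ _).1 H; apply/near_normP; exists dl => // w wu.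
(* The k-th vertex of the staircase, with the coordinates of index below [k] already moved to
   [w]. *)
pose p (k : nat) : 'rV[R]_d := \row_j (if (j < k)%N then w 0 j else u 0 j).
have pd : p d = w by apply/rowP => j; rewrite mxE ltn_ord.
have p0 : p 0 = u by apply/rowP => j; rewrite mxE.
have pS (k : 'I_d) : p k.+1 = p k + (w 0 k - u 0 k) *: ebasis R k.
  apply/rowP => j; rewrite !mxE eqxx /= ltnS leq_eqVlt.
  have [->|jk] /= := eqVneq j k; first by rewrite eqxx ltnn /= mulr1; ring.
  by rewrite val_eqE (negbTE jk) /= mulr0 addr0.
have -> : g w - g u = \sum_(k < d) (g (p k.+1) - g (p k)).
  by rewrite -(big_mkord xpredT (fun k => g (p k.+1) - g (p k))) telescope_sumr // pd p0.
rewrite -sumrB mulr_sumr; apply: le_trans (ler_norm_sum _ _ _) _.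
apply: ler_sum => k _; rewrite pS.
have [th th1 ->] := MVT_line (p k) (w 0 k - u 0 k) (dg k).
rewrite -mulrBl normrM ler_wpM2r // distrC; apply: hdl.
apply: mxnorm_lt => // i j; rewrite !mxE ord1 /=.
have hj : `|w 0 j - u 0 j| < dl.
  by apply: le_lt_trans wu; have := mxnorm_ge_coord (w - u) 0 j; rewrite !mxE.
have [->|jk] := eqVneq j k.
  rewrite ltnn mulr1 addrAC subrr add0r; apply: le_lt_trans th1 _.
  by apply: le_lt_trans wu; have := mxnorm_ge_coord (w - u) 0 k; rewrite !mxE.
by rewrite mulr0 addr0; case: ifP => // _; rewrite subrr normr0.
Qed.

Lemma is_derive_comp_C1 d (g : 'rV[R]_d -> R) (x : R -> 'rV[R]_d) (v : 'rV[R]_d) (t : R) :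
  (forall i w, derivable g w (ebasis R i)) -> (forall i, continuous (partial i g)) ->
  (forall i, is_derive t 1 (fun s => x s 0 i) (v 0 i)) ->
  is_derive t 1 (fun s => g (x s)) (\sum_i partial i g (x t) * v 0 i).
Proof.
move=> dg cg dx; apply/is_derive_near => eps eps0.
pose A := \sum_i (`|v 0 i| + 1); pose B := \sum_i `|partial i g (x t)|.
have A0 : 0 <= A by apply: sumr_ge0 => i _; rewrite addr_ge0.
have B0 : 0 <= B by apply: sumr_ge0.
pose e1 := eps / 2 / (1 + A); pose e2 := Num.min 1 (eps / 2 / (1 + B)).
(* The remainder of [g] costs [e1 * A] per unit of |h| and the remainders of the curve cost
   [B * e2]; each is made at most [eps / 2]. The cap 1 in [e2] bounds the i-th increment of the
   curve by (|v_i| + 1) |h|, whence the 1 inside [A]. *)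
have e10 : 0 < e1 by rewrite !divr_gt0 //; lra.
have e20 : 0 < e2 by rewrite lt_min ltr01 !divr_gt0 //; lra.
have [dl dl0 hdl] := (near_normP _ _).1 (C1_diff_near (x t) dg cg e10).
have H : \forall h \near 0, forall i, `|x (t + h) 0 i - x t 0 i - v 0 i * h| <= e2 * `|h|.
  apply: (@filter_forall _ _ (fun i h => `|x (t + h) 0 i - x t 0 i - v 0 i * h| <= e2 * `|h|)
      (nbhs (0 : R)) (nbhs_filter _)) => i; exact: (is_derive_near _ _ _).1.
have H2 : \forall h \near (0 : R), A * `|h| < dl.
  have A1 : 0 < 1 + A by lra.
  apply/near_normP; exists (dl / (1 + A)); first by rewrite divr_gt0.
  move=> h; rewrite subr0 ltr_pdivlMr // => hh; apply: le_lt_trans hh.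
  by rewrite mulrC ler_wpM2l //; lra.
near=> h.
have h1 : forall i, `|x (t + h) 0 i - x t 0 i - v 0 i * h| <= e2 * `|h| by near: h.
have h2 : A * `|h| < dl by near: h.
have e21 : e2 <= 1 by rewrite ge_min lexx.
have h3 i : `|x (t + h) 0 i - x t 0 i| <= (`|v 0 i| + 1) * `|h|.
  rewrite -(subrK (v 0 i * h) (_ - _)); apply: le_trans (ler_normD _ _) _.
  rewrite normrM mulrDl addrC lerD2l mul1r; apply: le_trans (h1 i) _.
  by rewrite ler_piMl.
have h4 : `|x (t + h) - x t| < dl.
  apply: mxnorm_lt => // i j; rewrite !mxE ord1; apply: le_lt_trans h2.
  apply: le_trans (h3 j) _; rewrite ler_wpM2r // /A (bigD1 j) //= lerDl.
  by apply: sumr_ge0 => k _; rewrite addr_ge0.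
have := hdl _ h4.
set D := \sum_i _ => hD.
rewrite (_ : g (x (t + h)) - g (x t) - _ = (g (x (t + h)) - g (x t) - D) +
  \sum_i partial i g (x t) * (x (t + h) 0 i - x t 0 i - v 0 i * h)); last first.
  rewrite mulr_suml -[RHS]addrA; congr (_ + _).
  rewrite /D -!sumrN -big_split /=; apply: eq_bigr => i _; ring.
apply: le_trans (ler_normD _ _) _.
have b1 : e1 * (\sum_i `|x (t + h) 0 i - x t 0 i|) <= eps / 2 * `|h|.
  apply: (@le_trans _ _ (e1 * (A * `|h|))).
    by rewrite ler_wpM2l ?(ltW e10) // /A mulr_suml; apply: ler_sum => i _; apply: h3.
  rewrite mulrA ler_wpM2r // /e1 -mulrA ler_piMr ?ltW ?divr_gt0 //.
  by rewrite mulrC ltr_pdivrMr; lra.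
have b2 : `|\sum_i partial i g (x t) * (x (t + h) 0 i - x t 0 i - v 0 i * h)| <= eps / 2 * `|h|.
  apply: le_trans (ler_norm_sum _ _ _) _.
  apply: (@le_trans _ _ (B * (e2 * `|h|))).
    by rewrite /B mulr_suml; apply: ler_sum => i _; rewrite normrM ler_wpM2l.
  rewrite mulrA ler_wpM2r //.
  apply: (@le_trans _ _ (B * (eps / 2 / (1 + B)))).
    by rewrite ler_wpM2l // ge_min lexx orbT.
  rewrite mulrCA ler_piMr ?divr_ge0 ?ltW //.
  by rewrite ltr_pdivrMr; lra.
lra.
Unshelve. all: by end_near.
Qed.

End Differentiation.

(** * Primitives, integrability and Barbalat's lemma *)

Section RealFunctions.
Variable R : realType.
Implicit Types (u w g h H E : R -> R).

Lemma is_derive_cts g (t l : R) : is_derive t 1 g l -> {for t, continuous g}.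
Proof.
by move=> [dg _]; apply/differentiable_continuous/derivable1_diffP.
Qed.

Lemma MVT_simple g (dg : R -> R) (a b : R) : a <= b ->
  (forall t : R, a <= t <= b -> is_derive t 1 g (dg t)) ->
  exists2 c, a <= c <= b & g b - g a = dg c * (b - a).
Proof.
move=> ab hg.
have [||c] := @MVT_segment R g dg a b ab.
- by move=> c; rewrite in_itv /= => /andP[? ?]; apply: hg; rewrite !ltW.
- apply: derivable_within_continuous => t; rewrite in_itv /= => tab.
  by apply: (@ex_derive _ _ _ _ _ _ (dg t)); apply: hg.
- by move=> cab e; exists c => //; move: cab; rewrite in_itv.
Qed.

Lemma derive_le0_nonincr g (dg : R -> R) (a b : R) : a <= b ->
  (forall t : R, a <= t <= b -> is_derive t 1 g (dg t)) ->
  (forall t : R, a <= t <= b -> dg t <= 0) -> g b <= g a.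
Proof.
move=> ab hg hle; have [c cab e] := MVT_simple ab hg.
by rewrite -subr_le0 e mulr_le0_ge0 ?subr_ge0 ?hle.
Qed.

Lemma cvg_pinftyP_norm (V : normedModType R) (f : R -> V) (l : V) :
  f t @[t --> +oo] --> l <->
  forall eps, 0 < eps -> exists T : R, forall t : R, T < t -> `|f t - l| <= eps.
Proof.
split.
  move=> /cvgrPdist_le h eps eps0; have [T [_ hT]] := h _ eps0.
  by exists T => t /hT; rewrite distrC.
move=> h; apply/cvgrPdist_le => eps eps0; have [T hT] := h _ eps0.
by exists T; split => [|t /hT]; rewrite ?num_real // distrC.
Qed.

Lemma cvg_mx_pinfty n (f : R -> 'rV[R]_n) (l : 'rV[R]_n) :
  (forall i, f t 0 i @[t --> +oo] --> l 0 i) -> f t @[t --> +oo] --> l.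
Proof.
move=> h; apply/cvgrPdist_le => eps eps0.
have H : \forall t \near +oo, forall i, `|l 0 i - f t 0 i| <= eps.
  apply: (@filter_forall _ _ (fun i t => `|l 0 i - f t 0 i| <= eps) (+oo : set_system R)) => i.
  by have /cvgrPdist_le /(_ _ eps0) := h i.
apply: filterS H => t ht; apply: mxnorm_le; first exact: ltW.
by move=> i j; rewrite !mxE ord1.
Qed.

Lemma nonincr_inf E m : (forall s t, 0 < s -> s <= t -> E t <= E s) ->
  (forall t : R, 0 < t -> m <= E t) ->
  exists l, (forall t : R, 0 < t -> l <= E t) /\
    forall eps, 0 < eps -> exists2 T, 0 < T & forall t : R, T <= t -> E t < l + eps.
Proof.
move=> hE hm; pose A := [set y | exists2 t, 0 < t & y = E t].
have A0 : A !=set0 by exists (E 1), 1.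
have Am : has_inf A by split => //; exists m => _ [t t0 ->]; apply: hm.
exists (inf A); split.
  by move=> t t0; apply: ge_inf Am.2 _ _; exists t.
move=> eps eps0; have [_ [T T0 ->] hT] := inf_adherent eps0 Am.
exists T => // t Tt; exact: le_lt_trans (hE _ _ T0 Tt) hT.
Qed.

(* Barbalat's lemma, the integrability of u^2 being witnessed by a bounded
   Lyapunov function E. *)
Lemma barbalat u (du : R -> R) E (dE : R -> R) (K k m : R) : 0 < k ->
  (forall t : R, 0 < t -> is_derive t 1 u (du t)) ->
  (forall t : R, 0 < t -> `|du t| <= K) ->
  (forall t : R, 0 < t -> is_derive t 1 E (dE t)) ->
  (forall t : R, 0 < t -> dE t <= - k * u t ^+ 2) ->
  (forall t : R, 0 < t -> m <= E t) ->
  u t @[t --> +oo] --> (0 : R).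
Proof.
move=> k0 hu hK hE hdE hm.
have hE' s t : 0 < s -> s <= t -> E t <= E s.
  move=> s0 st; apply: (@derive_le0_nonincr E dE) => // r /andP[sr rt].
    by apply: hE; lra.
  by have := hdE r; have := sqr_ge0 (u r); nra.
have [l [hl hT]] := nonincr_inf hE' hm.
apply/cvg_pinftyP_norm => eps eps0.
have K0 : 0 < `|K| + 1 by have := normr_ge0 K; lra.
(* Over a time [dl] the function [u] moves by at most eps / 2. If |u t| > eps, then |u| >= eps / 2
   on [t, t + dl] and [E] drops there by at least k (eps / 2)^2 dl, although past [T] it exceeds its
   infimum by less. *)
pose dl := eps / (2 * (`|K| + 1)).
have dl0 : 0 < dl by rewrite divr_gt0 // mulr_gt0.
have q0 : 0 < k * (eps / 2) ^+ 2 * dl.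
  by rewrite mulr_gt0 // mulr_gt0 // exprn_gt0 // divr_gt0.
have [T T0 hTt] := hT _ q0; exists T => t Tt; rewrite subr0.
rewrite leNgt; apply/negP => ut.
have t0 : 0 < t by lra.
have hge s : t <= s <= t + dl -> (eps / 2) ^+ 2 <= u s ^+ 2.
  move=> /andP[ts sd].
  have [|c /andP[c1 c2] e] := @MVT_simple u du t s ts.
    by move=> r /andP[r1 r2]; apply: hu; lra.
  have cK : `|du c| <= `|K| + 1.
    by apply: le_trans (hK c _) _; [lra | have := ler_norm K; lra].
  have : `|u s - u t| <= eps / 2.
    rewrite e normrM; apply: (@le_trans _ _ ((`|K| + 1) * dl)).
      by apply: ler_pM => //; rewrite ger0_norm; lra.
    by rewrite /dl; have -> : (`|K| + 1) * (eps / (2 * (`|K| + 1))) = eps / 2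
      by field; lra.
  move=> d; rewrite -[leRHS]real_normK ?num_real // ler_pXn2r ?nnegrE //; last lra.
  have := ler_normB (u t - u s) (- u s); rewrite opprK subrK distrC normrN; lra.
have [||c hc e] := @MVT_simple E dE t (t + dl); first lra.
  by move=> r /andP[r1 r2]; apply: hE; lra.
have c0 : 0 < c by lra.
have h1 := hdE c c0; have h2 := hge c hc.
have h3 : dE c <= - (k * (eps / 2) ^+ 2) by nra.
have h4 : E (t + dl) - E t <= - (k * (eps / 2) ^+ 2 * dl).
  by rewrite e (addrAC t) subrr add0r -mulNr ler_wpM2r // ltW.
have h5 := hTt t (ltW Tt); have h6 := hl (t + dl); lra.
Qed.

(** The integrals of [k] over compact subintervals of ]0, +oo[ are at most those of [h], hence at
    most 2 M. Nothing is asked at 0: monotone convergence along an exhaustion of ]0, +oo[ does the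
    rest, the end point being a null set. *)
Lemma integrable_of_primitive k h H (M : R) :
  (forall t : R, 0 < t -> 0 <= k t <= h t) ->
  (forall t : R, 0 < t -> {for t, continuous k}) ->
  (forall t : R, 0 < t -> {for t, continuous h}) ->
  (forall t : R, 0 < t -> is_derive t 1 H (h t)) -> (forall t : R, 0 < t -> `|H t| <= M) ->
  (@lebesgue_measure R).-integrable `[0, +oo[ (EFin \o k).
Proof.
move=> kh ck ch dH HM.
have k0 (t : R) : 0 < t -> 0 <= k t by move=> /kh /andP[].
have mog (g : R -> R) : (forall t : R, 0 < t -> {for t, continuous g}) ->
    measurable_fun [set` `](0 : R), +oo[%R] g.
  move=> cg; apply: open_continuous_measurable_fun; first exact: interval_open.
  by move=> t; rewrite inE /= in_itv /= andbT => /cg.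
have mo := mog _ ck.
have mc : measurable_fun [set` `[(0 : R), +oo[%R] k by apply/measurable_fun_itv_obnd_cbndP.
apply/integrableP; split; first exact/measurable_EFinP.
have -> : (\int[lebesgue_measure]_(t in `[0%R, +oo[) `|(EFin \o k) t| =
    \int[lebesgue_measure]_(t in `]0%R, +oo[) (k t)%:E)%E.
  rewrite -integral_itv_obnd_cbnd; last by apply/measurableT_comp/measurable_EFinP.
  by apply: eq_integral => t; rewrite inE /= in_itv /= andbT => /k0 ht; rewrite ger0_norm.
(* The right end n + 2 keeps the interval nondegenerate for n = 0 as well, where the left end is
   1. *)
pose F (n : nat) : set R := [set` `[(n.+1%:R)^-1, n.+2%:R]%R].
have Fp n : 0 < (n.+1%:R)^-1 :> R by rewrite invr_gt0.
have Fl n : (n.+1%:R)^-1 < n.+2%:R :> R.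
  apply: (@le_lt_trans _ _ 1); first by rewrite invf_le1 // ler1n.
  by rewrite ltr1n.
have FU : \bigcup_n F n = `]0, +oo[%classic.
  apply/seteqP; split => t /=.
    by case=> n _; rewrite /F /= !in_itv /= andbT => /andP[+ _]; apply: lt_le_trans.
  rewrite in_itv /= andbT => t0.
  have [n hn] : exists n : nat, t + t^-1 < n%:R.
    by exists (Num.bound (t + t^-1)); rewrite archi_boundP // addr_ge0 // ?invr_ge0 ltW.
  exists n => //; rewrite /F /= in_itv /=.
  have ti : 0 < t^-1 by rewrite invr_gt0.
  have n1 : n%:R <= n.+1%:R :> R by rewrite ler_nat.
  have n2 : n%:R <= n.+2%:R :> R by rewrite ler_nat leqW.
  apply/andP; split; last lra.
  by rewrite -[leRHS]invrK lef_pV2 ?posrE //; lra.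
have Fh n : F n `<=` `]0, +oo[.
  by move=> t /= Ft; have : (\bigcup_n F n) t by [exists n]; rewrite FU.
have cvg := @ge0_nondecreasing_set_cvg_integral _ (measurableTypeR R) R F (EFin \o k)
    lebesgue_measure.
have {}cvg : ((\int[lebesgue_measure]_(x in F i) (EFin \o k) x)%E @[i --> \oo] -->
    (\int[lebesgue_measure]_(x in \bigcup_i F i) (EFin \o k) x)%E).
  apply: cvg.
  - move=> n m nm; apply/subsetPset => t; rewrite /F /= !in_itv /= => /andP[h1 h2].
    apply/andP; split.
      by apply: le_trans h1; rewrite lef_pV2 ?posrE // ler_nat.
    by apply: le_trans h2 _; rewrite ler_nat.
  - by move=> n; apply: measurable_itv.
  - move=> n; apply: measurable_funS (Fh n) _ => //; exact/measurable_EFinP.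
  - by move=> n t /Fh; rewrite /= in_itv /= andbT lee_fin => /k0.
rewrite -FU -(cvg_lim _ cvg) //.
apply: (@le_lt_trans _ _ (M + M)%:E); last exact: ltry.
apply: lime_le; first by apply/cvg_ex; eexists; exact: cvg.
near=> n.
have Fnp (t : R) : (n.+1%:R)^-1 <= t -> 0 < t by apply: lt_le_trans.
have mS (g : R -> R) : (forall t : R, 0 < t -> {for t, continuous g}) ->
    measurable_fun (F n) (EFin \o g).
  move=> /mog mg; apply: measurable_funS (Fh n) _ => //; exact/measurable_EFinP.
apply: (@le_trans _ _ (\int[lebesgue_measure]_(t in F n) (h t)%:E)%E).
  apply: ge0_le_integral => //; last 3 first.
  - exact: mS ck.
  - exact: mS ch.
  - by move=> t /Fh; rewrite /= in_itv /= andbT => /kh /andP[_]; rewrite lee_fin.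
  - exact: measurable_itv.
  - by move=> t /Fh; rewrite /= in_itv /= andbT => /k0; rewrite lee_fin.
rewrite (@continuous_FTC2 _ h H) //.
- rewrite -EFinB lee_fin.
  have := HM _ (Fnp _ (lexx _)); have := HM _ (Fnp _ (ltW (Fl n))).
  by rewrite !ler_norml; lra.
- apply: continuous_in_subspaceT => t; rewrite inE /= in_itv /= => /andP[ht _].
  exact: ch (Fnp _ ht).
- split.
  + move=> t; rewrite in_itv /= => /andP[/ltW /Fnp /dH ht _].
    exact: (@ex_derive _ _ _ _ _ _ (h t)).
  + by apply: cvg_at_right_filter; apply: is_derive_cts (dH _ (Fp n)).
  + by apply: cvg_at_left_filter; apply: is_derive_cts (dH _ (Fnp _ (ltW (Fl n)))).
- move=> t; rewrite in_itv /= => /andP[/ltW /Fnp /dH ht _].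
  by rewrite derive1E; apply: derive_val.
Unshelve. all: by end_near.
Qed.

Lemma primitive_from h (a : R) : continuous h ->
  exists H, forall t : R, a < t -> is_derive t 1 H (h t).
Proof.
move=> ch; exists (fun x => (\int[lebesgue_measure]_(t in [set` `[a, x]]) (h t))%R).
move=> t at_.
have [||d e] := @continuous_FTC1_closed R h a t (t + 1) _ _ at_ (ch t).
- by rewrite ltrDl.
- apply: continuous_compact_integrable; first exact: segment_compact.
  exact: continuous_subspaceT.
- by split => //; rewrite -derive1E.
Qed.

(** A primitive based at -1 covers the right half line, and the mirror image of another covers the
    left one. They differ by a constant on ]-1, 1[, so they can be glued at 0. Working on the whole
    line avoids one-sided derivatives at 0. *)
Lemma primitive_exists h : continuous h ->
  exists H, H 0 = 0 /\ forall t : R, is_derive t 1 H (h t).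
Proof.
move=> ch.
have [F hF] := primitive_from (-1) ch.
have ch' : continuous (fun t => h (- t)).
  by move=> t; apply: continuous_comp; [apply: opp_continuous | apply: ch].
have [G' hG'] := primitive_from (-1) ch'.
pose G t := - G' (- t).
have hG (t : R) : t < 1 -> is_derive t 1 G (h t).
  move=> t1; have tN : -1 < - t by lra.
  have d1 := hG' _ tN; rewrite opprK in d1.
  have := is_deriveN (is_derive1_comp d1 (is_deriveNid t 1)).
  by rewrite mulrN1 opprK.
pose k := F 0 - G 0.
have FG t : -1 < t -> t < 1 -> F t = G t + k.
  move=> t0 t1.
  have hFG (s : R) : -1 < s < 1 -> is_derive s 1 (fun r => F r - G r) 0.
    move=> /andP[s0 s1]; have := is_deriveB (hF s s0) (hG s s1).
    by rewrite subrr.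
  have [t00|t00] := leP 0 t.
    have [|c hc] := @MVT_simple (fun r => F r - G r) (fun=> 0) 0 t t00.
      by move=> s /andP[? ?]; apply: hFG; apply/andP; split; lra.
    by rewrite mul0r /k; lra.
  have [|c hc] := @MVT_simple (fun r => F r - G r) (fun=> 0) t 0 (ltW t00).
    by move=> s /andP[? ?]; apply: hFG; apply/andP; split; lra.
  by rewrite mul0r /k; lra.
pose H t := (if 0 < t then F t else G t + k) - F 0.
exists H; split; first by rewrite /H ltxx /k; ring.
move=> t.
have [t0|t0] := ltP (-1) t.
  have := is_deriveB (hF t t0) (is_derive_cst (F 0) t 1).
  rewrite subr0; apply: near_eq_is_derive.
  apply/near_normP; exists (t + 1); first lra.
  move=> s hs; rewrite /H; case: ifP => //= /negbT; rewrite -leNgt => s0.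
  have s1 : -1 < s by move: hs; rewrite ltr_norml; lra.
  have s2 : s < 1 by lra.
  by rewrite -(FG s).
have t1 : t < 1 by lra.
have := is_deriveB (hG t t1) (is_derive_cst (F 0 - k) t 1).
rewrite subr0; apply: near_eq_is_derive.
apply/near_normP; exists 1 => // s hs; rewrite /H ifF /=.
  by rewrite -[LHS]/(G s - (F 0 - k)); ring.
by apply/negbTE; rewrite -leNgt; move: hs; rewrite ltr_norml; lra.
Qed.

End RealFunctions.

(** * The Picard iteration *)

Section Picard.
Variable R : realType.

Lemma continuous_normP (U V : normedModType R) (f : U -> V) (u : U) :
  {for u, continuous f} <-> forall eps, 0 < eps ->
    exists2 dl, 0 < dl & forall w, `|w - u| < dl -> `|f w - f u| <= eps.
Proof.
split.
  move=> /cvgrPdist_le h eps eps0; have [dl dl0 hd] := (near_normP _ _).1 (h _ eps0).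
  by exists dl => // w /hd; rewrite distrC.
move=> h; apply/cvgrPdist_le => eps eps0; have [dl dl0 hd] := h _ eps0.
by apply/near_normP; exists dl => // w /hd; rewrite distrC.
Qed.

Lemma continuous_rV (U : normedModType R) n (f : U -> 'rV[R]_n) (u : U) :
  (forall i, {for u, continuous (fun w => f w 0 i)}) -> {for u, continuous f}.
Proof.
move=> h; apply/cvgrPdist_le => eps eps0.
have H : \forall t \near u, forall i, `|f u 0 i - f t 0 i| <= eps.
  apply: (@filter_forall _ _ (fun i t => `|f u 0 i - f t 0 i| <= eps) (nbhs u) (nbhs_filter u))
      => i.
  by have /cvgrPdist_le /(_ _ eps0) := h i.
apply: filterS H => t ht; apply: mxnorm_le; first exact: ltW.
by move=> i j; rewrite !mxE ord1.
Qed.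

Lemma continuous_coord (U : normedModType R) n (f : U -> 'rV[R]_n) (u : U) i :
  {for u, continuous f} -> {for u, continuous (fun w => f w 0 i)}.
Proof.
move=> cf; apply: (@continuous_comp _ _ _ f (fun v : 'rV[R]_n => v 0 i) u cf).
exact: coord_continuous.
Qed.

Lemma continuous_sum_for (U : normedModType R) n (F : 'I_n -> U -> R) (u : U) :
  (forall i, {for u, continuous (F i)}) -> {for u, continuous (fun w => \sum_i F i w)}.
Proof.
move=> h; elim: (index_enum _) => [|i r IH].
  rewrite (_ : (fun w => _) = fun=> 0 : R); first exact: cst_continuous.
  by apply/funext => w; rewrite big_nil.
rewrite (_ : (fun w => _) = fun w => F i w + \sum_(j <- r) F j w).
  exact: continuousD.
by apply/funext => w; rewrite big_cons.
Qed.

Lemma half_powers_lt (c eps : R) : 0 < eps -> exists n : nat, c / 2 ^+ n < eps.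
Proof.
move=> eps0; exists (Num.bound (`|c| / eps)).
have := archi_boundP (_ : 0 <= `|c| / eps); set N := Num.bound _ => h.
have {}h : `|c| / eps < N%:R by apply: h; rewrite divr_ge0 // ltW.
rewrite ltr_pdivrMr ?exprn_gt0 //; apply: le_lt_trans (ler_norm c) _.
move: h; rewrite ltr_pdivrMr // mulrC => h; apply: lt_le_trans h _.
by rewrite ler_pM2l // -natrX ler_nat ltnW // ltn_expl.
Qed.

Lemma half_powers_cauchy (s : nat -> R) B :
  (forall n, `|s n.+1 - s n| <= B / 2 ^+ n) ->
  exists l, forall n, `|s n - l| <= 2 * B / 2 ^+ n.
Proof.
move=> hs.
have p2 (n : nat) : 0 < 2 ^+ n :> R by rewrite exprn_gt0.
(* The subtracted tail is what makes the induction on [m] close: one more increment exactly consumes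
   the change of the tail. *)
have hc n m : `|s (n + m)%N - s n| <= 2 * B / 2 ^+ n - 2 * B / 2 ^+ (n + m).
  elim: m => [|m IH]; first by rewrite addn0 !subrr normr0.
  rewrite addnS -(subrK (s (n + m)%N) (s (n + m).+1)) -addrA.
  apply: le_trans (ler_normD _ _) _; apply: le_trans (lerD (hs _) IH) _.
  rewrite [X in _ <= _ - X](_ : _ = B / 2 ^+ (n + m)); last first.
    by rewrite exprS; field; rewrite gt_eqF.
  rewrite [X in _ + (_ - X) <= _](_ : _ = B / 2 ^+ (n + m) + B / 2 ^+ (n + m)); first lra.
  by field; rewrite gt_eqF.
have B0 : 0 <= B.
  by have := le_trans (normr_ge0 _) (hs 0%N); rewrite expr0 divr1.
have hc' n m : `|s (n + m)%N - s n| <= 2 * B / 2 ^+ n.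
  apply: le_trans (hc n m) _; rewrite gerBl divr_ge0 ?mulr_ge0 //.
have : cvg (s @ \oo).
  apply/cauchy_cvgP/cauchy_exP => eps eps0.
  have [n hn] := half_powers_lt (2 * B) eps0.
  exists (s n); exists n => // m /= nm; rewrite -ball_normE /= distrC.
  by rewrite -(subnKC nm); apply: le_lt_trans (hc' _ _) hn.
move=> /cvg_ex[l hl]; exists l => n.
rewrite leNgt; apply/negP; set c := 2 * B / 2 ^+ n => h.
have e0 : 0 < `|s n - l| - c by rewrite subr_gt0.
have /cvgrPdist_lt /(_ _ e0)[N _ hN] := hl.
have := hN (n + N)%N (leq_addl _ _) => /= hN1.
have := ler_normD (s n - s (n + N)%N) (s (n + N)%N - l).
rewrite addrA subrK (distrC (s n) (s _)) (distrC (s (n + N)%N) l).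
by have := hc' n N; rewrite -/c; lra.
Qed.

(** This is the estimate behind Bielecki's weighted norm: integrating [K] times the weight e^(2Kt)
    gains a factor 1/2, so Picard's map contracts by 1/2 on every bounded interval, however long. It
    follows from the sign of the derivative of [u] or [- u] minus the bound. *)
Lemma exp_growth0 (u du : R -> R) (A K T : R) : 0 <= A -> 0 < K -> u 0 = 0 ->
  (forall t, 0 <= t <= T -> is_derive t 1 u (du t)) ->
  (forall t, 0 <= t <= T -> `|du t| <= A * K * expR (2 * K * t)) ->
  forall t, 0 <= t <= T -> `|u t| <= A / 2 * expR (2 * K * t).
Proof.
move=> A0 K0 u0 hu hdu t /andP[t0 tT].
have key (sg : R) : sg = 1 \/ sg = -1 -> sg * u t - A / 2 * expR (2 * K * t) <= 0.
  move=> hsg.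
  pose g s := sg * u s - A / 2 * expR (2 * K * s).
  pose dg s := sg * du s - A / 2 * (expR (2 * K * s) * (2 * K)).
  have dexp (s : R) : is_derive s 1 (fun r => expR (2 * K * r)) (expR (2 * K * s) * (2 * K)).
    have d1 : is_derive s 1 (fun r : R => (2 * K) *: r) ((2 * K) *: 1).
      exact: is_deriveZ.
    have := is_derive1_comp (is_derive_expR (2 * K * s)) d1.
    by rewrite [_ *: 1]mulr1.
  have : g t <= g 0.
    apply: (@derive_le0_nonincr _ g dg) => // s /andP[s0 st].
      have hs : 0 <= s <= T by apply/andP; split; lra.
      have d1 := is_deriveZ sg (hu s hs).
      have d2 := is_deriveZ (A / 2) (dexp s).
      exact: is_deriveB d1 d2.
    have hs : 0 <= s <= T by apply/andP; split; lra.
    rewrite /dg; have := hdu s hs; rewrite ler_norml.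
    case: hsg => ->; rewrite ?mul1r ?mulN1r; nra.
  rewrite /g u0 mulr0 mulr0 expR0; lra.
have h1 := key 1 (or_introl erefl); have h2 := key (-1) (or_intror erefl).
rewrite ler_norml; apply/andP; split; lra.
Qed.

Lemma exp_growth (u du : R -> R) (A K T : R) : 0 <= A -> 0 < K -> u 0 = 0 ->
  (forall t : R, is_derive t 1 u (du t)) ->
  (forall t, `|t| <= T -> `|du t| <= A * K * expR (2 * K * `|t|)) ->
  forall t, `|t| <= T -> `|u t| <= A / 2 * expR (2 * K * `|t|).
Proof.
move=> A0 K0 u0 hu hdu t tT.
have [t0|t0] := leP 0 t.
  rewrite (ger0_norm t0); rewrite (ger0_norm t0) in tT.
  apply: (@exp_growth0 u du A K T) => //; last by rewrite t0.
  by move=> s /andP[s0 sT]; have := hdu s; rewrite ger0_norm //; apply.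
rewrite (ltr0_norm t0); rewrite (ltr0_norm t0) in tT.
have := @exp_growth0 (fun s => u (- s)) (fun s => - du (- s)) A K T A0 K0.
rewrite oppr0 => /(_ u0 _ _ (- t)); rewrite opprK; apply; last by apply/andP; split; lra.
  move=> s _; have := is_derive1_comp (hu (- s)) (is_deriveNid s 1).
  by rewrite mulrN1.
move=> s /andP[s0 sT]; have := hdu (- s); rewrite !normrN ger0_norm //; exact.
Qed.

Lemma primitive_rV n (h : R -> 'rV[R]_n) : continuous h ->
  exists H : R -> 'rV[R]_n, H 0 = 0 /\
    forall (t : R) i, is_derive t 1 (fun s => H s 0 i) (h t 0 i).
Proof.
move=> ch.
have hi i : exists H, H 0 = 0 /\ forall t : R, is_derive t 1 H (h t 0 i).
  apply: primitive_exists => t.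
  exact: continuous_coord (ch t).
have [F hF] := choice hi.
exists (fun t => \row_i F i t); split.
  by apply/rowP => i; rewrite !mxE (hF i).1.
move=> t i; rewrite (_ : (fun s => _) = F i); first exact: (hF i).2.
by apply/funext => s; rewrite mxE.
Qed.

Variables (n : nat) (F : R -> 'rV[R]_n -> 'rV[R]_n) (z0 : 'rV[R]_n).
Hypothesis Fcts : forall z : R -> 'rV[R]_n, continuous z -> continuous (fun t => F t (z t)).
Hypothesis Flip : forall T : R, exists2 K, 0 < K &
  forall t u w, `|t| <= T -> `|F t u - F t w| <= K * `|u - w|.

Definition picard_spec (z w : R -> 'rV[R]_n) := w 0 = z0 /\
  forall (t : R) i, is_derive t 1 (fun s => w s 0 i) (F t (z t) 0 i).

Lemma picard_spec_ex z : continuous z -> exists w, picard_spec z w.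
Proof.
move=> cz; have [H [H0 hH]] := primitive_rV (Fcts cz).
exists (fun t => z0 + H t); split; first by rewrite H0 addr0.
move=> t i; have := is_deriveD (is_derive_cst (z0 0 i) t 1) (hH t i).
rewrite add0r; congr (is_derive _ _ _ _).
by apply/funext => s; rewrite !mxE.
Qed.

(** Picard's integral operator, taken as some curve with the required derivative and initial value.
    The default 0 is never met for a continuous [z], by [picard_spec_ex]. *)
Definition picard_step (z : R -> 'rV[R]_n) : R -> 'rV[R]_n :=
  xget (fun=> 0) [set w | picard_spec z w].

Lemma picard_stepP z : continuous z -> picard_spec z (picard_step z).
Proof. by move=> cz; have [w hw] := picard_spec_ex cz; apply: (@xgetPex _ _ [set w | picard_spec
    z w]); exists w. Qed.

Lemma picard_step_cts z : continuous z -> continuous (picard_step z).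
Proof.
move=> cz t; apply: continuous_rV => i.
exact: is_derive_cts ((picard_stepP cz).2 t i).
Qed.

Lemma picard_step_contract (T K : R) (z w : R -> 'rV[R]_n) (A : R) : 0 < K -> 0 <= A ->
  (forall t u w, `|t| <= T -> `|F t u - F t w| <= K * `|u - w|) ->
  continuous z -> continuous w ->
  (forall t, `|t| <= T -> `|z t - w t| <= A * expR (2 * K * `|t|)) ->
  forall t, `|t| <= T -> `|picard_step z t - picard_step w t| <= A / 2 * expR (2 * K * `|t|).
Proof.
move=> K0 A0 hK cz cw hzw t tT.
have [z1 z2] := picard_stepP cz; have [w1 w2] := picard_stepP cw.
apply: mxnorm_le => [|i j]; first by rewrite mulr_ge0 ?expR_ge0 // divr_ge0.
rewrite ord1 !mxE {i}.
apply: (@exp_growth (fun s => picard_step z s 0 j - picard_step w s 0 j)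
  (fun s => F s (z s) 0 j - F s (w s) 0 j) A K T) => //.
- by rewrite z1 w1 subrr.
- move=> s sT; apply: le_trans (_ : `|F s (z s) - F s (w s)| <= _).
    by have := mxnorm_ge_coord (F s (z s) - F s (w s)) 0 j; rewrite !mxE.
  apply: le_trans (hK _ _ _ sT) _.
  by rewrite [leRHS](_ : _ = K * (A * expR (2 * K * `|s|))) ?ler_wpM2l ?hzw //; [exact: ltW | ring].
Qed.

Fixpoint picard_seq (k : nat) : R -> 'rV[R]_n :=
  if k is k'.+1 then picard_step (picard_seq k') else fun=> z0.

Lemma picard_seq_cts k : continuous (picard_seq k).
Proof.
by elim: k => [|k IH]; [move=> t; apply: cst_continuous | apply: picard_step_cts].
Qed.

Lemma picard_seq_bound (T : R) : exists2 B, 0 <= B & forall k t, `|t| <= T ->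
  `|picard_seq k.+1 t - picard_seq k t| <= B / 2 ^+ k.
Proof.
have [T0|T0] := leP 0 T; last first.
  by exists 0 => // k t tT; have := normr_ge0 t; lra.
have [K K0 hK] := Flip T.
pose q (t : R) := `|picard_seq 1 t - picard_seq 0 t|.
have cq : continuous q.
  move=> t; apply: (@continuous_comp _ _ _ (fun t => picard_seq 1 t - picard_seq 0 t) Num.norm).
    by apply: continuousB; apply: (@picard_seq_cts).
  exact: norm_continuous.
have [|c _ hc] := @EVT_max R q (- T) T _ (continuous_subspaceT cq); first lra.
have q0 : 0 <= q c by apply: normr_ge0.
exists (q c * expR (2 * K * T)); first by rewrite mulr_ge0 // expR_ge0.
have main k : forall t, `|t| <= T ->
    `|picard_seq k.+1 t - picard_seq k t| <= q c / 2 ^+ k * expR (2 * K * `|t|).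
  elim: k => [|k IH] t tT.
    rewrite expr0 divr1; apply: (@le_trans _ _ (q c)).
      by apply: hc; rewrite in_itv /=; move: tT; rewrite ler_norml.
    rewrite ler_peMr // -expR0 ler_expR mulr_ge0 // mulr_ge0 //; exact: ltW.
  have := picard_step_contract K0 _ hK (@picard_seq_cts k.+1) (@picard_seq_cts k) IH tT.
  rewrite (_ : q c / 2 ^+ k / 2 = q c / 2 ^+ k.+1); last first.
    by rewrite exprS; field; rewrite gt_eqF // exprn_gt0.
  by apply; rewrite divr_ge0 // exprn_ge0.
move=> k t tT; apply: le_trans (main k t tT) _.
rewrite mulrAC ler_wpM2r ?invr_ge0 ?exprn_ge0 // ler_wpM2l // ler_expR.
by rewrite ler_wpM2l // mulr_ge0 // ltW.
Qed.

(** The increments decay geometrically with a constant uniform on |t| <= T, so the pointwise limit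
    is continuous; [picard_step] can then be applied to it, and the contraction shows that it is a
    fixed point. *)
Theorem picard_global : exists z : R -> 'rV[R]_n, z 0 = z0 /\
  forall (t : R) i, is_derive t 1 (fun s => z s 0 i) (F t (z t) 0 i).
Proof.
have lim1 t : exists l : 'rV[R]_n, forall i, exists B, forall k,
    `|picard_seq k t 0 i - l 0 i| <= B / 2 ^+ k.
  have hi i : exists l, exists B, forall k, `|picard_seq k t 0 i - l| <= B / 2 ^+ k.
    have [B B0 hB] := picard_seq_bound `|t|.
    have [k|l hl] := @half_powers_cauchy (fun k => picard_seq k t 0 i) B; last by exists l, (2 * B).
    apply: le_trans (hB k t (lexx _)).
    by have := mxnorm_ge_coord (picard_seq k.+1 t - picard_seq k t) 0 i; rewrite !mxE.
  have [l hl] := choice hi; exists (\row_i l i) => i; have [B hB] := hl i.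
  by exists B => k; rewrite mxE.
have [z hz] := choice lim1.
have unif T : exists2 B, 0 <= B & forall k t, `|t| <= T -> `|picard_seq k t - z t| <= B / 2 ^+ k.
  have [B B0 hB] := picard_seq_bound T.
  exists (2 * B); first by rewrite mulr_ge0.
  move=> k t tT; apply: mxnorm_le => [|i j].
    by rewrite divr_ge0 ?mulr_ge0 // exprn_ge0.
  rewrite ord1 !mxE.
  have [k'|l hl] := @half_powers_cauchy (fun k => picard_seq k t 0 j) B.
    apply: le_trans (hB k' t tT).
    by have := mxnorm_ge_coord (picard_seq k'.+1 t - picard_seq k' t) 0 j; rewrite !mxE.
  suff -> : z t 0 j = l by apply: hl.
  have [B' hB'] := hz t j.
  apply/eqP; rewrite -subr_eq0 -normr_eq0; apply/negPn/negP => ne.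
  have e0 : 0 < `|z t 0 j - l| by rewrite lt_def ne normr_ge0.
  have [m hm] := half_powers_lt (B' + 2 * B) e0.
  have := ler_normD (z t 0 j - picard_seq m t 0 j) (picard_seq m t 0 j - l).
  rewrite addrA subrK (distrC (z t 0 j) (picard_seq m t 0 j)); have := hl m; have := hB' m.
  move: hm; rewrite mulrDl; lra.
have cz : continuous z.
  move=> t; apply/continuous_normP => eps eps0.
  have [B B0 hB] := unif (`|t| + 1).
  have e3 : 0 < eps / 3 by lra.
  have [m hm] := half_powers_lt B e3.
  have [dl dl0 hd] := (continuous_normP _ _).1 (@picard_seq_cts m t) _ e3.
  exists (Num.min dl 1); first by rewrite lt_min dl0 ltr01.
  move=> s; rewrite lt_min => /andP[sd s1].
  have h1 : `|s| <= `|t| + 1.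
    by have := ler_normD t (s - t); rewrite addrC subrK; lra.
  have h2 := hB m _ h1; have h3 := hB m t; have {}h3 := h3 (ltW (ltr_pwDr ltr01 (lexx _))).
  have h4 := hd s sd.
  rewrite (_ : z s - z t = (z s - picard_seq m s) + (picard_seq m s - picard_seq m t)
     + (picard_seq m t - z t)); last by rewrite !addrA !subrK.
  apply: le_trans (ler_normD _ _) _.
  have := ler_normD (z s - picard_seq m s) (picard_seq m s - picard_seq m t).
  rewrite (distrC (z s) (picard_seq m s)); lra.
suff e : picard_step z = z.
  by have := picard_stepP cz; rewrite e => hzz; exists z.
apply/funext => t; apply/eqP; rewrite -subr_eq0 -normr_eq0; apply/negPn/negP => ne.
have e0 : 0 < `|picard_step z t - z t| by rewrite lt_def ne normr_ge0.
have [B B0 hB] := unif `|t|; have [K K0 hK] := Flip `|t|.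
pose X := expR (2 * K * `|t|).
(* Both [picard_step z t] and [z t] are close to the iterate m + 1, with errors at most B X / 2^m
   and B / 2^m; their sum is made smaller than the supposed gap. *)
have [m hm] := half_powers_lt (B * X + B) e0.
have p2 : 0 < 2 ^+ m :> R by rewrite exprn_gt0.
have A0 : 0 <= B / 2 ^+ m by rewrite divr_ge0 // ltW.
have h1 := picard_step_contract K0 A0 hK cz (@picard_seq_cts m).
have {}h1 : `|picard_step z t - picard_seq m.+1 t| <= B / 2 ^+ m / 2 * X.
  apply: (h1 _ t (lexx _)) => s sT; rewrite distrC; apply: le_trans (hB m s sT) _.
  by rewrite ler_peMr // -expR0 ler_expR mulr_ge0 // mulr_ge0 // ltW.
have h2 := hB m.+1 t (lexx _).
have h3 : B / 2 ^+ m.+1 <= B / 2 ^+ m.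
  by rewrite ler_wpM2l // lef_pV2 ?posrE ?exprn_gt0 // exprS; lra.
have h4 : B / 2 ^+ m / 2 * X <= B / 2 ^+ m * X.
  by rewrite ler_wpM2r ?expR_ge0 //; lra.
have := ler_normD (picard_step z t - picard_seq m.+1 t) (picard_seq m.+1 t - z t).
rewrite addrA subrK.
have : (B * X + B) / 2 ^+ m = B / 2 ^+ m * X + B / 2 ^+ m by rewrite mulrDl mulrAC.
lra.
Qed.

End Picard.

(** * Energy and truncated gradient field *)

Section GradientField.
Variables (R : realType) (d : nat).

Lemma closed_norm_le n (r : R) : closed [set u : 'rV[R]_n | `|u| <= r].
Proof.
apply: (@preimage_closed _ _ (fun u : 'rV[R]_n => `|u|) [set x | x <= r]).
  by move=> u _; apply: norm_continuous.
exact: closed_le.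
Qed.

Lemma compact_norm_le n (r : R) : compact [set u : 'rV[R]_n | `|u| <= r].
Proof.
apply: bounded_closed_compact; last exact: closed_norm_le.
by exists r; split; [apply: num_real | move=> s rs u /= /le_trans; apply; apply: ltW].
Qed.

Lemma continuous_bounded_on_ball n (g : 'rV[R]_n -> R) (r : R) : continuous g ->
  exists2 M, 0 <= M & forall u, `|u| <= r -> `|g u| <= M.
Proof.
move=> cg; have [r0|r0] := leP 0 r; last first.
  by exists 0 => // u ur; have := normr_ge0 u; lra.
pose A := [set u : 'rV[R]_n | `|u| <= r].
have cng : continuous (fun u => `|g u|).
  move=> u; apply: (@continuous_comp _ _ _ g Num.norm _ (cg u)); exact: norm_continuous.
have [||| c _ hc] := @EVT_max_rV R n (fun u => `|g u|) A.
- by exists 0; rewrite /A /= normr0.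
- exact: compact_norm_le.
- exact: continuous_subspaceT.
- by exists `|g c| => // u ur; apply: hc; rewrite inE.
Qed.

Lemma C1_lipschitz_on_ball (g : 'rV[R]_d -> R) (r : R) :
  (forall i w, derivable g w (ebasis R i)) -> (forall i, continuous (partial i g)) ->
  exists2 K, 0 <= K & forall u w, `|u| <= r -> `|w| <= r -> `|g u - g w| <= K * `|u - w|.
Proof.
move=> dg cg.
have hM i : exists M, 0 <= M /\ forall u, `|u| <= r -> `|partial i g u| <= M.
  by have [M M0 hM] := continuous_bounded_on_ball r (cg i); exists M.
have [M hM'] := choice hM.
exists (\sum_i M i); first by apply: sumr_ge0 => i _; apply: (hM' i).1.
move=> u w ur wr.
pose p (s : R) : 'rV[R]_d := w + s *: (u - w).
have dp (s : R) i : is_derive s 1 (fun s => p s 0 i) ((u - w) 0 i).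
  have d1 : is_derive s 1 (fun r : R => ((u - w) 0 i) *: r) (((u - w) 0 i) *: 1).
    exact: is_deriveZ.
  have := is_deriveD (is_derive_cst (w 0 i) s 1) d1.
  rewrite add0r [_ *: 1]mulr1; congr (is_derive _ _ _ _); apply/funext => q.
  by rewrite /p !mxE fctE /cst /= -[_ *: q]/((_ - _) * q) mulrC.
have dgp (s : R) := is_derive_comp_C1 dg cg (dp s).
have [s s01 e] := MVT_simple (@ler01 R) (fun s _ => dgp s).
move: e; rewrite {1 2}/p scale1r scale0r addr0 subr0 mulr1 (addrC w) subrK => ->.
have ps : `|p s| <= r.
  rewrite (_ : p s = (1 - s) *: w + s *: u); last first.
    by apply/rowP => j; rewrite !mxE; ring.
  apply: le_trans (ler_normD _ _) _; rewrite !normrZ.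
  by move/andP: s01 => [s0 s1]; rewrite !ger0_norm //; [nra | lra].
apply: le_trans (ler_norm_sum _ _ _) _; rewrite mulr_suml; apply: ler_sum => i _.
rewrite normrM; apply: ler_pM => //; first exact: (hM' i).2.
exact: mxnorm_ge_coord.
Qed.

Definition clamp (r u : R) : R := Num.max (- r) (Num.min r u).

Lemma clamp_dist r s u w : 0 <= r -> 0 <= s ->
  `|clamp r u - clamp s w| <= `|r - s| + `|u - w|.
Proof.
move=> r0 s0; rewrite /clamp /Num.max /Num.min /Order.max /Order.min.
have h1 := ler_norm (r - s); have h2 := ler_norm (s - r).
have h3 := ler_norm (u - w); have h4 := ler_norm (w - u).
rewrite (distrC s r) in h2; rewrite (distrC w u) in h4.
set A := `|r - s| in h1 h2 *; set B := `|u - w| in h3 h4 *; rewrite ler_norml.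
by case: (ltP r u) => h5; case: (ltP s w) => h6; case: ltP => h7; case: ltP => h8;
  apply/andP; split; lra.
Qed.

Lemma clamp_id r u : `|u| <= r -> clamp r u = u.
Proof.
rewrite ler_norml => /andP[h1 h2]; rewrite /clamp /Num.max /Num.min /Order.max /Order.min.
case: (ltP r u) => h3; case: ltP => h4; lra.
Qed.

Lemma clamp_le r u : 0 <= r -> `|clamp r u| <= r.
Proof.
move=> r0; rewrite ler_norml /clamp /Num.max /Num.min /Order.max /Order.min.
case: (ltP r u) => h3; case: ltP => h4; apply/andP; split; lra.
Qed.

Definition clampv (r : R) (u : 'rV[R]_d) : 'rV[R]_d := \row_i clamp r (u 0 i).

Lemma clampv_id r u : `|u| <= r -> clampv r u = u.
Proof.
move=> ur; apply/rowP => i; rewrite mxE clamp_id //.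
exact: le_trans (mxnorm_ge_coord _ _ _) ur.
Qed.

Lemma clampv_le r u : 0 <= r -> `|clampv r u| <= r.
Proof. by move=> r0; apply: mxnorm_le => // i j; rewrite mxE clamp_le. Qed.

(** The truncation radius will move with time. The first term gives continuity in time of the
    truncated field, the second its Lipschitz bound in space. *)
Lemma clampv_dist r s u w : 0 <= r -> 0 <= s ->
  `|clampv r u - clampv s w| <= `|r - s| + `|u - w|.
Proof.
move=> r0 s0; apply: mxnorm_le => [|i j]; first by rewrite addr_ge0.
rewrite !mxE; apply: le_trans (clamp_dist _ _ r0 s0) _.
by rewrite lerD2l; have := mxnorm_ge_coord (u - w) 0 j; rewrite !mxE.
Qed.

Lemma derive_rV (x : R -> 'rV[R]_d) (v : 'rV[R]_d) (t : R) :
  (forall i, is_derive t 1 (fun s => x s 0 i) (v 0 i)) -> is_derive t 1 x v.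
Proof.
move=> h; have dx : derivable x t 1.
  by apply/derivable_mxP => i j; rewrite ord1; apply: (@ex_derive _ _ _ _ _ _ (v 0 j)).
split => //; rewrite derive_mx //; apply/rowP => j; rewrite mxE.
exact: derive_val.
Qed.

Lemma derive_rV_coord (x : R -> 'rV[R]_d) (t : R) i : derivable x t 1 ->
  is_derive t 1 (fun s => x s 0 i) (derive1 x t 0 i).
Proof.
move=> dx; have dxi : derivable (fun s => x s 0 i) t 1.
  exact: (derivable_mxP _ _ _).1.
by split => //; rewrite derive1E derive_mx // mxE.
Qed.

Lemma dissipation_le (c g b v w : R) : 0 < c -> c <= g -> 0 < b -> b * g <= 2 ->
  w * v + (v + b * w) * (- g * v - w) <= - (c / 4) * v ^+ 2 - (b / 3) * w ^+ 2.
Proof.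
move=> c0 cg b0 bg.
have h1 : 0 <= g * (v + 2 / 3 * b * w) ^+ 2 by apply: mulr_ge0; [lra | exact: sqr_ge0].
have h2 : 0 <= (g - c) * v ^+ 2 by apply: mulr_ge0; [lra | exact: sqr_ge0].
have h3 : 0 <= (2 - b * g) * (b * w ^+ 2).
  by apply: mulr_ge0; [lra | apply: mulr_ge0; [lra | exact: sqr_ge0]].
(* The cross terms w v cancel and leave -(g v^2 + b g v w + b w^2), a form that is definite as long
   as b g < 4. The bound b g <= 2 leaves room for c/4 and b/3, as the displayed sum of three
   nonnegative terms shows. *)
rewrite -subr_ge0 [leRHS](_ : _ = 3 / 4 * (g * (v + 2 / 3 * b * w) ^+ 2)
   + 1 / 4 * ((g - c) * v ^+ 2) + 1 / 3 * ((2 - b * g) * (b * w ^+ 2))); last by field.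
lra.
Qed.

Variables (f : 'rV[R]_d -> R).
Hypothesis fC2 : C2 f.

Lemma grad_cts : continuous (grad f).
Proof.
case: fC2 => [_ [_ [c1 _]]] u; apply: continuous_rV => i.
rewrite (_ : (fun w => _) = partial i f); first exact: c1.
by apply/funext => w; rewrite mxE.
Qed.

Lemma grad_lipschitz (r : R) : exists2 K, 0 < K & forall u w, `|u| <= r -> `|w| <= r ->
  `|grad f u - grad f w| <= K * `|u - w|.
Proof.
case: fC2 => [_ [_ [_ [d2 c2]]]].
have hK i : exists K, 0 <= K /\ forall u w, `|u| <= r -> `|w| <= r ->
    `|partial i f u - partial i f w| <= K * `|u - w|.
  by have [K K0 hK] := C1_lipschitz_on_ball r (d2 i) (c2 i); exists K.
have [K hK'] := choice hK.
have K0 : 0 <= \sum_i K i by apply: sumr_ge0 => i _; apply: (hK' i).1.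
exists (1 + \sum_i K i); first lra.
move=> u w ur wr; apply: mxnorm_le => [|i j]; first by rewrite mulr_ge0 //; lra.
rewrite !mxE; apply: le_trans ((hK' j).2 _ _ ur wr) _.
rewrite ler_wpM2r // (bigD1 j) //=.
have : 0 <= \sum_(i | i != j) K i by apply: sumr_ge0 => k _; apply: (hK' k).1.
lra.
Qed.

Definition energy (x y : 'rV[R]_d) := f x + 2^-1 * \sum_i y 0 i ^+ 2.

Lemma energy_derive (x y : R -> 'rV[R]_d) (t g b : R) :
  (forall i, is_derive t 1 (fun s => x s 0 i) (y t 0 i - b * partial i f (x t))) ->
  (forall i, is_derive t 1 (fun s => y s 0 i)
    (- g * (y t 0 i - b * partial i f (x t)) - partial i f (x t))) ->
  is_derive t 1 (fun s => energy (x s) (y s))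
    (\sum_i (partial i f (x t) * (y t 0 i - b * partial i f (x t)) +
       y t 0 i * (- g * (y t 0 i - b * partial i f (x t)) - partial i f (x t)))).
Proof.
move=> dx dy; case: fC2 => [_ [d1 [c1 _]]].
pose v : 'rV[R]_d := \row_i (y t 0 i - b * partial i f (x t)).
have dxv i : is_derive t 1 (fun s => x s 0 i) (v 0 i) by rewrite mxE.
have e1 := is_derive_comp_C1 d1 c1 dxv.
have e2 := is_derive_sum (fun i => is_deriveX 2 (dy i)).
have := is_deriveD e1 (is_deriveZ 2^-1 e2).
rewrite -[2^-1 *: _]/(2^-1 * _) mulr_sumr -big_split /=.
rewrite (_ : \sum_i _ = \sum_i (partial i f (x t) * (y t 0 i - b * partial i f (x t)) +
   y t 0 i * (- g * (y t 0 i - b * partial i f (x t)) - partial i f (x t)))); last first.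
  apply: eq_bigr => i _; rewrite mxE; congr (_ + _).
  by rewrite expr1 -[_ *: _]/(_ * _) -mulr_natl; field.
congr (is_derive _ _ _ _); apply/funext => s.
by rewrite -[LHS]/(f (x s) + 2^-1 * (\sum_i ((fun r => y r 0 i) ^+ 2)) s) fct_sumE.
Qed.

Lemma energy_derive_le (x y : 'rV[R]_d) (c g b : R) : 0 < c -> c <= g -> 0 < b -> b * g <= 2 ->
  \sum_i (partial i f x * (y 0 i - b * partial i f x) +
       y 0 i * (- g * (y 0 i - b * partial i f x) - partial i f x)) <=
  - (c / 4) * (\sum_i (y 0 i - b * partial i f x) ^+ 2) - (b / 3) * \sum_i partial i f x ^+ 2.
Proof.
move=> c0 cg b0 bg; rewrite !mulr_sumr -sumrB; apply: ler_sum => i _.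
have := dissipation_le (y 0 i - b * partial i f x) (partial i f x) c0 cg b0 bg.
by rewrite (subrK (b * partial i f x)).
Qed.

End GradientField.

(** * Global existence *)

Section RegularityAtZero.
Variables (R : realType) (d : nat) (x V W : R -> 'rV[R]_d).
Hypotheses (cx : continuous x) (cV : continuous V) (cW : continuous W).
Hypothesis dx : forall t : R, 0 < t -> is_derive t 1 x (V t).
Hypothesis dV : forall t : R, 0 < t -> is_derive t 1 V (W t).

Lemma derive1_pos (t : R) : 0 < t -> derive1 x t = V t.
Proof. by move=> t0; rewrite derive1E; have := dx t0 => h; apply: derive_val. Qed.

Lemma near_derive1_pos (t : R) : 0 < t -> \forall s \near t, V s = derive1 x s.
Proof.
move=> t0; apply/near_normP; exists t => // s hs; rewrite derive1_pos //.
by move: hs; rewrite ltr_norml; lra.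
Qed.

Lemma derive2_pos_der (t : R) : 0 < t -> is_derive t 1 (derive1 x) (W t).
Proof. by move=> t0; apply: near_eq_is_derive (near_derive1_pos t0) (dV t0). Qed.

Lemma derive2_pos (t : R) : 0 < t -> derive1n 2 x t = W t.
Proof.
move=> t0; rewrite derive1nS derive1n1 derive1E.
by have := derive2_pos_der t0 => h; apply: derive_val.
Qed.

Lemma within_pos_ext (g h : R -> 'rV[R]_d) : continuous g ->
  (forall t, 0 < t -> h t = g t) -> {within `]0, +oo[, continuous h} /\ cvg (h t @[t --> 0^'+]).
Proof.
move=> cg hg; split.
  apply: (@subspace_eq_continuous R `]0, +oo[%classic _ g h).
    by move=> t; rewrite inE /= in_itv /= andbT => /hg ->.
  exact: continuous_subspaceT.
apply/cvg_ex; exists (g 0); apply: (@cvg_trans _ (g t @[t --> 0^'+])).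
  apply: near_eq_cvg; near=> t; apply/esym/hg.
  by near: t; exact: nbhs_right_gt.
by apply: cvg_at_right_filter; apply: cg.
Unshelve. all: by end_near.
Qed.

(** The values at 0 of the continuous curves [V] and [W] supply the limits of the first two
    derivatives there. *)
Lemma C2_Rplus_intro : C2_Rplus x.
Proof.
have [a1 a2] := within_pos_ext cV derive1_pos.
have [b1 b2] := within_pos_ext cW derive2_pos.
split; first split.
- by move=> t t0; have := dx t0 => h; apply: ex_derive.
- split; first exact: continuous_subspaceT.
  by split; [exact: a1 | exact: a2].
- split; last by split; [exact: b1 | exact: b2].
  move=> t t0; by have := derive2_pos_der t0 => h; apply: ex_derive.
Qed.

End RegularityAtZero.

(** * The truncated first order system and its solution *)

Section Existence.
Variables (R : realType) (d : nat) (f : 'rV[R]_d -> R) (gamma : R -> R).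
Variables (c beta m : R) (x0 v0 : 'rV[R]_d).
Hypothesis fC2 : C2 f.
Hypothesis fm : forall u, m <= f u.
Hypothesis gamma_cts : {within `[0, +oo[, continuous gamma}.
Hypothesis c0 : 0 < c.
Hypothesis gc : forall t : R, 0 <= t -> c <= gamma t.
Hypothesis b0 : 0 < beta.
Hypothesis bg : forall t : R, 0 <= t -> beta * gamma t <= 2.

(** Even extension of the damping, so that the iteration can run on the whole line with the same
    bounds; its continuity at 0 needs only the right limit of [gamma]. *)
Definition gam (t : R) := gamma `|t|.

Lemma gam_cts : continuous gam.
Proof.
have [g1 g2] := (continuous_within_itvcyP _ _).1 gamma_cts.
move=> t; have [->|t0] := eqVneq t 0; last first.
  apply: (@continuous_comp R R R (fun s : R => `|s|) gamma t); first exact: norm_continuous.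
  by apply: g1; rewrite in_itv /= andbT normr_gt0.
apply/continuous_normP => eps eps0.
have /cvgrPdist_le /(_ _ eps0) := g2; rewrite near_withinE => H.
have [dl dl0 hdl] := (near_normP _ _).1 H.
exists dl => // w; rewrite subr0 => wd; rewrite /gam normr0.
have [->|w0] := eqVneq w 0; first by rewrite normr0 subrr normr0 ltW.
by rewrite distrC; apply: hdl; rewrite ?subr0 ?normr_id ?normr_gt0.
Qed.

Let y0 := v0 + beta *: grad f x0.
Let E0 := energy f x0 y0.

Lemma initial_energy_ge : m <= E0.
Proof.
rewrite /E0 /energy; have := fm x0.
have : 0 <= \sum_i y0 0 i ^+ 2 by apply: sumr_ge0 => i _; apply: sqr_ge0.
lra.
Qed.

(** While the truncation is inactive, each coordinate of x(t) - x0 is at most t / 2 + (2 / c) (E0 -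
    m), where E0 - m is the energy available for dissipation. The radius exceeds the resulting bound
    on x(t), and the added 1 makes this strict. *)
Let rho (t : R) := `|x0| + 1 + 2 / c * (E0 - m) + `|t|.

Lemma rho_gt t : `|x0| + 2 / c * (E0 - m) + `|t| < rho t.
Proof. rewrite /rho; lra. Qed.

Lemma rho_ge0 t : 0 <= rho t.
Proof.
have : 0 <= 2 / c * (E0 - m).
  by apply: mulr_ge0; [rewrite divr_ge0 // ltW | rewrite subr_ge0 initial_energy_ge].
have := rho_gt t; have := normr_ge0 x0; have := normr_ge0 t; lra.
Qed.

Let G t (x : 'rV[R]_d) := grad f (clampv (rho t) x).

(** The second block is -gamma (y - beta G) - G expanded, with the truncated gradient [G] standing
    for the gradient. *)
Let F (t : R) (z : 'rV[R]_(d + d)) : 'rV[R]_(d + d) :=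
  row_mx (rsubmx z - beta *: G t (lsubmx z))
    ((- gam t) *: rsubmx z + (beta * gam t - 1) *: G t (lsubmx z)).

Lemma lsubmx_norm (z : 'rV[R]_(d + d)) : `|lsubmx z| <= `|z|.
Proof. by apply: mxnorm_le => // i j; rewrite mxE mxnorm_ge_coord. Qed.

Lemma rsubmx_norm (z : 'rV[R]_(d + d)) : `|rsubmx z| <= `|z|.
Proof. by apply: mxnorm_le => // i j; rewrite mxE mxnorm_ge_coord. Qed.

Lemma G_cts (x : R -> 'rV[R]_d) : continuous x -> continuous (fun t => G t (x t)).
Proof.
move=> cx t; apply: (@continuous_comp _ _ _ (fun t => clampv (rho t) (x t)) (grad f));
  last exact: grad_cts.
apply/continuous_normP => eps eps0.
have e2 : 0 < eps / 2 by lra.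
have [dl dl0 hdl] := (continuous_normP _ _).1 (cx t) _ e2.
exists (Num.min dl (eps / 2)); first by rewrite lt_min dl0.
move=> w; rewrite lt_min => /andP[w1 w2].
apply: le_trans (clampv_dist _ _ (rho_ge0 _) (rho_ge0 _)) _.
have := hdl w w1.
have : `|rho w - rho t| <= `|w - t|.
  rewrite /rho opprD addrACA subrr add0r; exact: ler_dist_dist.
lra.
Qed.

Lemma F_cts (z : R -> 'rV[R]_(d + d)) : continuous z -> continuous (fun t => F t (z t)).
Proof.
move=> cz t.
have ccz i : {for t, continuous (fun s => z s 0 i)}.
  exact: continuous_coord (cz t).
have cl : continuous (fun s => lsubmx (z s)).
  move=> s; apply/continuous_normP => eps eps0.
  have [dl dl0 hdl] := (continuous_normP _ _).1 (cz s) _ eps0.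
  exists dl => // w /hdl; apply: le_trans; rewrite -linearB; exact: lsubmx_norm.
have cG i : {for t, continuous (fun s => G s (lsubmx (z s)) 0 i)}.
  exact: continuous_coord (@G_cts _ cl t).
apply: continuous_rV => k; case: (split_ordP k) => i ->.
  rewrite (_ : (fun s => _) = (fun s => z s 0 (rshift d i) + - beta * G s (lsubmx (z s)) 0 i)).
    apply: continuousD; first exact: ccz.
    by apply: continuousM; [apply: cst_continuous | apply: cG].
  by apply/funext => s; rewrite row_mxEl !mxE mulNr.
rewrite (_ : (fun s => _) = (fun s => - gam s * z s 0 (rshift d i) +
   (beta * gam s + (-1)) * G s (lsubmx (z s)) 0 i)).
  apply: continuousD; apply: continuousM => //.
  - by apply: continuousN; apply: gam_cts.
  - apply: continuousD; last exact: cst_continuous.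
    by apply: continuousM; [apply: cst_continuous | apply: gam_cts].
by apply/funext => s; rewrite row_mxEr !mxE.
Qed.

Lemma F_lip (T : R) : exists2 K, 0 < K &
  forall t u w, `|t| <= T -> `|F t u - F t w| <= K * `|u - w|.
Proof.
have [L L0 hL] := grad_lipschitz fC2 (rho T).
(* For |t| <= T the clamped points lie in the ball of radius [rho T], on which the gradient is
   L-Lipschitz. The coefficients are controlled by gam <= 2 / beta and |beta gam - 1| <= 1, both
   from beta gam <= 2; the constant is generous. *)
pose K := 1 + beta * L + 2 / beta + 1 * L + 2 * L.
have bi : 0 < 2 / beta by rewrite divr_gt0.
have bL : 0 < beta * L by rewrite mulr_gt0.
exists K; first by rewrite /K; lra.
move=> t u w tT.
have n0 : 0 <= `|u - w| by [].
have rT : rho t <= rho T.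
  by rewrite /rho lerD2l; apply: le_trans tT _; apply: ler_norm.
have hG : `|G t (lsubmx u) - G t (lsubmx w)| <= L * `|u - w|.
  apply: le_trans (hL _ _ _ _) _.
  - exact: le_trans (clampv_le _ (rho_ge0 t)) rT.
  - exact: le_trans (clampv_le _ (rho_ge0 t)) rT.
  - rewrite ler_wpM2l //; first exact: ltW.
    apply: le_trans (clampv_dist _ _ (rho_ge0 _) (rho_ge0 _)) _.
    rewrite subrr normr0 add0r -linearB; exact: lsubmx_norm.
have hr : `|rsubmx u - rsubmx w| <= `|u - w| by rewrite -linearB rsubmx_norm.
have gb0 : 0 < gam t by apply: lt_le_trans c0 (gc _).
have gb2 : gam t <= 2 / beta.
  by rewrite ler_pdivlMr // mulrC; apply: bg.
have bg2 : beta * gam t <= 2 by apply: bg.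
have bgp : 0 < beta * gam t by rewrite mulr_gt0.
apply: mxnorm_le => [|i k]; first by rewrite mulr_ge0 // /K; lra.
rewrite ord1 [leLHS](_ : _ = `|F t u 0 k - F t w 0 k|); last by rewrite !mxE.
have hGj j : `|G t (lsubmx u) 0 j - G t (lsubmx w) 0 j| <= L * `|u - w|.
  apply: le_trans hG.
  by have := mxnorm_ge_coord (G t (lsubmx u) - G t (lsubmx w)) 0 j; rewrite !mxE.
have hrj j : `|rsubmx u 0 j - rsubmx w 0 j| <= `|u - w|.
  apply: le_trans hr.
  by have := mxnorm_ge_coord (rsubmx u - rsubmx w) 0 j; rewrite !mxE.
case: (split_ordP k) => j -> {i k}.
  rewrite !row_mxEl.
  rewrite (_ : _ - _ = (rsubmx u 0 j - rsubmx w 0 j) -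
     beta * (G t (lsubmx u) 0 j - G t (lsubmx w) 0 j)); last by rewrite 2!mxE; rewrite !mxE; ring.
  apply: le_trans (ler_normB _ _) _; rewrite normrM (gtr0_norm b0).
  have h1 : beta * `|G t (lsubmx u) 0 j - G t (lsubmx w) 0 j| <= beta * (L * `|u - w|).
    by rewrite ler_wpM2l // ltW.
  have := hrj j; have : 0 <= 2 / beta * `|u - w| by rewrite mulr_ge0 // ltW.
  have : 0 <= L * `|u - w| by rewrite mulr_ge0 // ltW.
  rewrite /K; nra.
rewrite !row_mxEr.
rewrite (_ : _ - _ = - gam t * (rsubmx u 0 j - rsubmx w 0 j) +
   (beta * gam t - 1) * (G t (lsubmx u) 0 j - G t (lsubmx w) 0 j)); last by rewrite 2!mxE;
       rewrite !mxE; ring.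
apply: le_trans (ler_normD _ _) _; rewrite !normrM normrN (gtr0_norm gb0).
have h0 : `|beta * gam t - 1| <= 1 by rewrite ler_norml; lra.
have h1 : `|beta * gam t - 1| * `|G t (lsubmx u) 0 j - G t (lsubmx w) 0 j| <= 1 * (L * `|u - w|).
  by apply: ler_pM.
have h2 : gam t * `|rsubmx u 0 j - rsubmx w 0 j| <= 2 / beta * `|u - w|.
  by apply: ler_pM => //; apply: ltW.
have : 0 <= L * `|u - w| by rewrite mulr_ge0 // ltW.
have : 0 <= beta * L * `|u - w| by rewrite mulr_ge0 // ltW.
rewrite /K; lra.
Qed.

Lemma truncated_solution : exists x y : R -> 'rV[R]_d, [/\ x 0 = x0, y 0 = y0,
  forall (t : R) i, is_derive t 1 (fun s => x s 0 i) (y t 0 i - beta * G t (x t) 0 i) &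
  forall (t : R) i, is_derive t 1 (fun s => y s 0 i)
    (- gam t * y t 0 i + (beta * gam t - 1) * G t (x t) 0 i)].
Proof.
have [z [z0 hz]] := picard_global (row_mx x0 y0) F_cts F_lip.
exists (fun t => lsubmx (z t)), (fun t => rsubmx (z t)); split.
- by rewrite z0 row_mxKl.
- by rewrite z0 row_mxKr.
- move=> t i; have := hz t (lshift d i); rewrite row_mxEl.
  by rewrite !mxE; congr (is_derive _ _ _ _); apply/funext => s; rewrite mxE.
- move=> t i; have := hz t (rshift d i); rewrite row_mxEr.
  by rewrite !mxE; congr (is_derive _ _ _ _); apply/funext => s; rewrite mxE.
Qed.

Section Truncated.
Variables (x y : R -> 'rV[R]_d).
Hypotheses (x00 : x 0 = x0) (y00 : y 0 = y0).
Hypothesis dx : forall (t : R) i, is_derive t 1 (fun s => x s 0 i)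
  (y t 0 i - beta * G t (x t) 0 i).
Hypothesis dy : forall (t : R) i, is_derive t 1 (fun s => y s 0 i)
  (- gam t * y t 0 i + (beta * gam t - 1) * G t (x t) 0 i).

Lemma trunc_x_cts : continuous x.
Proof. by move=> t; apply: continuous_rV => i; apply: is_derive_cts (dx t i). Qed.

Lemma trunc_y_cts : continuous y.
Proof. by move=> t; apply: continuous_rV => i; apply: is_derive_cts (dy t i). Qed.

Lemma trunc_dx (t : R) : `|x t| <= rho t -> forall i,
  is_derive t 1 (fun s => x s 0 i) (y t 0 i - beta * partial i f (x t)).
Proof. by move=> xt i; have := dx t i; rewrite /G clampv_id // mxE. Qed.

Lemma trunc_dy (t : R) : 0 <= t -> `|x t| <= rho t -> forall i,
  is_derive t 1 (fun s => y s 0 i)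
    (- gamma t * (y t 0 i - beta * partial i f (x t)) - partial i f (x t)).
Proof.
move=> t0 xt i; have := dy t i; rewrite /G clampv_id // mxE /gam ger0_norm //.
by rewrite (_ : - _ * _ + _ = - gamma t * (y t 0 i - beta * partial i f (x t))
  - partial i f (x t)) //; ring.
Qed.

(** The hypothesis makes the truncation inactive up to [T], so the genuine energy decreases there.
    The gain from a large to a strict inequality is what closes the continuation argument of
    [trunc_stays]. *)
Lemma trunc_apriori (T : R) : 0 <= T -> (forall s, 0 <= s <= T -> `|x s| <= rho s) ->
  `|x T| < rho T.
Proof.
move=> T0 hT.
have e0 : 0 <= 2 / c * (E0 - m).
  by apply: mulr_ge0; [rewrite divr_ge0 // ltW | rewrite subr_ge0 initial_energy_ge].
apply: le_lt_trans (rho_gt T); rewrite (ger0_norm T0).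
apply: mxnorm_le => [|i0 i]; first by have := normr_ge0 x0; lra.
rewrite ord1 {i0}.
pose E s := energy f (x s) (y s).
pose v s i := y s 0 i - beta * partial i f (x s).
pose dE s := \sum_i (partial i f (x s) * v s i +
  y s 0 i * (- gamma s * v s i - partial i f (x s))).
have hE s : 0 <= s <= T -> is_derive s 1 E (dE s).
  move=> /[dup] /hT xs /andP[s0 _]; apply: (energy_derive fC2).
    exact: trunc_dx.
  exact: trunc_dy.
have hdE s : 0 <= s <= T -> dE s <= - (c / 4) * v s i ^+ 2.
  move=> /andP[s0 _].
  have := energy_derive_le f (x s) (y s) c0 (gc s0) b0 (bg s0).
  move=> /le_trans; apply.
  have h1 : 0 <= beta / 3 * \sum_i partial i f (x s) ^+ 2.
    by apply: mulr_ge0; [rewrite divr_ge0 // ltW | apply: sumr_ge0 => j _; apply: sqr_ge0].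
  have h2 : v s i ^+ 2 <= \sum_i (y s 0 i - beta * partial i f (x s)) ^+ 2.
    by rewrite (bigD1 i) //= lerDl sumr_ge0 // => j _; apply: sqr_ge0.
  have : (c / 4) * v s i ^+ 2 <= (c / 4) * \sum_i (y s 0 i - beta * partial i f (x s)) ^+ 2.
    by rewrite ler_wpM2l // divr_ge0 // ltW.
  lra.
have key (sg : R) : sg = 1 \/ sg = -1 -> sg * (x T 0 i - x0 0 i) <= T / 2 + 2 / c * (E0 - m).
  move=> hsg.
  (* Since (2 / c) E' <= - v_i^2 / 2 and sg v_i - 1/2 <= v_i^2 / 2, this combination is
     nonincreasing. Comparing its ends and using E >= m bounds the displacement by T / 2 + (2 / c)
     (E0 - m). *)
  pose h s := sg * x s 0 i + (- 2^-1 * s + 2 / c * E s).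
  pose dh s := sg * v s i + (- 2^-1 * 1 + 2 / c * dE s).
  have : h T <= h 0.
    apply: (@derive_le0_nonincr _ h dh 0 T T0) => s sT.
      have d1 := is_deriveZ sg (trunc_dx (hT s sT) i).
      have d2 : is_derive s 1 (fun r : R => (- 2^-1) *: r) ((- 2^-1) *: 1).
        exact: is_deriveZ.
      have d3 := is_deriveZ (2 / c) (hE s sT).
      exact: is_deriveD d1 (is_deriveD d2 d3).
    have h1 : 2 / c * dE s <= - 2^-1 * v s i ^+ 2.
      rewrite (_ : - 2^-1 * v s i ^+ 2 = 2 / c * (- (c / 4) * v s i ^+ 2)); last first.
        by field; rewrite gt_eqF.
      by rewrite ler_wpM2l ?hdE // divr_ge0 // ltW.
    have := sqr_ge0 (sg * v s i - 1).
    rewrite /dh; case: hsg => ->; nra.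
  rewrite /h x00.
  have -> : E 0 = E0 by rewrite /E x00 y00.
  have : 2 / c * m <= 2 / c * E T.
    rewrite ler_wpM2l //; first by rewrite divr_ge0 // ltW.
    apply: le_trans (fm (x T)) _; rewrite /E /energy lerDl mulr_ge0 ?invr_ge0 //.
    by apply: sumr_ge0 => j _; apply: sqr_ge0.
  rewrite mulr0 add0r !mulrBr; lra.
have h1 := key 1 (or_introl erefl); have h2 := key (-1) (or_intror erefl).
have : `|x T 0 i - x0 0 i| <= T / 2 + 2 / c * (E0 - m).
  by rewrite ler_norml; apply/andP; split; lra.
have := ler_normD (x T 0 i - x0 0 i) (x0 0 i); rewrite subrK.
have := mxnorm_ge_coord x0 0 i; lra.
Qed.

Lemma trunc_stays (T : R) : 0 <= T -> `|x T| <= rho T.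
Proof.
move=> T0; apply: ltW.
have rmono (s t : R) : 0 <= s -> s <= t -> rho s <= rho t.
  by move=> s0 st; rewrite /rho lerD2l !ger0_norm //; lra.
(* The induction carries the strict inequality: it persists to the right by continuity, and at a
   left limit continuity yields the large inequality, which [trunc_apriori] makes strict. *)
apply: (@real_ind _ 0 T (fun s => `|x s| < rho s)) => //; last by rewrite T0 lexx.
- rewrite x00; apply: le_lt_trans (rho_gt 0); rewrite normr0 addr0 lerDl.
  by apply: mulr_ge0; [rewrite divr_ge0 // ltW | rewrite subr_ge0 initial_energy_ge].
- move=> t /andP[t0 tT] ht; have xt : `|x t| < rho t by apply: ht; rewrite t0 lexx.
  have e0 : 0 < (rho t - `|x t|) / 2 by lra.
  have [dl dl0 hdl] := (continuous_normP _ _).1 (@trunc_x_cts t) _ e0.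
  exists dl => // s /andP[ts sd]; apply: lt_le_trans (rmono t s t0 (ltW ts)).
  have := hdl s; rewrite ger0_norm; last lra.
  have -> : s - t < dl by lra.
  move=> /(_ isT); have := ler_normD (x s - x t) (x t); rewrite subrK; lra.
- move=> t /andP[t0 tT] ht; apply: trunc_apriori; first exact: ltW.
  move=> s /andP[s0]; rewrite le_eqVlt => /predU1P[->|st]; last by apply/ltW/ht; rewrite s0.
  rewrite leNgt; apply/negP => xt.
  have e0 : 0 < (`|x t| - rho t) / 2 by lra.
  have [dl dl0 hdl] := (continuous_normP _ _).1 (@trunc_x_cts t) _ e0.
  pose w := Num.max 0 (t - dl / 2).
  have wt : w < t by rewrite gt_max t0; lra.
  have w0 : 0 <= w by rewrite le_max lexx.
  have wd : t - dl / 2 <= w by rewrite le_max lexx orbT.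
  have hw : `|w - t| < dl by rewrite ltr_norml; apply/andP; split; lra.
  have := hdl w hw; have := ht w; rewrite w0 wt => /(_ isT).
  have := rmono w t w0 (ltW wt).
  have := ler_normD (x t - x w) (x w); rewrite subrK (distrC (x t)); lra.
Qed.

Let V t := y t - beta *: grad f (x t).
(** The acceleration: differentiating y - beta grad f(x) brings the Hessian back. *)
Let W t := (- gam t) *: V t - grad f (x t) - beta *: hess_app f (x t) (V t).

Lemma hess_appE u v i : hess_app f u v 0 i = \sum_j partial j (partial i f) u * v 0 j.
Proof. by rewrite /hess_app !mxE; apply: eq_bigr => j _; rewrite !mxE. Qed.

Lemma trunc_gx_cts : continuous (fun t => grad f (x t)).
Proof.
by move=> t; apply: (@continuous_comp _ _ _ x (grad f) t (@trunc_x_cts t)); apply: grad_cts.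
Qed.

Lemma trunc_V_cts : continuous V.
Proof.
move=> t; apply: (@continuousB _ _ _ y (fun s => beta *: grad f (x s)) t (@trunc_y_cts t)).
by apply: (@continuousZr _ _ _ (fun s => grad f (x s)) beta t); apply: trunc_gx_cts.
Qed.

Lemma trunc_W_cts : continuous W.
Proof.
move=> t; apply: continuous_rV => i.
rewrite (_ : (fun s => _) = (fun s => - gam s * V s 0 i + - partial i f (x s) +
  - beta * \sum_j partial j (partial i f) (x s) * V s 0 j)); last first.
  apply/funext => s; rewrite -hess_appE /W.
  by move: (hess_app _ _ _) => H; rewrite !mxE; ring.
case: fC2 => [_ [_ [c1 [_ c2]]]].
have cV j : {for t, continuous (fun s => V s 0 j)} by apply: continuous_coord (@trunc_V_cts t).
apply: continuousD; first apply: continuousD.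
- by apply: continuousM => //; apply: continuousN; apply: gam_cts.
- by apply: continuousN; apply: (@continuous_comp _ _ _ x (partial i f) t (@trunc_x_cts t));
    apply: c1.
- apply: continuousM; first exact: cst_continuous.
  apply: (@continuous_sum_for _ _ _ (fun j s => partial j (partial i f) (x s) * V s 0 j)) => j.
  apply: continuousM => //.
  by apply: (@continuous_comp _ _ _ x (partial j (partial i f)) t (@trunc_x_cts t)); apply: c2.
Qed.

Lemma trunc_dxV (t : R) : 0 <= t -> is_derive t 1 x (V t).
Proof.
move=> t0; apply: derive_rV => i.
by have := trunc_dx (trunc_stays t0) i; rewrite !mxE.
Qed.

Lemma trunc_dVW (t : R) : 0 <= t -> is_derive t 1 V (W t).
Proof.
move=> t0; apply: derive_rV => i.
case: fC2 => [_ [_ [_ [d2 c2]]]].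
have dxv j : is_derive t 1 (fun s => x s 0 j) (V t 0 j).
  by have := trunc_dx (trunc_stays t0) j; rewrite !mxE.
have d1 := is_derive_comp_C1 (d2 i) (c2 i) dxv.
have := is_deriveB (trunc_dy t0 (trunc_stays t0) i) (is_deriveZ beta d1).
rewrite -hess_appE.
rewrite (_ : _ - _ = W t 0 i); last first.
  rewrite /W /gam (ger0_norm t0); move: (hess_app _ _ _) => H.
  by rewrite !mxE.
by congr (is_derive _ _ _ _); apply/funext => s; rewrite !mxE.
Qed.

Lemma trunc_ISEHD : ISEHD_solution f gamma beta x0 v0 x.
Proof.
have dxV t (t0 : 0 < t) := trunc_dxV (ltW t0).
have dVW t (t0 : 0 < t) := trunc_dVW (ltW t0).
split; first exact: C2_Rplus_intro trunc_x_cts trunc_V_cts trunc_W_cts dxV dVW.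
split=> //; split.
  (* The curve, defined on the whole line, has a two-sided derivative at 0, and [y0] was chosen to
     make it equal to [v0]; restricting the difference quotient to h > 0 gives the initial
     velocity. *)
  have [dx0 e] := trunc_dxV (lexx 0).
  have -> : v0 = V 0 by rewrite /V x00 y00 /y0 addrK.
  have : h^-1 *: ((x \o shift 0) (h *: 1) - x 0) @[h --> 0^'] --> V 0.
    by rewrite -e; apply: dx0.
  rewrite (_ : (fun h : R => _) = (fun h => h^-1 *: (x h - x 0))); last first.
    by apply/funext => h /=; rewrite addr0 [h *: 1]mulr1.
  exact: cvg_dnbhs_at_right.
move=> t t0; rewrite (derive2_pos dxV dVW t0) (derive1_pos dxV t0) /W /gam gtr0_norm //.
by rewrite scaleNr; apply/rowP => i; rewrite !mxE; ring.
Qed.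

End Truncated.

Lemma ISEHD_exists : exists x, ISEHD_solution f gamma beta x0 v0 x.
Proof.
have [x [y [h1 h2 h3 h4]]] := truncated_solution.
by exists x; apply: trunc_ISEHD h1 h2 h3 h4.
Qed.

End Existence.

(** * The Euclidean norm against the sup norm of row vectors *)

Section Enorm.
Variables (R : realType) (d : nat).

Lemma enorm_ge0 (u : 'rV[R]_d) : 0 <= enorm u.
Proof. exact: sqrtr_ge0. Qed.

Lemma enorm_sqr (u : 'rV[R]_d) : enorm u ^+ 2 = \sum_i u 0 i ^+ 2.
Proof. by rewrite sqr_sqrtr // sumr_ge0 // => i _; apply: sqr_ge0. Qed.

Lemma coord_le_enorm (u : 'rV[R]_d) i : `|u 0 i| <= enorm u.
Proof.
rewrite -sqrtr_sqr ler_sqrt; last by apply: sumr_ge0 => j _; apply: sqr_ge0.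
by rewrite (bigD1 i) //= lerDl sumr_ge0 // => j _; apply: sqr_ge0.
Qed.

Lemma norm_le_enorm (u : 'rV[R]_d) : `|u| <= enorm u.
Proof.
by apply: mxnorm_le => [|i j]; rewrite ?enorm_ge0 // ord1 coord_le_enorm.
Qed.

Lemma enorm_le_sum (u : 'rV[R]_d) : enorm u <= \sum_i `|u 0 i|.
Proof.
have s0 : 0 <= \sum_i `|u 0 i| by apply: sumr_ge0.
rewrite -[leRHS]ger0_norm // -sqrtr_sqr ler_sqrt ?sqr_ge0 //.
rewrite expr2 mulr_suml; apply: ler_sum => i _.
rewrite -real_normK ?num_real // expr2 ler_wpM2l // (bigD1 i) //= lerDl.
exact: sumr_ge0.
Qed.

Lemma enorm_cvg0 (w : R -> 'rV[R]_d) :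
  (forall i, w t 0 i @[t --> +oo] --> (0 : R)) -> enorm (w t) @[t --> +oo] --> (0 : R).
Proof.
move=> h; apply/cvgrPdist_le => eps eps0.
have e0 : 0 < eps / (1 + d%:R) by rewrite divr_gt0 // ltr_wpDr.
have H : \forall t \near +oo, forall i, `|w t 0 i| <= eps / (1 + d%:R).
  apply: (@filter_forall _ _ (fun i t => `|w t 0 i| <= eps / (1 + d%:R)) (+oo : set_system R)) => i.
  have /cvgrPdist_le /(_ _ e0) := h i; apply: filterS => t.
  by rewrite sub0r normrN.
apply: filterS H => t ht; rewrite sub0r normrN ger0_norm ?enorm_ge0 //.
apply: le_trans (enorm_le_sum _) _.
apply: (@le_trans _ _ (\sum_(i < d) (eps / (1 + d%:R)))); first exact: ler_sum.
rewrite sumr_const card_ord -[leLHS]mulr_natr mulrAC ler_pdivrMr ?ltr_wpDr //.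
by rewrite ler_pM2l // lerDr.
Qed.

Lemma continuous_enorm (w : R -> 'rV[R]_d) (t : R) :
  (forall i, {for t, continuous (fun s => w s 0 i)}) ->
  {for t, continuous (fun s => enorm (w s))}.
Proof.
move=> h; apply: (@continuous_comp _ _ _ (fun s => \sum_i w s 0 i ^+ 2) Num.sqrt);
  last exact: sqrt_continuous.
apply: (@continuous_sum_for _ _ _ (fun i s => w s 0 i ^+ 2)) => i.
by apply: (@continuousM _ _ (fun s => w s 0 i) (fun s => w s 0 i)).
Qed.

Lemma sumsq_ge0 (u : 'I_d -> R) : 0 <= \sum_i u i ^+ 2.
Proof. by apply: sumr_ge0 => i _; apply: sqr_ge0. Qed.

Lemma coord_sumsq (u : 'I_d -> R) i : u i ^+ 2 <= \sum_i u i ^+ 2.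
Proof. by rewrite (bigD1 i) //= lerDl sumr_ge0 // => j _; apply: sqr_ge0. Qed.

End Enorm.

(** * Definable predicates and functions *)

Section OMinimal.
Variables (R : realType) (S : forall n : nat, set (set 'rV[R]_n)).
Hypothesis HS : o_minimal S.

Definition is_lin (U V : lmodType R) (L : U -> V) :=
  forall a u v, L (a *: u + v) = a *: L u + L v.

Lemma is_lin_comp (U V W : lmodType R) (L : V -> W) (M : U -> V) :
  is_lin L -> is_lin M -> is_lin (fun u => L (M u)).
Proof. by move=> hL hM a u v; rewrite hM hL. Qed.

Lemma is_lin_sum (U V : lmodType R) (L : U -> V) (I : Type) (r : seq I)
    (a : I -> R) (u : I -> U) :
  is_lin L -> L (\sum_(i <- r) a i *: u i) = \sum_(i <- r) a i *: L (u i).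
Proof.
move=> hL; elim: r => [|i r IH].
  by rewrite !big_nil; have := hL (-1) 0 0; rewrite scaler0 addr0 scaleN1r addNr.
by rewrite !big_cons hL IH.
Qed.

Lemma S_cast n m (e : n = m) (A : set 'rV[R]_m) :
  S A -> S [set v : 'rV[R]_n | A (castmx (erefl, e) v)].
Proof.
case: m / e A => A hA.
by rewrite (_ : [set _ | _] = A) //; apply/seteqP; split => v /=; rewrite castmx_id.
Qed.

Lemma S_setI n (A B : set 'rV[R]_n) : S A -> S B -> S (A `&` B).
Proof.
move=> hA hB; rewrite -[A `&` B]setCK setCI.
by apply: (om_setC HS); apply: (om_setU HS); apply: (om_setC HS).
Qed.

Lemma S_setT n : S [set: 'rV[R]_n].
Proof. by rewrite -setC0; apply: (om_setC HS); apply: (om_set0 HS). Qed.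

Lemma S_forall n (I : finType) (A : I -> set 'rV[R]_n) :
  (forall i, S (A i)) -> S [set v | forall i, A i v].
Proof.
move=> hA; suff h (s : seq I) : S [set v | forall i, i \in s -> A i v].
  have := h (enum I); congr (S _); apply/seteqP; split => v /= hv i; last by move=> _.
  by apply: hv; rewrite mem_enum.
elim: s => [|i s IH].
  rewrite (_ : [set _ | _] = setT); first exact: S_setT.
  by apply/seteqP; split.
have := S_setI (hA i) IH; congr (S _); apply/seteqP; split => v /=.
  by move=> [h1 h2] j; rewrite inE => /orP[/eqP ->//|/h2].
move=> h; split; first by apply: h; rewrite inE eqxx.
by move=> j js; apply: h; rewrite inE js orbT.
Qed.

Lemma S_proj m n (A : set 'rV[R]_(n + m)) : S A ->
  S [set u : 'rV[R]_n | exists w : 'rV[R]_m, A (row_mx u w)].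
Proof.
elim: m n A => [|m IH] n A hA.
  have e : n = (n + 0)%N by rewrite addn0.
  have hu (u : 'rV[R]_n) w : castmx (erefl, e) u = row_mx u w.
    apply/rowP => j; have -> : j = lshift 0 (cast_ord (esym e) j) by apply/val_inj.
    by rewrite castmxE row_mxEl; congr (u _ _); apply/val_inj.
  have := S_cast e hA; congr (S _); apply/seteqP; split => u /=.
    by rewrite (hu u 0) => h; exists 0.
  by case=> w; rewrite -hu.
have hA' := S_cast (esym (addnA n 1 m)) hA.
have := om_proj HS (IH _ _ hA'); congr (S _); apply/seteqP; split => u /=.
  by case=> a [w]; rewrite -row_mxA => h; exists (row_mx a w).
case=> w h; exists (@lsubmx R 1 1 m w), (@rsubmx R 1 1 m w).
by rewrite -row_mxA hsubmxK.
Qed.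

Lemma S_prodl n m (A : set 'rV[R]_m) : S A ->
  S [set v : 'rV[R]_(n + m) | A (rsubmx v)].
Proof.
move=> hA; elim: n => [|n IH].
  rewrite (_ : [set _ | _] = A) //; apply/seteqP; split => v /=;
  by congr A; apply/rowP => j; rewrite mxE; congr (v _ _); apply/val_inj.
have := om_prodl HS IH; congr (S _); apply/seteqP; split => v /=;
by congr A; apply/rowP => j; rewrite !mxE; congr (v _ _); apply/val_inj.
Qed.

(** Polynomiality read through every linear parametrisation by some R^n, so that products of spaces
    can serve as domains without choosing coordinates on them. *)
Definition poly_fun (T : lmodType R) (p : T -> R) :=
  forall n (phi : 'rV[R]_n -> T), is_lin phi ->
    exists q : mpoly.mpoly n R, forall v, p (phi v) = mpoly.meval (fun i => v 0 i) q.

Lemma poly_fun_lin (T : lmodType R) (L : T -> R^o) : is_lin L -> poly_fun L.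
Proof.
move=> hL n phi hphi.
exists (\sum_i L (phi (delta_mx 0 i)) *: mpoly.mpolyX R (mpoly.mnm1 i)) => v.
rewrite raddf_sum /= {1}(row_sum_delta v) (is_lin_sum _ _ _ (is_lin_comp hL hphi)).
by apply: eq_bigr => i _; rewrite mpoly.mevalZ mpoly.mevalXU mulrC.
Qed.

Lemma poly_fun_cst (T : lmodType R) c : poly_fun (fun _ : T => c).
Proof. by move=> n phi _; exists (mpoly.mpolyC n c) => v; rewrite mpoly.mevalC. Qed.

Lemma poly_funD (T : lmodType R) (p q : T -> R) :
  poly_fun p -> poly_fun q -> poly_fun (fun t => p t + q t).
Proof.
move=> hp hq n phi hphi; have [a ha] := hp _ _ hphi; have [b hb] := hq _ _ hphi.
by exists (a + b) => v; rewrite mpoly.mevalD ha hb.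
Qed.

Lemma poly_funM (T : lmodType R) (p q : T -> R) :
  poly_fun p -> poly_fun q -> poly_fun (fun t => p t * q t).
Proof.
move=> hp hq n phi hphi; have [a ha] := hp _ _ hphi; have [b hb] := hq _ _ hphi.
by exists (a * b) => v; rewrite mpoly.mevalM ha hb.
Qed.

Lemma poly_funB (T : lmodType R) (p q : T -> R) :
  poly_fun p -> poly_fun q -> poly_fun (fun t => p t - q t).
Proof.
move=> hp hq; have := poly_funD hp (poly_funM (@poly_fun_cst _ (-1)) hq).
by congr poly_fun; apply/funext => t; rewrite mulN1r.
Qed.

(* Quantifying over all linear parametrisations makes pullback along a linear
   map immediate, whatever the shape of the ambient space. *)
Definition definable_pred (T : lmodType R) (P : T -> Prop) :=
  forall n (phi : 'rV[R]_n -> T), is_lin phi -> S [set v | P (phi v)].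

Lemma definable_pred_lin (T U : lmodType R) (L : T -> U) (P : U -> Prop) :
  is_lin L -> definable_pred P -> definable_pred (fun t => P (L t)).
Proof.
by move=> hL hP n phi hphi; apply: (hP n (fun v => L (phi v))); apply: is_lin_comp.
Qed.

Lemma definable_pred_poly0 (T : lmodType R) (p : T -> R) :
  poly_fun p -> definable_pred (fun t => p t = 0).
Proof.
move=> hp n phi hphi; have [q hq] := hp _ _ hphi.
have := om_alg HS q; congr (S _).
by apply/seteqP; split => v /=; rewrite hq.
Qed.

Lemma definable_pred_ext (T : lmodType R) (P Q : T -> Prop) :
  (forall t, P t <-> Q t) -> definable_pred P -> definable_pred Q.
Proof. by move=> h; congr definable_pred; apply/funext => t; apply/propext. Qed.

Lemma definable_pred_not (T : lmodType R) (P : T -> Prop) : definable_pred P -> definable_pred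
    (fun t => ~ P t).
Proof. by move=> hP n phi hphi; apply: (om_setC HS (hP _ _ hphi)). Qed.

Lemma definable_pred_and (T : lmodType R) (P Q : T -> Prop) :
  definable_pred P -> definable_pred Q -> definable_pred (fun t => P t /\ Q t).
Proof.
by move=> hP hQ n phi hphi; apply: (S_setI (hP _ _ hphi) (hQ _ _ hphi)).
Qed.

Lemma definable_pred_or (T : lmodType R) (P Q : T -> Prop) :
  definable_pred P -> definable_pred Q -> definable_pred (fun t => P t \/ Q t).
Proof.
by move=> hP hQ n phi hphi; apply: (om_setU HS (hP _ _ hphi) (hQ _ _ hphi)).
Qed.

Lemma definable_pred_imp (T : lmodType R) (P Q : T -> Prop) :
  definable_pred P -> definable_pred Q -> definable_pred (fun t => P t -> Q t).
Proof.
move=> hP hQ; apply: definable_pred_ext (definable_pred_or (definable_pred_not hP) hQ) => t; split.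
  by case.
by move=> h; case: (pselect (P t)) => [/h|]; [right|left].
Qed.

Lemma definable_pred_forall_fin (T : lmodType R) (I : finType) (P : I -> T -> Prop) :
  (forall i, definable_pred (P i)) -> definable_pred (fun t => forall i, P i t).
Proof.
by move=> hP n phi hphi; apply: S_forall => i; apply: hP.
Qed.

Lemma definable_pred_exR (T : lmodType R) (P : T -> R -> Prop) :
  definable_pred (fun p : T * R^o => P p.1 p.2) -> definable_pred (fun t => exists a, P t a).
Proof.
move=> hP n phi hphi.
pose psi (v : 'rV[R]_(n + 1)) : T * R^o := (phi (lsubmx v), rsubmx v 0 0).
have hpsi : is_lin psi.
  by move=> a u v; apply: injective_projections => /=; rewrite ?linearP ?hphi // !mxE.
have := om_proj HS (hP _ _ hpsi); congr (S _); apply/seteqP; split => u /=.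
  by case=> a; rewrite row_mxKl row_mxKr => h; exists (a 0 0).
by case=> a h; exists (const_mx a); rewrite row_mxKl row_mxKr mxE.
Qed.

Lemma definable_pred_exV (T : lmodType R) d (P : T -> 'rV[R]_d -> Prop) :
  definable_pred (fun p : T * 'rV[R]_d => P p.1 p.2) -> definable_pred (fun t => exists z, P t z).
Proof.
move=> hP n phi hphi.
pose psi (v : 'rV[R]_(n + d)) : T * 'rV[R]_d := (phi (lsubmx v), rsubmx v).
have hpsi : is_lin psi by move=> a u v; apply: injective_projections => /=; rewrite ?linearP ?hphi.
have := S_proj (hP _ _ hpsi); congr (S _); apply/seteqP; split => u /=.
  by case=> a; rewrite row_mxKl row_mxKr => h; exists a.
by case=> a h; exists a; rewrite row_mxKl row_mxKr.
Qed.

Lemma definable_pred_allR (T : lmodType R) (P : T -> R -> Prop) :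
  definable_pred (fun p : T * R^o => P p.1 p.2) -> definable_pred (fun t => forall a, P t a).
Proof.
move=> hP; apply: definable_pred_ext (definable_pred_not (@definable_pred_exR _ (fun t a => ~ P t
    a) (definable_pred_not hP))) => t /=.
by split => [h a|h [a na]]; [apply: contrapT => na; apply: h; exists a | exact: na (h a)].
Qed.

Lemma definable_pred_allV (T : lmodType R) d (P : T -> 'rV[R]_d -> Prop) :
  definable_pred (fun p : T * 'rV[R]_d => P p.1 p.2) -> definable_pred (fun t => forall z, P t z).
Proof.
move=> hP; apply: definable_pred_ext (definable_pred_not (@definable_pred_exV _ _ (fun t a => ~ P
    t a) (definable_pred_not hP))) => t /=.
by split => [h a|h [a na]]; [apply: contrapT => na; apply: h; exists a | exact: na (h a)].
Qed.

(** Stability under linear pullback is not an axiom. The preimage of [A] under [M] is the projection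
    of the graph of [M], an algebraic set, intersected with R^n x A. *)
Lemma definable_pred_of_S m (A : set 'rV[R]_m) : S A -> definable_pred A.
Proof.
move=> hA n M hM.
have hG : S [set u : 'rV[R]_(n + m) |
    forall j, (rsubmx u 0 j - M (lsubmx u) 0 j : R) = 0].
  apply: S_forall => j.
  apply: (@definable_pred_poly0 _ (fun u : 'rV[R]_(n + m) => rsubmx u 0 j - M (lsubmx u) 0 j) _ _
      id) => //.
  apply: poly_funB; apply: poly_fun_lin => a u v; first by rewrite !mxE.
  by rewrite linearP hM !mxE.
have := S_proj (S_setI hG (S_prodl n hA)); congr (S _); apply/seteqP; split => u /=.
  case=> w []; rewrite row_mxKl row_mxKr => h; rewrite (_ : w = M u) //.
  by apply/rowP => j; apply/eqP; rewrite -subr_eq0 h.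
by move=> h; exists (M u); rewrite row_mxKl row_mxKr; split=> // j; rewrite subrr.
Qed.

Definition definable_fun (T : lmodType R) (g : T -> R) :=
  definable_pred (fun p : T * R^o => g p.1 = p.2).

Lemma definable_fun_lin (T U : lmodType R) (L : T -> U) (g : U -> R) :
  is_lin L -> definable_fun g -> definable_fun (fun t => g (L t)).
Proof.
move=> hL hg.
apply: (@definable_pred_lin _ _ (fun p : T * R^o => (L p.1, p.2) : U * R^o) _ _ hg).
by move=> a u v; apply: injective_projections => /=; rewrite ?hL.
Qed.

Lemma definable_fun_poly (T : lmodType R) (p : T -> R) : poly_fun p -> definable_fun p.
Proof.
move=> hp; apply: (@definable_pred_ext _ (fun u : T * R^o => p u.1 - u.2 = 0)).
  by move=> t; split => [/subr0_eq //|->]; rewrite subrr.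
apply: definable_pred_poly0; apply: poly_funB; last exact: poly_fun_lin.
by move=> n phi hphi; apply: (hp n (fun v => (phi v).1)) => a u v; rewrite hphi.
Qed.

(** Substitution is done by naming the two values with existential quantifiers, that is, by
    projecting an intersection of graphs. *)
Lemma definable_pred_comp2 (T : lmodType R) (g h : T -> R) (P : R -> R -> Prop) :
  definable_fun g -> definable_fun h -> definable_pred (fun q : R^o * R^o => P q.1 q.2) ->
  definable_pred (fun t => P (g t) (h t)).
Proof.
move=> hg hh hP.
apply: (@definable_pred_ext _ (fun t => exists a, exists b, (g t = a /\ h t = b) /\ P a b)).
  by move=> t; split => [[a [b [[-> ->]]]] //|h0]; exists (g t), (h t).
apply: definable_pred_exR; apply: definable_pred_exR; apply: definable_pred_and; first apply:
    definable_pred_and.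
- by apply: (@definable_pred_lin _ _ (fun p : T * R^o * R^o => (p.1.1, p.1.2) : T * R^o) _ _ hg).
- by apply: (@definable_pred_lin _ _ (fun p : T * R^o * R^o => (p.1.1, p.2) : T * R^o) _ _ hh).
- by apply: (@definable_pred_lin _ _ (fun p : T * R^o * R^o => (p.1.2, p.2) : R^o * R^o) _ _ hP).
Qed.

Lemma definable_fun_comp2 (T : lmodType R) (g h : T -> R) (o : R -> R -> R) :
  definable_fun g -> definable_fun h -> poly_fun (fun q : R^o * R^o => o q.1 q.2) ->
  definable_fun (fun t => o (g t) (h t)).
Proof.
move=> hg hh ho.
have hg' := @definable_fun_lin (T * R^o)%type _ fst _ (fun _ _ _ => erefl) hg.
have hh' := @definable_fun_lin (T * R^o)%type _ fst _ (fun _ _ _ => erefl) hh.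
rewrite /definable_fun.
apply: (@definable_pred_ext _ (fun p : T * R^o => exists a, g p.1 = a /\ o a (h p.1) = p.2)).
  by move=> t; split => [[a [->]] //|h0]; exists (g t.1).
apply: definable_pred_exR; apply: definable_pred_and => //=.
apply: (@definable_pred_ext _ (fun p : T * R^o * R^o => exists b, h p.1.1 = b /\ o p.2 b = p.1.2)).
  by move=> t; split => [[a [->]] //|h0]; exists (h t.1.1).
apply: definable_pred_exR; apply: definable_pred_and.
  by apply: (@definable_pred_lin _ _ (fun p : T * R^o * R^o * R^o => (p.1.1.1, p.2) : T * R^o) _
      _ hh).
by apply: (@definable_pred_lin _ _ (fun p : T * R^o * R^o * R^o => ((p.1.2, p.2), p.1.1.2) :
   R^o * R^o * R^o) _ _ (definable_fun_poly ho)).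
Qed.

Lemma definable_funD (T : lmodType R) (g h : T -> R) :
  definable_fun g -> definable_fun h -> definable_fun (fun t => g t + h t).
Proof. by move=> hg hh; apply: (@definable_fun_comp2 _ g h (fun a b => a + b)) => //; apply:
    poly_funD; apply: poly_fun_lin. Qed.

Lemma definable_funM (T : lmodType R) (g h : T -> R) :
  definable_fun g -> definable_fun h -> definable_fun (fun t => g t * h t).
Proof. by move=> hg hh; apply: (@definable_fun_comp2 _ g h (fun a b => a * b)) => //; apply:
    poly_funM; apply: poly_fun_lin. Qed.

Lemma definable_funB (T : lmodType R) (g h : T -> R) :
  definable_fun g -> definable_fun h -> definable_fun (fun t => g t - h t).
Proof. by move=> hg hh; apply: (@definable_fun_comp2 _ g h (fun a b => a - b)) => //; apply:
    poly_funB; apply: poly_fun_lin. Qed.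

Lemma definable_fun_cst (T : lmodType R) c : definable_fun (fun _ : T => c).
Proof. by apply: definable_fun_poly; apply: poly_fun_cst. Qed.

Lemma definable_fun_linf (T : lmodType R) (L : T -> R^o) : is_lin L -> definable_fun L.
Proof. by move=> hL; apply: definable_fun_poly; apply: poly_fun_lin. Qed.

Lemma definable_fun_sum (T : lmodType R) (I : Type) (r : seq I) (g : I -> T -> R) :
  (forall i, definable_fun (g i)) -> definable_fun (fun t => \sum_(i <- r) g i t).
Proof.
move=> hg; elim: r => [|i r IH].
  rewrite (_ : (fun t => _) = (fun _ : T => 0 : R)); first exact: definable_fun_cst.
  by apply/funext => t; rewrite big_nil.
rewrite (_ : (fun t => _) = (fun t : T => g i t + \sum_(j <- r) g j t)); first exact:
    definable_funD.
by apply/funext => t; rewrite big_cons.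
Qed.

(** The axioms provide zero sets of polynomials, and the order comes from projecting one of them: a
    <= b means that b - a is a square. *)
Lemma definable_pred_le (T : lmodType R) (g h : T -> R) :
  definable_fun g -> definable_fun h -> definable_pred (fun t => g t <= h t).
Proof.
move=> hg hh; apply: (@definable_pred_comp2 _ g h (fun a b => a <= b)) => //.
apply: (@definable_pred_ext _ (fun q : R^o * R^o => exists c : R, (q.2 - q.1 : R) - c * c = 0)).
  move=> [a b] /=; split => [[c /subr0_eq e]|ab].
    by rewrite -subr_ge0 e -expr2 sqr_ge0.
  exists (Num.sqrt (b - a)); rewrite -expr2 sqr_sqrtr ?subr_ge0 //.
  by rewrite subrr.
apply: definable_pred_exR; apply: definable_pred_poly0; apply: poly_funB.
  by apply: poly_funB; apply: poly_fun_lin.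
by apply: poly_funM; apply: poly_fun_lin.
Qed.

Lemma definable_pred_lt (T : lmodType R) (g h : T -> R) :
  definable_fun g -> definable_fun h -> definable_pred (fun t => g t < h t).
Proof.
move=> hg hh; apply: definable_pred_ext (definable_pred_not (definable_pred_le hh hg)) => t.
by rewrite ltNge; split => /negP.
Qed.

Lemma definable_pred_eq (T : lmodType R) (g h : T -> R) :
  definable_fun g -> definable_fun h -> definable_pred (fun t => g t = h t).
Proof.
move=> hg hh; apply: definable_pred_ext (definable_pred_and (definable_pred_le hg hh)
    (definable_pred_le hh hg)) => t.
by split => [[? ?]|->] //; apply: le_anti; apply/andP.
Qed.

End OMinimal.

(** * Monotonicity of definable functions of one variable *)

Section Monotonicity.
Variables (R : realType) (S : forall n : nat, set (set 'rV[R]_n)).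
Hypothesis HS : o_minimal S.

Lemma itv_lower_germ (a : R) (x : itv_bound R) :
  rgt (fun s => (x <= BLeft s)%O) a \/ rgt (fun s => ~~ (x <= BLeft s)%O) a.
Proof.
case: x => [[] y|[]]; last 2 first.
- by left; exists 1.
- by right; exists 1.
- have [ya|ay] := leP y a.
    by left; exists 1 => // s /andP[? ?]; rewrite bnd_simp; lra.
  right; exists (y - a); rewrite ?subr_gt0 // => s /andP[? ?].
  by rewrite bnd_simp -ltNge; lra.
- have [ya|ay] := leP y a.
    by left; exists 1 => // s /andP[? ?]; rewrite bnd_simp; lra.
  right; exists (y - a); rewrite ?subr_gt0 // => s /andP[? ?].
  by rewrite bnd_simp -leNgt; lra.
Qed.

Lemma itv_upper_germ (a : R) (x : itv_bound R) :
  rgt (fun s => (BRight s <= x)%O) a \/ rgt (fun s => ~~ (BRight s <= x)%O) a.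
Proof.
case: x => [[] y|[]]; last 2 first.
- by right; exists 1.
- by left; exists 1.
- have [ya|ay] := leP y a.
    by right; exists 1 => // s /andP[? ?]; rewrite bnd_simp -leNgt; lra.
  left; exists (y - a); rewrite ?subr_gt0 // => s /andP[? ?].
  by rewrite bnd_simp; lra.
- have [ya|ay] := leP y a.
    by right; exists 1 => // s /andP[? ?]; rewrite bnd_simp -ltNge; lra.
  left; exists (y - a); rewrite ?subr_gt0 // => s /andP[? ?].
  by rewrite bnd_simp; lra.
Qed.

Lemma rgt_imp (P Q : R -> Prop) a : (forall s, P s -> Q s) -> rgt P a -> rgt Q a.
Proof. by move=> h [d d0 hd]; exists d => // s /hd /h. Qed.

Lemma itv_germ (a : R) (I : interval R) :
  rgt (fun s => s \in I) a \/ rgt (fun s => s \notin I) a.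
Proof.
case: I => x y.
have [hx|hx] := itv_lower_germ a x; last first.
  right; apply: rgt_imp hx => s; rewrite itv_boundlr; case: (_ <= _)%O => //.
have [hy|hy] := itv_upper_germ a y; last first.
  by right; apply: rgt_imp hy => s; rewrite itv_boundlr => /negbTE ->; rewrite andbF.
by left; apply: rgt_imp (rgtI hx hy) => s [h1 h2]; rewrite itv_boundlr h1.
Qed.

(** This is where the axiom on subsets of the line enters: just to the right of [a], a finite union
    of intervals is either everything or nothing. *)
Lemma definable_pred_rgt (P : R -> Prop) a : definable_pred S (P : R^o -> Prop) ->
  rgt P a \/ rgt (fun s => ~ P s) a.
Proof.
move=> hP; pose phi (v : 'rV[R]_1) : R^o := v 0 0.
have hphi : is_lin phi by move=> c u v; rewrite /phi !mxE.
have [l hl] := om_dim1 HS (hP _ _ hphi).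
have PE s : P s <-> exists2 I, I \in l & s \in I.
  have /= := congr1 (fun A : set 'rV[R]_1 => A (const_mx s)) hl.
  by rewrite /phi mxE => ->.
have : rgt (fun s => exists2 I, I \in l & s \in I) a \/
    rgt (fun s => ~ exists2 I, I \in l & s \in I) a.
  elim: l {hl PE} => [|I l [IH|IH]].
  - by right; exists 1 => // s _ [].
  - left; apply: rgt_imp IH => s [J Jl sJ]; exists J => //.
    by rewrite inE Jl orbT.
  - have [hI|hI] := itv_germ a I.
      by left; apply: rgt_imp hI => s sI; exists I => //; rewrite inE eqxx.
    right; apply: rgt_imp (rgtI IH hI) => s [h1 h2] [J].
    rewrite inE => /predU1P[->|Jl sJ]; first by apply/negP.
    by apply: h1; exists J.
by case=> h; [left|right]; apply: rgt_imp h => s; rewrite PE.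
Qed.

Lemma definable_pred_lft (P : R -> Prop) a : definable_pred S (P : R^o -> Prop) ->
  lft P a \/ lft (fun s => ~ P s) a.
Proof.
move=> hP; have hP' : definable_pred S (fun s : R^o => P (- s)).
  by apply: definable_pred_lin hP => c u v; rewrite opprD scalerN.
by case: (definable_pred_rgt (- a) hP') => -[d d0 h]; [left|right]; exists d => // s /andP[? ?];
  rewrite -[s]opprK; apply: h; apply/andP; split; lra.
Qed.

(** A germ condition is a first order formula over a definable predicate. Hence the behaviour of a
    function just beside [s] is itself a definable property of [s], to which the dichotomy applies
    again. *)
Lemma definable_pred_rgtP (T : lmodType R) (P : T -> R -> Prop) (q : T -> R) :
  definable_fun S q -> definable_pred S (fun p : T * R^o => P p.1 p.2) -> definable_pred S (fun t
      => rgt (P t) (q t)).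
Proof.
move=> hq hP.
apply: (@definable_pred_ext _ _ _ (fun t => exists d, 0 < d /\
    forall s, (q t < s /\ s < q t + d) -> P t s)).
  move=> t; split; first by case=> d [d0 h]; exists d => // s /andP[? ?]; apply: h.
  by case=> d d0 h; exists d; split => // s [? ?]; apply: h; apply/andP.
apply: (definable_pred_exR HS); apply: (definable_pred_and HS).
  by apply: (definable_pred_lt HS); [apply: (definable_fun_cst HS)|apply: (definable_fun_linf HS)].
have hq' := @definable_fun_lin _ _ (T * R^o * R^o)%type _ (fun p => p.1.1) q (fun _ _ _ => erefl)
    hq.
apply: (definable_pred_allR HS); apply: (definable_pred_imp HS).
  apply: (definable_pred_and HS); apply: (definable_pred_lt HS) => //; first exact:
      (definable_fun_linf HS).
    exact: (definable_fun_linf HS).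
  by apply: (definable_funD HS) => //; apply: (definable_fun_linf HS).
by apply: (@definable_pred_lin _ _ _ _ (fun p : T * R^o * R^o => (p.1.1, p.2) : T * R^o) _ _ hP).
Qed.

Lemma definable_pred_lftP (T : lmodType R) (P : T -> R -> Prop) (q : T -> R) :
  definable_fun S q -> definable_pred S (fun p : T * R^o => P p.1 p.2) -> definable_pred S (fun t
      => lft (P t) (q t)).
Proof.
move=> hq hP.
apply: (@definable_pred_ext _ _ _ (fun t => rgt (fun s => P t (- s)) (0 - q t))).
  move=> t; split => -[d d0 h]; exists d => // s /andP[? ?].
    by rewrite -[s]opprK; apply: h; apply/andP; split; lra.
  by apply: h; apply/andP; split; lra.
apply: definable_pred_rgtP; first by apply: (definable_funB HS) => //; apply: (definable_fun_cst
    HS).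
apply: (@definable_pred_lin _ _ _ _ (fun p : T * R^o => (p.1, - p.2) : T * R^o) _ _ hP).
by move=> c u v; apply: injective_projections => //=; rewrite opprD scalerN.
Qed.

(** For [s] near 0, whether [g] stays above [g s] just to the right, and below it just to the left,
    no longer depends on [s]. If both hold or both fail, local comparisons propagate by real
    induction; if one holds alone, every point is a local extremum, strict on one side, which
    [not_asym_near] excludes. *)
Theorem definable_fun_monotone (g : R -> R) : definable_fun S (g : R^o -> R) ->
  exists2 eta, 0 < eta &
    (forall s t, 0 < s -> s <= t -> t < eta -> g s <= g t) \/
    (forall s t, 0 < s -> s <= t -> t < eta -> g t <= g s).
Proof.
move=> hg.
have d1 : definable_fun S (fun p : R^o * R^o => g p.1) by apply: definable_fun_lin hg.
have d2 : definable_fun S (fun p : R^o * R^o => g p.2) by apply: definable_fun_lin hg.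
have did : definable_fun S (fun s : R^o => s) by apply: (definable_fun_linf HS).
have dr : definable_pred S (fun s : R^o => rgt (fun u => g s <= g u) s).
  by apply: (@definable_pred_rgtP R^o (fun s u => g s <= g u)) => //; apply: (definable_pred_le HS).
have dl : definable_pred S (fun s : R^o => lft (fun u => g u <= g s) s).
  by apply: (@definable_pred_lftP R^o (fun s u => g u <= g s)) => //; apply: (definable_pred_le HS).
have tr s : ~ rgt (fun u => g s <= g u) s -> rgt (fun u => g u < g s) s.
  have h : definable_pred S (fun u : R^o => g s <= g u).
    by apply: (definable_pred_le HS) => //; apply: (definable_fun_cst HS).
  by case: (definable_pred_rgt s h) => // h' _; apply: rgt_imp h' => u /negP; rewrite -ltNge.
have tl s : ~ lft (fun u => g u <= g s) s -> lft (fun u => g s < g u) s.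
  have h : definable_pred S (fun u : R^o => g u <= g s).
    by apply: (definable_pred_le HS) => //; apply: (definable_fun_cst HS).
  case: (definable_pred_lft s h) => // -[d d0 h'] _; exists d => // u /h' /negP.
  by rewrite -ltNge.
have [[e1 e10 hr]|[e1 e10 hr]] := definable_pred_rgt 0 dr;
have [[e2 e20 hl]|[e2 e20 hl]] := definable_pred_rgt 0 dl;
exists (Num.min e1 e2); rewrite ?lt_min ?e10 //.
- left=> s t s0 st tm; apply: (@locally_nondecreasing _ 0 _ g _ _ s t s0 st tm) => u /andP[u0];
  rewrite lt_min => /andP[? ?]; last by apply: hl; rewrite add0r u0.
  by apply: hr; rewrite add0r u0.
(* Every point would be a local minimum, strict from the left. *)
- exfalso; apply: (@not_asym_near _ 0 (Num.min e1 e2)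
    (fun s u => (u < s -> g s < g u) /\ (s < u -> g s <= g u))).
  + by rewrite lt_min e10.
  + by move=> s t st [_ /(_ st) h1] [/(_ st) h2 _]; lra.
  + move=> s; rewrite lt_min => /and3P[s0 s1 s2].
    have [|d d0 h] := hr s; first by rewrite s0 add0r.
    by exists d => // u /[dup] /h ? /andP[? ?]; split=> // ?; lra.
  + move=> s; rewrite lt_min => /and3P[s0 s1 s2].
    have /tl[d d0 h] : ~ lft (fun u => g u <= g s) s by apply: hl; rewrite s0 add0r.
    by exists d => // u /[dup] /h ? /andP[? ?]; split=> // ?; lra.
(* Every point would be a local maximum, strict from the right. *)
- exfalso; apply: (@not_asym_near _ 0 (Num.min e1 e2)
    (fun s u => (s < u -> g u < g s) /\ (u < s -> g u <= g s))).
  + by rewrite lt_min e10.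
  + by move=> s t st [/(_ st) h1 _] [_ /(_ st) h2]; lra.
  + move=> s; rewrite lt_min => /and3P[s0 s1 s2].
    have /tr[d d0 h] : ~ rgt (fun u => g s <= g u) s by apply: hr; rewrite s0 add0r.
    by exists d => // u /[dup] /h ? /andP[? ?]; split=> // ?; lra.
  + move=> s; rewrite lt_min => /and3P[s0 s1 s2].
    have [|d d0 h] := hl s; first by rewrite s0 add0r.
    by exists d => // u /[dup] /h ? /andP[? ?]; split=> // ?; lra.
- right=> s t s0 st tm; rewrite -lerN2.
  apply: (@locally_nondecreasing _ 0 _ (fun s => - g s) _ _ s t s0 st tm) => u /andP[u0];
  rewrite lt_min => /andP[? ?].
    have /tr[d d0 h] : ~ rgt (fun v => g u <= g v) u by apply: hr; rewrite u0 add0r.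
    by exists d => // v /h; lra.
  have /tl[d d0 h] : ~ lft (fun v => g v <= g u) u by apply: hl; rewrite u0 add0r.
  by exists d => // v /h; lra.
Qed.

End Monotonicity.

(** * Definable selection of minimisers *)

Section Selection.
Variables (R : realType) (S : forall n : nat, set (set 'rV[R]_n)).
Hypothesis HS : o_minimal S.

Lemma definable_fun_of_definable d (f : 'rV[R]_d -> R) :
  S [set v : 'rV[R]_(d + 1) | f (lsubmx v) = rsubmx v 0 0] -> definable_fun S f.
Proof.
move=> /(definable_pred_of_S HS) h.
pose L (p : 'rV[R]_d * R^o) : 'rV[R]_(d + 1) := row_mx p.1 (const_mx p.2).
have hL : is_lin L.
  move=> a u v; rewrite /L scale_row_mx add_row_mx; congr row_mx.
  by apply/rowP => i; rewrite !mxE.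
apply: definable_pred_ext (definable_pred_lin hL h) => -[u a] /=.
by rewrite /L row_mxKl row_mxKr mxE.
Qed.

(** A first order description of the derivative, needed to show that partial derivatives are
    definable. Squares replace absolute values and the quotient is cleared, so only sums and
    products of definable functions occur. *)
Lemma partialP d (f : 'rV[R]_d -> R) i u a : derivable f u (ebasis R i) ->
  partial i f u = a <-> forall eps, 0 < eps -> exists dl, 0 < dl /\
    forall h, (- dl < h /\ h < dl) ->
      (f (u + h *: ebasis R i) - f u - a * h) * (f (u + h *: ebasis R i) - f u - a * h)
      <= eps * h * (eps * h).
Proof.
move=> df.
have d0 := @is_derive_line R d f u i 0; rewrite scale0r addr0 in d0; have {}d0 := d0 df.
pose phi (h : R) := f (u + h *: ebasis R i).
have hE eps (h b : R) : 0 < eps ->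
    (`|phi (0 + h) - phi 0 - b * h| <= eps * `|h|) =
    ((f (u + h *: ebasis R i) - f u - b * h) * (f (u + h *: ebasis R i) - f u - b * h)
      <= eps * h * (eps * h)).
  move=> e0; rewrite /phi add0r scale0r addr0 -!expr2.
  rewrite -[in LHS](gtr0_norm e0) -normrM -ler_sqr ?nnegrE //.
  by rewrite !real_normK ?num_real.
split.
  move=> ea eps e0; have := (is_derive_near phi 0 a).1.
  rewrite -ea => /(_ d0 _ e0) H; have [dl dl0 hdl] := (near_normP _ _).1 H.
  exists dl; split=> // h [h1 h2]; rewrite -hE //; apply: hdl.
  by rewrite subr0 ltr_norml h1.
move=> H; have [_ <-] := d0.
have da : is_derive (0 : R) 1 phi a.
  apply/is_derive_near => eps e0; have [dl [dl0 hdl]] := H eps e0.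
  apply/near_normP; exists dl => // h; rewrite subr0 ltr_norml => /andP[h1 h2].
  by rewrite hE //; apply: hdl.
exact: (@derive_val _ _ _ _ _ _ _ da).
Qed.

Lemma definable_fun_partial d (f : 'rV[R]_d -> R) i : (forall u, derivable f u (ebasis R i)) ->
  definable_fun S f -> definable_fun S (partial i f).
Proof.
move=> df hf; rewrite /definable_fun.
apply: definable_pred_ext (fun p => iff_sym (partialP p.2 (df p.1))) _.
apply: (definable_pred_allR HS); apply: (definable_pred_imp HS).
  by apply: (definable_pred_lt HS); [apply: (definable_fun_cst HS) | apply: (definable_fun_linf
      HS)].
apply: (definable_pred_exR HS); apply: (definable_pred_and HS).
  by apply: (definable_pred_lt HS); [apply: (definable_fun_cst HS) | apply: (definable_fun_linf
      HS)].
apply: (definable_pred_allR HS).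
pose Q := ('rV[R]_d * R^o * R^o * R^o * R^o)%type.
have h1 : definable_fun S (fun p : Q => f (p.1.1.1.1 + p.2 *: ebasis R i)).
  apply: (@definable_fun_lin _ _ Q _ (fun p => p.1.1.1.1 + p.2 *: ebasis R i)) hf.
  by move=> a p q /=; rewrite scalerDl scalerDr addrACA scalerA.
have h2 : definable_fun S (fun p : Q => f p.1.1.1.1) by exact: (@definable_fun_lin _ _ Q _ (fun p
    => p.1.1.1.1)) hf.
have l1 : definable_fun S (fun p : Q => p.1.1.1.2) by exact: (definable_fun_linf HS).
have l2 : definable_fun S (fun p : Q => p.1.1.2) by exact: (definable_fun_linf HS).
have l3 : definable_fun S (fun p : Q => p.1.2) by exact: (definable_fun_linf HS).
have l4 : definable_fun S (fun p : Q => p.2) by exact: (definable_fun_linf HS).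
have D : definable_fun S (fun p : Q => f (p.1.1.1.1 + p.2 *: ebasis R i) - f p.1.1.1.1 -
    p.1.1.1.2 * p.2).
  by apply: (definable_funB HS); [apply: (definable_funB HS) | apply: (definable_funM HS)].
apply: (@definable_pred_imp _ _ HS Q (fun p : Q => - p.1.2 < p.2 /\ p.2 < p.1.2)).
  apply: (definable_pred_and HS).
    apply: (@definable_pred_lt _ _ HS Q (fun p : Q => - p.1.2)) => //.
    by apply: (definable_fun_linf HS) => a p q /=; rewrite opprD scalerN.
  exact: (@definable_pred_lt _ _ HS Q (fun p : Q => p.2)).
apply: (@definable_pred_le _ _ HS Q); first exact: (definable_funM HS D D).
have E : definable_fun S (fun p : Q => p.1.1.2 * p.2) by apply: (@definable_funM _ _ HS Q).
exact: (definable_funM HS E E).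
Qed.

Variable n : nat.
Implicit Types (P : R -> 'rV[R]_n -> Prop) (q : 'rV[R]_n -> R).

Definition argmin P q (s : R) (z : 'rV[R]_n) := P s z /\ forall w, P s w -> q z <= q w.

(** A definable family of compact fibres indexed by the level [s]. The class is stable under
    [argmin] for continuous definable objectives, so minimisations can be iterated. *)
Definition definable_compact P := definable_pred S (fun p : R^o * 'rV[R]_n => P p.1 p.2) /\
  forall s, compact [set z | P s z].

Lemma argmin_definable_compact P q : continuous q -> definable_fun S q -> definable_compact P ->
    definable_compact (argmin P q).
Proof.
move=> cq dq [dP cP]; split.
  apply: (definable_pred_and HS) => //; apply: (definable_pred_allV HS); apply:
      (definable_pred_imp HS).
    exact: (@definable_pred_lin _ _ _ _ (fun p : R^o * 'rV[R]_n * 'rV[R]_n => (p.1.1, p.2) : R^o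
        * 'rV[R]_n) _ _ dP).
  by apply: (definable_pred_le HS); apply: definable_fun_lin dq.
move=> s.
have [[z0 hz0]|h0] := pselect (exists z, argmin P q s z); last first.
  rewrite (_ : [set _ | _] = set0); first exact: compact0.
  by apply/seteqP; split => // z hz; case: h0; exists z.
rewrite (_ : [set _ | _] = [set z | P s z] `&` q @^-1` [set y | y <= q z0]).
  apply: compact_closedI => //; apply: preimage_closed; last exact: closed_le.
  by move=> z _; apply: cq.
apply/seteqP; split => z /=.
  by move=> [h1 h2]; split=> //; apply: h2; apply: hz0.1.
by move=> [h1 h2]; split=> // w Pw; apply: le_trans h2 _; apply: hz0.2.
Qed.

Lemma argmin_ex P q s : continuous q -> definable_compact P -> (exists z, P s z) -> exists z,
    argmin P q s z.
Proof.
move=> cq [_ cP] [z0 Pz0].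
have [|||z zP hz] := @EVT_min_rV R n q [set z | P s z].
- by exists z0.
- exact: cP.
- exact: continuous_subspaceT.
- by exists z; split; [move: zP; rewrite inE | move=> w Pw; apply: hz; rewrite inE].
Qed.

Lemma argmin_eq P q s z w : argmin P q s z -> argmin P q s w -> q z = q w.
Proof. by move=> [h1 h2] [h3 h4]; apply/le_anti; rewrite h2 // h4. Qed.

(** Successive minimisation of the listed coordinates. Once all are listed a nonempty fibre is
    reduced to one point, which gives a definable choice from compact fibres. *)
Fixpoint lexmin (ks : seq 'I_n) P : R -> 'rV[R]_n -> Prop :=
  if ks is k :: ks' then lexmin ks' (argmin P (fun z => z 0 k)) else P.

Lemma lexminP ks P : definable_compact P -> [/\ definable_compact (lexmin ks P),
  forall s z, lexmin ks P s z -> P s z,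
  forall s, (exists z, P s z) -> exists z, lexmin ks P s z &
  forall s z w k, k \in ks -> lexmin ks P s z -> lexmin ks P s w -> z 0 k = w 0 k].
Proof.
elim: ks P => [|k ks IH] P gP /=; first by split.
have cq : continuous (fun z : 'rV[R]_n => z 0 k) by apply: coord_continuous.
have dq : definable_fun S (fun z : 'rV[R]_n => z 0 k).
  by apply: (definable_fun_linf HS) => a u v; rewrite !mxE.
have gA := argmin_definable_compact cq dq gP; have [h1 h2 h3 h4] := IH _ gA.
split => //.
- by move=> s z /h2 [].
- by move=> s hs; apply: h3; apply: argmin_ex.
- move=> s z w j; rewrite inE => /predU1P[->|jk]; last exact: h4.
  by move=> /h2 hz /h2 hw; apply: argmin_eq hz hw.
Qed.

Theorem definable_minimiser (phase_energy N : 'rV[R]_n -> R) (E0 r : R) :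
  continuous phase_energy -> continuous N -> definable_fun S phase_energy -> definable_fun S N ->
  exists X : R -> 'rV[R]_n, (forall k, definable_fun S (fun s : R^o => X s 0 k)) /\
    forall s z, `|z| <= r -> phase_energy z = s + E0 ->
      [/\ `|X s| <= r, phase_energy (X s) = s + E0 & N (X s) <= N z].
Proof.
move=> cE cN dE dN.
(* The cube is described by coordinate inequalities, which are visibly definable; the clause
   [0 <= r] makes them equivalent to |z| <= r in dimension 0 too. *)
pose P (s : R) (z : 'rV[R]_n) := 0 <= r /\ (forall k, - r <= z 0 k /\ z 0 k <= r) /\ phase_energy
    z = s + E0.
have PE (z : 'rV[R]_n) : 0 <= r -> (forall k, - r <= z 0 k /\ z 0 k <= r) <-> `|z| <= r.
  move=> r0; split => [h|h k]; last first.
    by have := le_trans (mxnorm_ge_coord z 0 k) h; rewrite ler_norml => /andP.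
  by apply: mxnorm_le => // i j; rewrite ord1 ler_norml; have [-> ->] := h j.
have gP : definable_compact P.
  have dz k : definable_fun S (fun p : R^o * 'rV[R]_n => p.2 0 k).
    by apply: (definable_fun_linf HS) => a u v; rewrite !mxE.
  split.
    apply: (definable_pred_and HS); first by apply: (definable_pred_le HS); apply:
        (definable_fun_cst HS).
    apply: (definable_pred_and HS).
      apply: (definable_pred_forall_fin HS) => k.
      by apply: (definable_pred_and HS); apply: (definable_pred_le HS) => //; apply:
          (definable_fun_cst HS).
    apply: (definable_pred_eq HS); first by apply: definable_fun_lin dE.
    by apply: (definable_funD HS); [apply: (definable_fun_linf HS) | apply: (definable_fun_cst HS)].
  move=> s; have [r0|r0] := pselect (0 <= r); last first.
    rewrite (_ : [set _ | _] = set0); first exact: compact0.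
    by apply/seteqP; split => // z [].
  rewrite (_ : [set _ | _] = [set z : 'rV[R]_n | `|z| <= r] `&` phase_energy @^-1` [set s + E0]).
    apply: compact_closedI; first exact: compact_norm_le.
    apply: preimage_closed; first by move=> z _; apply: cE.
    exact: closed_eq.
  apply/seteqP; split => z /=; first by move=> [_ [/PE h1 h2]]; split => //; apply: h1.
  by move=> [h1 h2]; split => //; split => //; apply/PE.
have gA := argmin_definable_compact cN dN gP.
have [[g1 g2] h2 h3 h4] := lexminP (enum 'I_n) gA.
pose Q := lexmin (enum 'I_n) (argmin P N).
pose X s : 'rV[R]_n := xget 0 [set z | Q s z].
exists X; split.
  move=> k; rewrite /definable_fun.
  (* The second alternative describes the default value 0 on levels that miss the cube, so that [X]
     is definable on the whole line. *)
  apply: (@definable_pred_ext _ _ _ (fun p : R^o * R^o => (exists z, Q p.1 z /\ z 0 k = p.2) \/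
     (~ (exists z, Q p.1 z) /\ p.2 = 0))).
    move=> [s a] /=; have [[z Qz]|nQ] := pselect (exists z, Q s z).
      have QX : Q s (X s) by apply: (@xgetPex _ _ [set z | Q s z]); exists z.
      split; last by move=> <-; left; exists (X s).
      move=> [[w [Qw <-]]|[n1 _]]; last by case: n1; exists z.
      by apply: h4 QX Qw; rewrite mem_enum.
    have -> : X s = 0.
      by apply: xgetPN => z Qz; apply: nQ; exists z.
    rewrite mxE; split; last by move=> <-; right.
    by move=> [[w [Qw _]]|[_ ->] //]; case: nQ; exists w.
  apply: (definable_pred_or HS).
    apply: (definable_pred_exV HS); apply: (definable_pred_and HS).
      exact: (@definable_pred_lin _ _ _ _ (fun p : R^o * R^o * 'rV[R]_n => (p.1.1, p.2) : R^o *
          'rV[R]_n) _ _ g1).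
    apply: (definable_pred_eq HS); last exact: (definable_fun_linf HS).
    by apply: (definable_fun_linf HS) => a u v; rewrite !mxE.
  apply: (definable_pred_and HS).
    apply: (definable_pred_not HS); apply: (definable_pred_exV HS).
    exact: (@definable_pred_lin _ _ _ _ (fun p : R^o * R^o * 'rV[R]_n => (p.1.1, p.2) : R^o *
        'rV[R]_n) _ _ g1).
  by apply: (definable_pred_eq HS); [apply: (definable_fun_linf HS) | apply: (definable_fun_cst
      HS)].
move=> s z zr Ez.
have r0 : 0 <= r by apply: le_trans zr.
have Pz : P s z by split => //; split => //; apply/PE.
have [w Qw] : exists z, Q s z.
  by apply: h3; apply: argmin_ex => //; exists z.
have /h2 [[_ [h5 h6]] h7] : Q s (X s) by apply: (@xgetPex _ _ [set z | Q s z]); exists w.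
by split; [apply/PE | | apply: h7].
Qed.

End Selection.

(** * Length of bounded trajectories *)

Section LengthBound.
Variable R : realType.

Lemma derive_rgt (g : R -> R) (t l eps : R) : 0 < eps -> is_derive t 1 g l ->
  rgt (fun s => (l - eps) * (s - t) <= g s - g t <= (l + eps) * (s - t)) t.
Proof.
move=> e0 /is_derive_near /(_ _ e0) H; have [dl dl0 hdl] := (near_normP _ _).1 H.
exists dl => // s /andP[s1 s2].
have := hdl (s - t); rewrite subr0 gtr0_norm; last lra.
have -> : s - t < dl by lra.
move=> /(_ isT); rewrite (addrC t) subrK ler_norml => /andP[h1 h2].
by apply/andP; split; nra.
Qed.

(* A discontinuous V is allowed: V o e is nonincreasing, so its jumps only help. *)
Lemma dini_length (V e de L l : R -> R) (kap eta T0 : R) : 0 < kap ->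
  (forall s s', 0 < s -> s <= s' -> s' < eta -> V s <= V s') ->
  (forall t, T0 <= t -> 0 < e t < eta) ->
  (forall t, T0 <= t -> is_derive t 1 e (de t)) -> (forall t, T0 <= t -> de t <= 0) ->
  (forall t, T0 <= t -> is_derive t 1 L (l t)) ->
  (forall t, T0 <= t -> l t = 0 \/ exists2 G, 0 < G & [/\ 0 < l t, kap * G * l t <= - de t &
     lft (fun s => e t - s <= 2 * G * (V (e t) - V s)) (e t)]) ->
  forall t, T0 <= t -> V (e t) + kap / 8 * L t <= V (e T0) + kap / 8 * L T0.
Proof.
move=> k0 mV he hde hde0 hL hG t tT.
have k8 : 0 < kap / 8 by rewrite divr_gt0.
have em s u : T0 <= s -> s <= u -> e u <= e s.
  move=> s0 su; apply: (@derive_le0_nonincr _ e de s u su) => r /andP[r1 r2].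
    by apply: hde; lra.
  by apply: hde0; lra.
have Vm s u : T0 <= s -> s <= u -> V (e u) <= V (e s).
  move=> s0 su; apply: mV; last 2 first.
  - exact: em.
  - by have /andP[] := he s s0.
  - by have /andP[] : 0 < e u < eta by apply: he; lra.
apply/ler_addgt0Pr => eps eps0.
have d0 : 0 < 1 + (t - T0) by lra.
(* An extra slope [ep] leaves room for the first order errors in the induction; its total cost at
   time [t] is at most [eps]. *)
pose ep := eps / (1 + (t - T0)).
have ep0 : 0 < ep by rewrite divr_gt0.
suff h : forall u, T0 <= u <= t ->
    V (e u) + kap / 8 * L u <= V (e T0) + kap / 8 * L T0 + ep * (u - T0).
  apply: le_trans (h t _) _; first by rewrite tT lexx.
  rewrite lerD2l /ep mulrAC ler_pdivrMr //; nra.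
apply: real_ind => //; first lra.
- move=> u /andP[u0 ut] hu.
  have hu' : V (e u) + kap / 8 * L u <= V (e T0) + kap / 8 * L T0 + ep * (u - T0).
    by apply: hu; rewrite u0 lexx.
  have [l0|[G G0 [l0 hk [d1 d10 hd1]]]] := hG u u0.
    pose a := ep / (kap / 8).
    have a0 : 0 < a by rewrite divr_gt0.
    apply: rgt_imp (rgtI (derive_rgt a0 (hL u u0)) (_ : rgt (fun s => u < s) u)).
      move=> s [/andP[_ h1] us]; rewrite l0 add0r in h1.
      have h2 : kap / 8 * (L s - L u) <= ep * (s - u).
        apply: le_trans (_ : kap / 8 * (a * (s - u)) <= _); first by rewrite ler_pM2l.
        by rewrite mulrA /a mulrCA mulfV ?gt_eqF // mulr1.
      have := Vm u s u0 (ltW us); lra.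
    by exists 1 => // s /andP[].
  have nde : 0 < - de u.
    by apply: lt_le_trans hk; rewrite !mulr_gt0.
  have nde2 : 0 < - de u / 2 by rewrite divr_gt0.
  (* Just after [u], [L] gains at most 2 l (s - u) and [e] loses at least half of its linear
     prediction, so [V] loses at least (- de) (s - u) / (4 G) >= kap l (s - u) / 4. This pays for
     the gain of (kap / 8) L, whence the 8. The window keeps the loss of [e], at most 2 (- de) (s -
     u), below [d1]. *)
  apply: rgt_imp (rgtI (rgtI (derive_rgt l0 (hL u u0)) (derive_rgt nde2 (hde u u0)))
    (_ : rgt (fun s => u < s /\ (- de u) * 2 * (s - u) < d1) u)).
    move=> s [[/andP[_ h1] /andP[h2 h3]] [us h4]].
    have su : 0 < s - u by lra.
    have h5 : e s < e u.
      have : 0 < - de u / 2 * (s - u) by rewrite mulr_gt0.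
      lra.
    have h6 : e u - d1 < e s.
      have : (- de u / 2) * (s - u) <= (- de u) * (s - u) by nra.
      lra.
    have h7 : e u - e s <= 2 * G * (V (e u) - V (e s)) by apply: hd1; rewrite h6.
    have h8 : kap * l u / 4 * (s - u) <= V (e u) - V (e s).
      have h9 : kap * G * l u * (s - u) <= - de u * (s - u) by rewrite ler_pM2r.
      have h10 : kap * G * l u * (s - u) <= 4 * G * (V (e u) - V (e s)) by lra.
      rewrite -(ler_pM2l G0); lra.
    have h11 : kap / 8 * (L s - L u) <= kap / 8 * (2 * l u * (s - u)).
      by rewrite ler_pM2l //; lra.
    have : 0 <= ep * (s - u) by rewrite mulr_ge0 // ltW.
    lra.
  exists (d1 / ((- de u) * 2)); first by rewrite divr_gt0 // mulr_gt0.
  move=> s /andP[s1 s2]; split=> //.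
  have : s - u < d1 / (- de u * 2) by lra.
  by rewrite ltr_pdivlMr ?mulr_gt0 // mulrC.
- move=> u /andP[u0 ut] hu.
  rewrite leNgt; apply/negP => hc.
  pose A := V (e u) + kap / 8 * L u.
  pose Bd := V (e T0) + kap / 8 * L T0 + ep * (u - T0).
  have {}hc : Bd < A := hc.
  have g0 : 0 < (A - Bd) / kap by rewrite divr_gt0 // subr_gt0.
  have Lc := is_derive_cts (hL u (ltW u0)).
  have [dl dl0 hdl] := (continuous_normP _ _).1 Lc _ g0.
  pose w := Num.max T0 (u - dl / 2).
  have wu : w < u by rewrite gt_max u0; lra.
  have w0 : T0 <= w by rewrite le_max lexx.
  have wd : u - dl / 2 <= w by rewrite le_max lexx orbT.
  have hw : `|w - u| < dl by rewrite ltr_norml; apply/andP; split; lra.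
  have h1 : `|L w - L u| <= (A - Bd) / kap := hdl w hw.
  have h2 : V (e w) + kap / 8 * L w <= V (e T0) + kap / 8 * L T0 + ep * (w - T0).
    by apply: hu; rewrite w0.
  have h3 := Vm w u w0 (ltW wu).
  have h4 : kap / 8 * (L u - L w) <= (A - Bd) / 8.
    rewrite (_ : (A - Bd) / 8 = kap / 8 * ((A - Bd) / kap)); last by field; rewrite gt_eqF.
    by rewrite ler_pM2l //; move: h1; rewrite distrC; apply: le_trans; apply: ler_norm.
  have h5 : ep * (w - T0) <= ep * (u - T0) by rewrite ler_pM2l //; lra.
  have hA : A = V (e u) + kap / 8 * L u by [].
  have hB : Bd = V (e T0) + kap / 8 * L T0 + ep * (u - T0) by [].
  have : 0 < A - Bd by rewrite subr_gt0.
  lra.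
Qed.

Lemma nondecr_cvg (g : R -> R) (M : R) :
  (forall s t : R, 0 < s -> s <= t -> g s <= g t) -> (forall t : R, 0 < t -> `|g t| <= M) ->
  exists l : R, g t @[t --> +oo] --> l.
Proof.
move=> mg gM.
have [||l [l1 l2]] := @nonincr_inf R (fun t => - g t) (- M).
- by move=> s t s0 st; rewrite lerN2; apply: mg.
- by move=> t t0; rewrite lerN2; apply: le_trans (gM t t0); apply: ler_norm.
exists (- l); apply/cvg_pinftyP_norm => eps e0; have [T T0 hT] := l2 _ e0.
exists T => t Tt; have := l1 t; have := hT t (ltW Tt) => *.
by rewrite ler_norml; apply/andP; split; lra.
Qed.

Lemma fin_pos_min (n : nat) (a : 'I_n -> R) : (forall k, 0 < a k) ->
  exists2 b, 0 < b & forall k, b <= a k.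
Proof.
move=> a0; exists (\big[Num.min/1]_k a k).
  by apply/lt_bigmin => [|k _]; [exact: ltr01 | exact: a0].
by move=> k; apply: bigmin_le_cond.
Qed.

End LengthBound.

(** * The energy on phase space and its curve of minimisers *)

Section FiniteLength.
Variables (R : realType) (d : nat) (f : 'rV[R]_d -> R).
Hypothesis fC2 : C2 f.

Let phase_energy (z : 'rV[R]_(d + d)) := energy f (lsubmx z) (rsubmx z).
(** The squared Euclidean norm of the gradient of [phase_energy], whose two blocks are grad f(x) and
    y. *)
Let phase_gradnorm (z : 'rV[R]_(d + d)) :=
  \sum_i partial i f (lsubmx z) ^+ 2 + \sum_i rsubmx z 0 i ^+ 2.

Lemma lsubmx_cts : continuous (fun z : 'rV[R]_(d + d) => lsubmx z).
Proof.
move=> s; apply/continuous_normP => eps eps0; exists eps => // w /ltW.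
by apply: le_trans; rewrite -linearB; exact: lsubmx_norm.
Qed.

Lemma rsubmx_coord_cts i : continuous (fun z : 'rV[R]_(d + d) => rsubmx z 0 i).
Proof.
rewrite (_ : (fun z => _) = (fun z : 'rV[R]_(d + d) => z 0 (rshift d i))).
  exact: coord_continuous.
by apply/funext => z; rewrite mxE.
Qed.

Lemma rsubmx_sq_cts (z : 'rV[R]_(d + d)) :
  {for z, continuous (fun z : 'rV[R]_(d + d) => \sum_i rsubmx z 0 i ^+ 2)}.
Proof.
apply: (@continuous_sum_for _ _ _ (fun i (z : 'rV[R]_(d + d)) => rsubmx z 0 i ^+ 2)) => i.
by apply: (@continuousM _ _ (fun z : 'rV[R]_(d + d) => rsubmx z 0 i)); apply: rsubmx_coord_cts.
Qed.

Lemma phase_energy_cts : continuous phase_energy.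
Proof.
case: fC2 => [cf _] z.
apply: (@continuousD _ _ _ (fun z : 'rV[R]_(d + d) => f (lsubmx z))).
  by apply: (@continuous_comp _ _ _ (fun z : 'rV[R]_(d + d) => lsubmx z) f z (@lsubmx_cts z));
      apply: cf.
apply: (@continuousM _ _ (fun=> 2^-1)); first exact: cst_continuous.
exact: rsubmx_sq_cts.
Qed.

Lemma phase_gradnorm_cts : continuous phase_gradnorm.
Proof.
case: fC2 => [_ [_ [c1 _]]] z.
apply: (@continuousD _ _ _ (fun z : 'rV[R]_(d + d) => \sum_i partial i f (lsubmx z) ^+ 2)).
  apply: (@continuous_sum_for _ _ _ (fun i (z : 'rV[R]_(d + d)) => partial i f (lsubmx z) ^+ 2))
      => i.
  have h : {for z, continuous (fun z : 'rV[R]_(d + d) => partial i f (lsubmx z))}.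
    by apply: (@continuous_comp _ _ _ (fun z : 'rV[R]_(d + d) => lsubmx z) (partial i f) z
        (@lsubmx_cts z)); apply: c1.
  exact: (@continuousM _ _ (fun z : 'rV[R]_(d + d) => partial i f (lsubmx z)) _ _ h h).
exact: rsubmx_sq_cts.
Qed.

(** With partial derivatives at most [G] at [z], the linear part costs [G] in the sum norm, and the
    remainder is absorbed by a second [G] close to [z]. *)
Lemma energy_local_lipschitz (z : 'rV[R]_(d + d)) (G : R) : 0 < G ->
  (forall i, `|partial i f (lsubmx z)| <= G) -> (forall i, `|rsubmx z 0 i| <= G) ->
  exists2 dl, 0 < dl & forall w, `|w - z| < dl ->
    `|phase_energy w - phase_energy z| <= 2 * G * \sum_k `|w 0 k - z 0 k|.
Proof.
move=> G0 hp hy; case: fC2 => [_ [d1 [c1 _]]].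
have [dl dl0 hdl] := (near_normP _ _).1 (C1_diff_near (lsubmx z) d1 c1 G0).
(* The cap 2 G serves the kinetic part, where the increment is (delta / 2) (delta + 2 y_i): |delta|
   <= 2 G and |y_i| <= G give the constant 2 G. *)
exists (Num.min dl (2 * G)); first by rewrite lt_min dl0 mulr_gt0.
move=> w; rewrite lt_min => /andP[w1 w2].
have hl : `|lsubmx w - lsubmx z| < dl.
  by apply: le_lt_trans w1; rewrite -linearB lsubmx_norm.
have hf : `|f (lsubmx w) - f (lsubmx z)| <= 2 * G * \sum_i `|lsubmx w 0 i - lsubmx z 0 i|.
  have := hdl _ hl; set D := \sum_i _ => hD.
  have hD2 : `|D| <= G * \sum_i `|lsubmx w 0 i - lsubmx z 0 i|.
    apply: le_trans (ler_norm_sum _ _ _) _; rewrite mulr_sumr; apply: ler_sum => i _.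
    by rewrite normrM ler_wpM2r.
  rewrite -(subrK D (_ - _)); apply: le_trans (ler_normD _ _) _; lra.
have hq : `|2^-1 * (\sum_i rsubmx w 0 i ^+ 2) - 2^-1 * (\sum_i rsubmx z 0 i ^+ 2)| <=
    2 * G * \sum_i `|rsubmx w 0 i - rsubmx z 0 i|.
  rewrite -mulrBr -sumrB mulr_sumr; apply: le_trans (ler_norm_sum _ _ _) _.
  rewrite mulr_sumr; apply: ler_sum => i _.
  rewrite (_ : 2^-1 * _ = 2^-1 * (rsubmx w 0 i - rsubmx z 0 i + 2 * rsubmx z 0 i) *
    (rsubmx w 0 i - rsubmx z 0 i)); last by field.
  rewrite normrM ler_wpM2r // normrM gtr0_norm ?invr_gt0 //.
  have h1 : `|rsubmx w 0 i - rsubmx z 0 i| <= 2 * G.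
    apply: le_trans (ltW w2); apply: le_trans (mxnorm_ge_coord (w - z) 0 (rshift d i)).
    by rewrite !mxE.
  have := ler_normD (rsubmx w 0 i - rsubmx z 0 i) (2 * rsubmx z 0 i).
  rewrite (normrM 2) [`|2|]gtr0_norm //; have := hy i; lra.
rewrite /phase_energy /energy opprD addrACA; apply: le_trans (ler_normD _ _) _.
rewrite big_split_ord /= mulrDr; apply: lerD.
  by apply: le_trans hf _; rewrite ler_pM2l ?mulr_gt0 //; apply: ler_sum => i _; rewrite !mxE.
by apply: le_trans hq _; rewrite ler_pM2l ?mulr_gt0 //; apply: ler_sum => i _; rewrite !mxE.
Qed.

Variables (S : forall n : nat, set (set 'rV[R]_n)).
Hypothesis HS : o_minimal S.
Hypothesis Sf : S [set v : 'rV[R]_(d + 1) | f (lsubmx v) = rsubmx v 0 0].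

Lemma definable_fun_energy_gradnorm : definable_fun S phase_energy /\ definable_fun S
    phase_gradnorm.
Proof.
case: fC2 => [_ [d1 _]].
have df := definable_fun_of_definable HS Sf.
have ll : is_lin (fun z : 'rV[R]_(d + d) => lsubmx z) by move=> a u w; rewrite linearP.
have dr i : definable_fun S (fun z : 'rV[R]_(d + d) => rsubmx z 0 i).
  by apply: (definable_fun_linf HS) => a u w; rewrite !mxE.
have dq : definable_fun S (fun z : 'rV[R]_(d + d) => \sum_i rsubmx z 0 i ^+ 2).
  apply: (@definable_fun_sum _ _ HS _ _ _ (fun i (z : 'rV[R]_(d + d)) => rsubmx z 0 i ^+ 2)) => i.
  exact: (definable_funM HS (dr i) (dr i)).
split; apply: (definable_funD HS).
- exact: definable_fun_lin ll df.
- by apply: (definable_funM HS) => //; apply: (definable_fun_cst HS).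
- apply: (@definable_fun_sum _ _ HS _ _ _ (fun i (z : 'rV[R]_(d + d)) => partial i f (lsubmx z)
    ^+ 2)) => i.
  have h : definable_fun S (fun z : 'rV[R]_(d + d) => partial i f (lsubmx z)).
    by apply: definable_fun_lin ll _; apply: (definable_fun_partial HS) => //; apply: d1.
  exact: (definable_funM HS h h).
- exact: dq.
Qed.

(* This replaces the Kurdyka-Lojasiewicz inequality: V is the length of the
   curve X of minimisers of |grad phase_energy|, and plays the role of a
   desingularising function. *)
Lemma desingularise (E0 r : R) : exists V : R -> R, exists2 eta, 0 < eta &
  [/\ forall s s', 0 < s -> s <= s' -> s' < eta -> V s <= V s',
      exists M, forall s, 0 < s < eta -> (exists2 z, `|z| <= r & phase_energy z = s + E0) ->
          `|V s| <= M &
      forall z s G, `|z| <= r -> phase_energy z = s + E0 -> 0 < s < eta -> 0 < G ->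
          phase_gradnorm z <= G ^+ 2 ->
        (forall s', 0 < s' < s -> exists2 w, `|w| <= r & phase_energy w = s' + E0) ->
        lft (fun s' => s - s' <= 2 * G * (V s - V s')) s].
Proof.
have [dE dN] := definable_fun_energy_gradnorm.
have [X [dX hX]] := definable_minimiser HS E0 r phase_energy_cts phase_gradnorm_cts dE dN.
have hm k : exists p : R * R, 0 < p.1 /\ (p.2 = 1 \/ p.2 = -1) /\
    forall s t, 0 < s -> s <= t -> t < p.1 -> p.2 * X s 0 k <= p.2 * X t 0 k.
  have [e e0 [h|h]] := definable_fun_monotone HS (dX k).
    exists (e, 1); split => //; split; first by left.
    by move=> s t s0 st te; rewrite !mul1r; apply: h.
  exists (e, -1); split => //; split; first by right.
  by move=> s t s0 st te; rewrite !mulN1r lerN2; apply: h.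
have [p hp] := choice hm.
have [eta eta0 heta] := fin_pos_min (fun k => (hp k).1).
(* The signs make every summand nondecreasing, so increments of [V] are exactly the variation of [X]
   in the sum norm. *)
pose V s := \sum_k (p k).2 * X s 0 k.
have Vabs s t : 0 < s -> s <= t -> t < eta -> V t - V s = \sum_k `|X s 0 k - X t 0 k|.
  move=> s0 st te; rewrite /V -sumrB; apply: eq_bigr => k _.
  have [_ [hs hmon]] := hp k; have := hmon s t s0 st (lt_le_trans te (heta k)).
  by case: hs => ->; rewrite ?mul1r ?mulN1r => h; [rewrite distrC | ]; rewrite ger0_norm; lra.
exists V, eta => //; split.
- move=> s t s0 st te; rewrite -subr_ge0 Vabs //; exact: sumr_ge0.
- exists (\sum_(k < d + d) r) => s _ [z zr ez]; have [Xr _ _] := hX s z zr ez.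
  apply: le_trans (ler_norm_sum _ _ _) _; apply: ler_sum => k _.
  have [_ [hs _]] := hp k; rewrite normrM.
  have -> : `|(p k).2| = 1 by case: hs => ->; rewrite ?normrN normr1.
  by rewrite mul1r; apply: le_trans (mxnorm_ge_coord _ _ _) Xr.
move=> z s G zr ez /andP[s0 se] G0 NG hlev.
have [Xr eX NX] := hX s z zr ez.
(* The minimality of [X s] is used here: a gradient bound at any point [z] of the level passes to
   [X s], which replaces the trajectory in the estimate. *)
have G2 : phase_gradnorm (X s) <= G ^+ 2 by apply: le_trans NX NG.
have hp1 i : `|partial i f (lsubmx (X s))| <= G.
  rewrite -ler_sqr ?nnegrE ?(ltW G0) // real_normK ?num_real //; apply: le_trans G2.
  have := coord_sumsq (fun i => partial i f (lsubmx (X s))) i.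
  by have := sumsq_ge0 (fun i => rsubmx (X s) 0 i); rewrite /phase_gradnorm; lra.
have hy1 i : `|rsubmx (X s) 0 i| <= G.
  rewrite -ler_sqr ?nnegrE ?(ltW G0) // real_normK ?num_real //; apply: le_trans G2.
  have := coord_sumsq (fun i => rsubmx (X s) 0 i) i.
  by have := sumsq_ge0 (fun i => partial i f (lsubmx (X s))); rewrite /phase_gradnorm; lra.
have [dl dl0 hdl] := energy_local_lipschitz G0 hp1 hy1.
exists (Num.min s (2 * G * dl)); first by rewrite lt_min s0 !mulr_gt0.
move=> s' /andP[h1 h2].
have hmin1 : Num.min s (2 * G * dl) <= s by rewrite ge_min lexx.
have hmin2 : Num.min s (2 * G * dl) <= 2 * G * dl by rewrite ge_min lexx orbT.
move: h1 hmin1 hmin2; set mn := Num.min _ _ => h1 hmin1 hmin2.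
have h3 : 0 < s' by lra.
have h4 : s - s' < 2 * G * dl by lra.
have [w wr ew] : exists2 w, `|w| <= r & phase_energy w = s' + E0 by apply: hlev; rewrite h3.
have [Xr' eX' _] := hX s' w wr ew.
rewrite (Vabs s' s h3 (ltW h2) se).
(* If [X s'] is near [X s], the energy difference s - s' is bounded by the local Lipschitz estimate.
   If [X] jumps by at least [dl], its variation is at least [dl], which suffices because the window
   imposes s - s' < 2 G dl. *)
have [near|far] := ltP `|X s' - X s| dl.
  apply: le_trans (hdl _ near); rewrite eX eX' distrC.
  by rewrite opprD addrACA subrr addr0 ler_norm.
apply: le_trans (ltW h4) _; rewrite ler_pM2l ?mulr_gt0 //.
apply: le_trans far _; apply: mxnorm_le => [|i k]; first exact: sumr_ge0.
by rewrite ord1 !mxE (bigD1 k) //= lerDl; apply: sumr_ge0.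
Qed.

End FiniteLength.

(** * Asymptotics of trajectories *)
Section Trajectory.
Variables (R : realType) (d : nat) (f : 'rV[R]_d -> R) (gamma : R -> R).
Variables (c C beta m B : R) (x v : R -> 'rV[R]_d).
Hypothesis fC2 : C2 f.
Hypothesis fm : forall u, m <= f u.
Hypothesis gamma_cts : forall t : R, 0 < t -> {for t, continuous gamma}.
Hypothesis c0 : 0 < c.
Hypothesis gc : forall t : R, 0 < t -> c <= gamma t.
Hypothesis gC : forall t : R, 0 < t -> gamma t <= C.
Hypothesis b0 : 0 < beta.
Hypothesis bg : forall t : R, 0 < t -> beta * gamma t <= 2.
Hypothesis dx : forall t : R, 0 < t -> forall i, is_derive t 1 (fun s => x s 0 i) (v t 0 i).
Hypothesis dv : forall t : R, 0 < t -> forall i, is_derive t 1 (fun s => v s 0 i)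
  (- gamma t * v t 0 i - beta * (\sum_j partial j (partial i f) (x t) * v t 0 j)
   - partial i f (x t)).

Definition shifted_velocity t : 'rV[R]_d := v t + beta *: grad f (x t).
Definition energy_at t := energy f (x t) (shifted_velocity t).
Definition energy_rate t := \sum_i (partial i f (x t) * v t 0 i +
  shifted_velocity t 0 i * (- gamma t * v t 0 i - partial i f (x t))).

Hypothesis EB : forall t : R, 0 < t -> energy_at t <= B.

Lemma shifted_velocityE t i : shifted_velocity t 0 i = v t 0 i + beta * partial i f (x t).
Proof. by rewrite !mxE. Qed.

Lemma velocityE t i : v t 0 i = shifted_velocity t 0 i - beta * partial i f (x t).
Proof. by rewrite shifted_velocityE addrK. Qed.

Lemma partial_along_derive (t : R) : 0 < t -> forall i, is_derive t 1 (fun s => partial i f (x s))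
  (\sum_j partial j (partial i f) (x t) * v t 0 j).
Proof.
move=> t0 i; case: fC2 => [_ [_ [_ [d2 c2]]]].
exact: is_derive_comp_C1 (d2 i) (c2 i) (dx t0).
Qed.

(** The derivative of beta grad f(x) cancels the Hessian term of the equation, so second derivatives
    of [f] disappear from the energy balance. *)
Lemma shifted_velocity_derive (t : R) : 0 < t -> forall i, is_derive t 1 (fun s =>
    shifted_velocity s 0 i)
  (- gamma t * v t 0 i - partial i f (x t)).
Proof.
move=> t0 i; have := is_deriveD (dv t0 i) (is_deriveZ beta (partial_along_derive t0 i)).
rewrite -[beta *: _]/(beta * _).
rewrite (_ : _ - _ + _ = - gamma t * v t 0 i - partial i f (x t)); last by ring.
by congr (is_derive _ _ _ _); apply/funext => s; rewrite shifted_velocityE.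
Qed.

Lemma energy_at_derive (t : R) : 0 < t -> is_derive t 1 energy_at (energy_rate t).
Proof.
move=> t0.
have h1 i : is_derive t 1 (fun s => x s 0 i) (shifted_velocity t 0 i - beta * partial i f (x t)).
  by rewrite -velocityE; apply: dx.
have h2 i : is_derive t 1 (fun s => shifted_velocity s 0 i)
    (- gamma t * (shifted_velocity t 0 i - beta * partial i f (x t)) - partial i f (x t)).
  by rewrite -velocityE; apply: shifted_velocity_derive.
have := energy_derive fC2 h1 h2; rewrite /energy_rate.
rewrite (_ : \sum_i _ = \sum_i (partial i f (x t) * v t 0 i +
  shifted_velocity t 0 i * (- gamma t * v t 0 i - partial i f (x t)))) //.
by apply: eq_bigr => i _; rewrite -velocityE.
Qed.

Lemma energy_rate_le (t : R) : 0 < t -> energy_rate t <= - (c / 4) * (\sum_i v t 0 i ^+ 2)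
  - (beta / 3) * \sum_i partial i f (x t) ^+ 2.
Proof.
move=> t0; have := energy_derive_le f (x t) (shifted_velocity t) c0 (gc t0) b0 (bg t0).
rewrite (_ : \sum_i _ = energy_rate t); last by apply: eq_bigr => i _; rewrite -velocityE.
by rewrite (eq_bigr (fun i => v t 0 i ^+ 2)) // => i _; rewrite -velocityE.
Qed.

Lemma energy_rate_le_velocity (t : R) : 0 < t -> c / 4 * (\sum_i v t 0 i ^+ 2) <= - energy_rate t.
Proof.
move=> t0; have := energy_rate_le t0.
have : 0 <= beta / 3 * \sum_i partial i f (x t) ^+ 2.
  by apply: mulr_ge0; [rewrite divr_ge0 // ltW | apply: sumsq_ge0].
lra.
Qed.

Lemma energy_rate_le_grad (t : R) : 0 < t -> beta / 3 * (\sum_i partial i f (x t) ^+ 2) <= -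
    energy_rate t.
Proof.
move=> t0; have := energy_rate_le t0.
have : 0 <= c / 4 * \sum_i v t 0 i ^+ 2.
  by apply: mulr_ge0; [rewrite divr_ge0 // ltW | apply: sumsq_ge0].
lra.
Qed.

Lemma energy_rate_le0 (t : R) : 0 < t -> energy_rate t <= 0.
Proof.
move=> t0; have := energy_rate_le_velocity t0.
have : 0 <= c / 4 * \sum_i v t 0 i ^+ 2.
  by apply: mulr_ge0; [rewrite divr_ge0 // ltW | apply: sumsq_ge0].
lra.
Qed.

Lemma energy_at_nonincr (s t : R) : 0 < s -> s <= t -> energy_at t <= energy_at s.
Proof.
move=> s0 st; apply: (@derive_le0_nonincr _ energy_at energy_rate s t st) => r /andP[sr rt].
  by apply: energy_at_derive; lra.
by apply: energy_rate_le0; lra.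
Qed.

Lemma energy_atE (t : R) : f (x t) + 2^-1 * (\sum_i shifted_velocity t 0 i ^+ 2) = energy_at t.
Proof. by []. Qed.

Lemma energy_at_ge (t : R) : m <= energy_at t.
Proof. by have := fm (x t); have := sumsq_ge0 (shifted_velocity t 0); rewrite -energy_atE; lra. Qed.

Lemma energy_rate_cts (t : R) : 0 < t -> {for t, continuous energy_rate}.
Proof.
move=> t0; have cg := gamma_cts t0.
have cv i := is_derive_cts (dv t0 i).
have cy i := is_derive_cts (shifted_velocity_derive t0 i).
have cp i := is_derive_cts (partial_along_derive t0 i).
apply: (@continuous_sum_for _ _ _ (fun i t => partial i f (x t) * v t 0 i +
  shifted_velocity t 0 i * (- gamma t * v t 0 i - partial i f (x t)))) => i.
apply: continuousD; first exact: (continuousM (cp i) (cv i)).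
apply: (continuousM (cy i)); apply: (@continuousB _ _ _ (fun t => - gamma t * v t 0 i)).
  by apply: (@continuousM _ _ (fun t => - gamma t) (fun t => v t 0 i)) => //; apply: continuousN.
exact: cp.
Qed.

(** The majorant is - E' / k, with primitive - E / k, and the energy stays between [m] and [B]. *)
Lemma integrable_le_dissipation (w : R -> 'rV[R]_d) (k : R) : 0 < k ->
  (forall t : R, 0 < t -> forall i, {for t, continuous (fun s => w s 0 i)}) ->
  (forall t : R, 0 < t -> k * (\sum_i w t 0 i ^+ 2) <= - energy_rate t) -> Lp_Rplus 2 w.
Proof.
move=> k0 cw hw.
rewrite /Lp_Rplus /Rplus.
apply: (@integrable_of_primitive R (fun t => enorm (w t) ^+ 2) (fun t => - k^-1 * energy_rate t)
  (fun t => - k^-1 * energy_at t) (k^-1 * (`|m| + `|B|))).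
- move=> t t0; rewrite enorm_sqr sumsq_ge0 /=.
  by rewrite mulNr -mulrN ler_pdivlMl //; apply: hw.
- move=> t t0; have ce := continuous_enorm (cw t t0).
  exact: (@continuousM _ _ (fun t => enorm (w t)) (fun t => enorm (w t)) t ce ce).
- move=> t t0; apply: (@continuousM _ _ (fun=> - k^-1) energy_rate).
    exact: cst_continuous.
  exact: energy_rate_cts.
- move=> t t0; exact: is_deriveZ (energy_at_derive t0).
- have ki : 0 < k^-1 by rewrite invr_gt0.
  move=> t t0; rewrite normrM normrN (gtr0_norm ki) ler_pM2l //.
  have := energy_at_ge t; have := EB t0; have := ler_norm B; have := ler_norm (- m).
  have := normr_ge0 B; have := normr_ge0 m; rewrite normrN ler_norml => *.
  by apply/andP; split; lra.
Qed.

Lemma L2_grad : Lp_Rplus 2 (fun t => grad f (x t)).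
Proof.
apply: (@integrable_le_dissipation _ (beta / 3)); first by rewrite divr_gt0.
  move=> t t0 i; rewrite (_ : (fun s => _) = (fun s => partial i f (x s))).
    exact: is_derive_cts (partial_along_derive t0 i).
  by apply/funext => s; rewrite mxE.
move=> t t0; rewrite (eq_bigr (fun i => partial i f (x t) ^+ 2)).
  exact: energy_rate_le_grad.
by move=> i _; rewrite mxE.
Qed.

Lemma L2_velocity : Lp_Rplus 2 v.
Proof.
apply: (@integrable_le_dissipation _ (c / 4)); first by rewrite divr_gt0.
  by move=> t t0 i; exact: is_derive_cts (dv t0 i).
exact: energy_rate_le_velocity.
Qed.

Variable M : R.
Hypothesis xM : forall t : R, 0 < t -> `|x t| <= M.

Lemma bounded_along (g : 'rV[R]_d -> R) : continuous g ->
  exists2 K, 0 <= K & forall t : R, 0 < t -> `|g (x t)| <= K.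
Proof.
move=> cg; have [K K0 hK] := continuous_bounded_on_ball M cg.
by exists K => // t t0; apply/hK/xM.
Qed.

Lemma shifted_velocity_bounded (t : R) i : 0 < t -> `|shifted_velocity t 0 i| <= 1 + 2 * (B - m).
Proof.
move=> t0; have h1 := coord_sumsq (shifted_velocity t 0) i; have h2 := EB t0; have h3 := fm (x t).
rewrite -energy_atE in h2; rewrite -real_normK ?num_real // in h1.
(* The kinetic energy is at most B - m, so y_i^2 <= 2 (B - m); then N <= 1 + N^2 replaces a square
   root. *)
have : 0 <= (`|shifted_velocity t 0 i| - 1) ^+ 2 by apply: sqr_ge0.
rewrite sqrrB1 => h4; have := normr_ge0 (shifted_velocity t 0 i).
have := sqr_ge0 `|shifted_velocity t 0 i|.
set N := `|_| in h1 h4 *; set q := N ^+ 2 in h1 h4 *; lra.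
Qed.

Lemma velocity_bounded : exists2 K, 0 <= K & forall t : R, 0 < t -> forall i, `|v t 0 i| <= K.
Proof.
case: fC2 => [_ [_ [c1 _]]].
have hK i : exists K, 0 <= K /\ forall t : R, 0 < t -> `|partial i f (x t)| <= K.
  by have [K K0 hK] := bounded_along (c1 i); exists K.
have [K hK'] := choice hK.
have bm : 0 <= B - m by rewrite subr_ge0 (le_trans (energy_at_ge 1)) // EB.
have K0 : 0 <= \sum_i K i by apply: sumr_ge0 => i _; apply: (hK' i).1.
exists (1 + 2 * (B - m) + beta * \sum_i K i).
  by have := mulr_ge0 (ltW b0) K0; lra.
move=> t t0 i; rewrite velocityE; apply: le_trans (ler_normB _ _) _.
apply: lerD; first exact: shifted_velocity_bounded.
rewrite normrM gtr0_norm // ler_pM2l //; apply: le_trans ((hK' i).2 t t0) _.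
by rewrite (bigD1 i) //= lerDl sumr_ge0 // => j _; apply: (hK' j).1.
Qed.

Lemma hess_along_bounded i : exists2 K, 0 <= K &
  forall t : R, 0 < t -> `|\sum_j partial j (partial i f) (x t) * v t 0 j| <= K.
Proof.
case: fC2 => [_ [_ [_ [_ c2]]]].
have hK j : exists K, 0 <= K /\ forall t : R, 0 < t -> `|partial j (partial i f) (x t)| <= K.
  by have [K K0 hK] := bounded_along (c2 i j); exists K.
have [K hK'] := choice hK; have [L L0 hL] := velocity_bounded.
exists (\sum_j K j * L).
  by apply: sumr_ge0 => j _; apply: mulr_ge0 => //; apply: (hK' j).1.
move=> t t0; apply: le_trans (ler_norm_sum _ _ _) _; apply: ler_sum => j _.
by rewrite normrM; apply: ler_pM => //; [apply: (hK' j).2 | apply: hL].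
Qed.

(** Boundedness of [x] bounds the Hessian along it and also the velocity, hence the time derivative
    that Barbalat's lemma requires. *)
Lemma partial_cvg0 i : partial i f (x t) @[t --> +oo] --> (0 : R).
Proof.
have [K K0 hK] := hess_along_bounded i.
have b3 : 0 < beta / 3 by rewrite divr_gt0.
apply: (barbalat b3 (fun t t0 => partial_along_derive t0 i) hK energy_at_derive _ (fun t _ =>
    energy_at_ge t)).
move=> t t0; have := energy_rate_le_grad t0.
have : beta / 3 * partial i f (x t) ^+ 2 <= beta / 3 * \sum_i partial i f (x t) ^+ 2.
  by rewrite ler_pM2l //; exact: (coord_sumsq (fun i => partial i f (x t))).
lra.
Qed.

Lemma velocity_cvg0 i : v t 0 i @[t --> +oo] --> (0 : R).
Proof.
have [K K0 hK] := hess_along_bounded i; have [L L0 hL] := velocity_bounded.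
case: fC2 => [_ [_ [c1 _]]]; have [P P0 hP] := bounded_along (c1 i).
have c4 : 0 < c / 4 by rewrite divr_gt0.
apply: (@barbalat _ (fun t => v t 0 i) _ energy_at energy_rate (`|C| * L + beta * K + P) _ m c4
  (fun t t0 => dv t0 i) _ energy_at_derive _ (fun t _ => energy_at_ge t)).
  move=> t t0; apply: le_trans (ler_normB _ _) _; apply: lerD; last exact: hP.
  apply: le_trans (ler_normB _ _) _; rewrite !normrM normrN.
  apply: lerD; last by rewrite gtr0_norm // ler_pM2l // hK.
  apply: ler_pM => //; last exact: hL.
  have := gc t0; have := gC t0; have := ler_norm C => *.
  by rewrite ger0_norm; lra.
move=> t t0; have := energy_rate_le_velocity t0.
have : c / 4 * v t 0 i ^+ 2 <= c / 4 * \sum_i v t 0 i ^+ 2.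
  by rewrite ler_pM2l //; exact: (coord_sumsq (v t 0)).
lra.
Qed.

Lemma shifted_velocity_cvg0 i : shifted_velocity t 0 i @[t --> +oo] --> (0 : R).
Proof.
rewrite (_ : (fun t => _) = (fun t => v t 0 i + beta * partial i f (x t))); last first.
  by apply/funext => t; rewrite shifted_velocityE.
rewrite -[X in _ --> X](addr0 0) -[X in _ --> _ + X](mulr0 beta).
apply: cvgD; first exact: velocity_cvg0.
by apply: cvgM; [apply: cvg_cst | apply: partial_cvg0].
Qed.

Lemma energy_at_limit : exists l, (forall t : R, 0 < t -> l <= energy_at t) /\
  forall eps, 0 < eps -> exists2 T, 0 < T & forall t, T <= t -> energy_at t < l + eps.
Proof. exact: nonincr_inf energy_at_nonincr (fun t _ => energy_at_ge t). Qed.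

(** The energy converges, being nonincreasing and bounded below, and its kinetic part tends to 0. *)
Lemma value_cvg : cvg (f (x t) @[t --> +oo]).
Proof.
have [l [l1 l2]] := energy_at_limit; apply/cvg_ex; exists l.
have hE : energy_at t @[t --> +oo] --> l.
  apply/cvg_pinftyP_norm => eps eps0; have [T T0 hT] := l2 _ eps0.
  exists T => t Tt; have := l1 t; have := hT t (ltW Tt) => *.
  by rewrite ger0_norm; lra.
have h0 : enorm (shifted_velocity t) @[t --> +oo] --> (0 : R) by apply: enorm_cvg0 => i; apply:
    shifted_velocity_cvg0.
rewrite (_ : (fun t => _) = (fun t => energy_at t - 2^-1 * (enorm (shifted_velocity t) * enorm
    (shifted_velocity t)))); last first.
  by apply/funext => t; rewrite -expr2 enorm_sqr -energy_atE addrK.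
suff : energy_at t - 2^-1 * (enorm (shifted_velocity t) * enorm (shifted_velocity t)) @[t -->
    +oo] --> l - 2^-1 * (0 * 0).
  by rewrite mulr0 mulr0 subr0.
apply: cvgB => //; apply: cvgM; first exact: cvg_cst.
exact: cvgM.
Qed.

(* [v] is only continuous on ]0, +oo[, so a primitive of its norm on the whole
   line is taken after freezing [v] below time 1; the two last terms of
   [speed_majorant] dominate the speed on ]0, 1]. *)
Let speed_from1 (t : R) := enorm (v (Num.max t 1)).

Lemma speed_from1_cts : continuous speed_from1.
Proof.
move=> t; apply: (@continuous_comp _ _ _ (fun s : R => Num.max s 1) (fun s => enorm (v s))).
  apply/continuous_normP => eps e0; exists eps => // s hs; apply: le_trans (ltW hs).
  have h1 := ler_norm (s - t); have h2 := ler_norm (t - s); rewrite (distrC t s) in h2.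
  rewrite ler_norml /Num.max /Order.max.
  by case: ltP => h3; case: ltP => h4; apply/andP; split; lra.
apply: continuous_enorm => i; apply: is_derive_cts (dv _ i).
by rewrite lt_max ltr01 orbT.
Qed.

Lemma speed_from1E (t : R) : 1 <= t -> speed_from1 t = enorm (v t).
Proof. by move=> t1; rewrite /speed_from1 max_l. Qed.

Variable L : R -> R.
Hypothesis L0 : L 0 = 0.
Hypothesis dL : forall t : R, is_derive t 1 L (speed_from1 t).

Lemma arclength_mono (s t : R) : s <= t -> L s <= L t.
Proof.
move=> st; rewrite -lerN2.
apply: (@derive_le0_nonincr _ (fun r => - L r) (fun r => - speed_from1 r) s t st) => r _.
by rewrite oppr_le0 enorm_ge0.
Qed.

Lemma arclength_bounded_intro (K T : R) : (forall t, T <= t -> L t <= K) ->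
  exists K', forall t : R, 0 < t -> `|L t| <= K'.
Proof.
move=> hK; exists K => t t0; rewrite ger0_norm; last by rewrite -L0 arclength_mono // ltW.
apply: (@le_trans _ _ (L (Num.max t T))); first by apply: arclength_mono; rewrite le_max lexx.
by apply: hK; rewrite le_max lexx orbT.
Qed.

Lemma velocity0_of_rate0 (t : R) : 0 < t -> energy_rate t = 0 -> enorm (v t) = 0.
Proof.
move=> t0 e; have := energy_rate_le_velocity t0; rewrite e oppr0 pmulr_rle0 ?divr_gt0 //
    -enorm_sqr => h.
by apply/eqP; rewrite -sqrf_eq0 eq_le h sqr_ge0.
Qed.

(** The square root is |grad E|. From y = x' + beta grad f one gets |grad E|^2 <= (1 + 2 beta^2)
    |grad f|^2 + 2 |x'|^2, and the inequality of the means bounds the product by (3 + 2 beta^2)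
    (|x'|^2 + |grad f|^2), which the dissipation controls. *)
Lemma dissipation_ge_product (t : R) : 0 < t ->
  Num.min (c / 4) (beta / 3) / (3 + 2 * beta ^+ 2) *
    (Num.sqrt (\sum_i partial i f (x t) ^+ 2 + \sum_i shifted_velocity t 0 i ^+ 2) + enorm (v t))
        * enorm (v t)
  <= - energy_rate t.
Proof.
move=> t0; have hd := energy_rate_le t0.
set b := \sum_i partial i f (x t) ^+ 2 in hd *.
have vs := enorm_sqr (v t); rewrite -vs in hd.
have b0' : 0 <= b by apply: sumsq_ge0.
set N := b + _; have N0 : 0 <= N by rewrite addr_ge0 // sumsq_ge0.
set l := enorm (v t) in vs hd *; have l0 : 0 <= l by apply: enorm_ge0.
have hN : N <= b + (2 * l ^+ 2 + 2 * beta ^+ 2 * b).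
  rewrite lerD2l vs !mulr_sumr -big_split /=; apply: ler_sum => i _; rewrite shifted_velocityE.
  by have := sqr_ge0 (v t 0 i - beta * partial i f (x t)); nra.
have hs := sqr_sqrtr N0; set g := Num.sqrt N in hs *.
have g0 : 0 <= g by apply: sqrtr_ge0.
have hk1 : Num.min (c / 4) (beta / 3) <= c / 4 by rewrite ge_min lexx.
have hk2 : Num.min (c / 4) (beta / 3) <= beta / 3 by rewrite ge_min lexx orbT.
have hk0 : 0 < Num.min (c / 4) (beta / 3) by rewrite lt_min !divr_gt0.
set k := Num.min _ _ in hk0 hk1 hk2 *.
have q0 : 0 < 3 + 2 * beta ^+ 2 by have := sqr_ge0 beta; lra.
have h1 : (g + l) * l <= (3 + 2 * beta ^+ 2) * (l ^+ 2 + b).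
  have := sqr_ge0 (g - l); have := sqr_ge0 l; have := mulr_ge0 (sqr_ge0 beta) b0'.
  have := mulr_ge0 (sqr_ge0 beta) (sqr_ge0 l); nra.
apply: (@le_trans _ _ (k * (l ^+ 2 + b))).
  rewrite (_ : k / _ * _ * l = k * ((g + l) * l / (3 + 2 * beta ^+ 2))); last first.
    by field; rewrite gt_eqF.
  by rewrite ler_pM2l // ler_pdivrMr // [leRHS]mulrC.
have h2 : k * l ^+ 2 <= c / 4 * l ^+ 2 by rewrite ler_wpM2r ?sqr_ge0.
have h3 : k * b <= beta / 3 * b by rewrite ler_wpM2r.
rewrite mulrDr; lra.
Qed.

Variable S : forall n : nat, set (set 'rV[R]_n).
Hypothesis HS : o_minimal S.
Hypothesis Sf : S [set w : 'rV[R]_(d + 1) | f (lsubmx w) = rsubmx w 0 0].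

Lemma arclength_bounded : exists K, forall t : R, 0 < t -> `|L t| <= K.
Proof.
have [l [l1 l2]] := energy_at_limit.
(* If the energy reaches its limit at a finite time, it is constant afterwards, the dissipation
   vanishes, and the trajectory stops. Otherwise it stays strictly above [l], as the desingularising
   function requires. *)
have [[t1 t10 h1]|hpos] := pselect (exists2 t, 0 < t & energy_at t <= l).
  have El t : t1 <= t -> energy_at t = l.
    move=> t1t; apply/le_anti; rewrite (l1 t) ?andbT; last lra.
    by apply: le_trans h1; apply: energy_at_nonincr.
  have dE0 t : t1 < t -> energy_rate t = 0.
    move=> t1t.
    have d1 : is_derive t 1 (cst l) (energy_rate t).
      apply: near_eq_is_derive (energy_at_derive _); last lra.
      apply/near_normP; exists (t - t1); first lra.
      by move=> s; rewrite ltr_norml => /andP[? ?]; rewrite El //; lra.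
    by rewrite -(@derive_val _ _ _ _ _ _ _ d1) derive_cst.
  pose T := t1 + 1.
  apply: (@arclength_bounded_intro (L T) T) => t Tt.
  apply: (@derive_le0_nonincr _ L speed_from1 T t Tt) => s /andP[s1 s2].
  by rewrite /T in s1; rewrite speed_from1E ?velocity0_of_rate0 ?dE0 //; lra.
have {}hpos t : 0 < t -> l < energy_at t.
  by move=> t0; rewrite ltNge; apply/negP => h; apply: hpos; exists t.
pose z t : 'rV[R]_(d + d) := row_mx (x t) (shifted_velocity t).
pose r := `|M| + (1 + 2 * (B - m)).
have bm : 0 <= B - m by rewrite subr_ge0 (le_trans (energy_at_ge 1)) // EB.
have zr t : 0 < t -> `|z t| <= r.
  move=> t0; apply: mxnorm_le => [|i k]; first by rewrite /r; have := normr_ge0 M; lra.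
  rewrite ord1; case: (split_ordP k) => j ->.
    rewrite row_mxEl; apply: le_trans (mxnorm_ge_coord _ _ _) _.
    by apply: le_trans (xM t0) _; have := ler_norm M; rewrite /r; lra.
  by rewrite row_mxEr; have := shifted_velocity_bounded j t0; have := normr_ge0 M; rewrite /r; lra.
have Ez t : energy f (lsubmx (z t)) (rsubmx (z t)) = (energy_at t - l) + l.
  by rewrite /z row_mxKl row_mxKr subrK.
(* Every level between [l] and the current energy is crossed later by the trajectory itself, by the
   intermediate value theorem, and so is attained inside the cube of radius [r]. *)
have lev s t : 0 < t -> 0 < s < energy_at t - l ->
    exists2 w : 'rV[R]_(d + d), `|w| <= r & energy f (lsubmx w) (rsubmx w) = s + l.
  move=> t0 /andP[s0 st]; have [T T0 hT] := l2 _ s0.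
  pose T' := Num.max t T.
  have tT' : t <= T' by rewrite le_max lexx.
  have hT' : energy_at T' < l + s by apply: hT; rewrite le_max lexx orbT.
  have [||u] := @IVT R energy_at t T' (s + l) tT'.
  - apply: derivable_within_continuous => u; rewrite in_itv /= => /andP[u1 u2].
    by apply: (@ex_derive _ _ _ _ _ _ (energy_rate u)); apply: energy_at_derive; lra.
  - by rewrite ge_min le_max; apply/andP; split; apply/orP; [right | left]; lra.
  rewrite in_itv /= => /andP[u1 u2] eu; exists (z u); first by apply: zr; lra.
  by rewrite Ez subrK.
have [V [eta eta0 [mV [MV hMV] hV]]] := desingularise fC2 HS Sf l r.
have [T T0 hT] := l2 _ eta0.
(* After time 1 the function [speed_from1] is the true speed. *)
pose T1 := Num.max T 1.
have T11 : 1 <= T1 by rewrite le_max lexx orbT.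
have T1T : T <= T1 by rewrite le_max lexx.
pose kap := Num.min (c / 4) (beta / 3) / (3 + 2 * beta ^+ 2).
have q0 : 0 < 3 + 2 * beta ^+ 2 by have := sqr_ge0 beta; lra.
have k0 : 0 < kap by rewrite divr_gt0 // lt_min !divr_gt0.
have erange t : T1 <= t -> 0 < energy_at t - l < eta.
  move=> tT; have h1 : 0 < t by lra.
  by have := hpos t h1; have := hT t (le_trans T1T tT) => *; apply/andP; split; lra.
have := @dini_length R V (fun t => energy_at t - l) energy_rate L speed_from1 kap eta T1 k0 mV
    erange.
move=> H; have {}H := H _ _ (fun t _ => dL t) _.
have {}H t : T1 <= t -> V (energy_at t - l) + kap / 8 * L t <= V (energy_at T1 - l) + kap / 8 * L
    T1.
  apply: H => {}t tT.
  - have t0 : 0 < t by lra.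
    have := is_deriveB (energy_at_derive t0) (is_derive_cst l t 1); rewrite subr0; exact.
  - by apply: energy_rate_le0; lra.
  have t0 : 0 < t by lra.
  rewrite speed_from1E; last lra.
  have [->|ln0] := eqVneq (enorm (v t)) 0; first by left.
  have lp : 0 < enorm (v t) by rewrite lt_def ln0 enorm_ge0.
  right; set N := \sum_i partial i f (x t) ^+ 2 + \sum_i shifted_velocity t 0 i ^+ 2.
  have N0 : 0 <= N by rewrite addr_ge0 // sumsq_ge0.
  (* Adding the speed to the gradient norm gives the positivity asked of [G] at once, and only
     enlarges its square. *)
  have G0 : 0 < Num.sqrt N + enorm (v t) by have := sqrtr_ge0 N; lra.
  exists (Num.sqrt N + enorm (v t)) => //; split => //.
    exact: dissipation_ge_product.
  apply: (hV (z t)) => //; first exact: zr.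
  - exact: erange.
  - rewrite /z row_mxKl row_mxKr -/N -{1}(sqr_sqrtr N0).
    by rewrite ler_sqr ?nnegrE ?sqrtr_ge0 ?ltW // ltrDl.
  - by move=> s' hs'; apply: lev t0 hs'.
apply: (@arclength_bounded_intro (8 / kap * (V (energy_at T1 - l) + kap / 8 * L T1 + MV)) T1) =>
    t tT.
have t0 : 0 < t by lra.
have hm : `|V (energy_at t - l)| <= MV.
  by apply: hMV; [apply: erange | exists (z t); [apply: zr | apply: Ez]].
have := H t tT; have := ler_norm (- V (energy_at t - l)); rewrite normrN => h1 h2.
have k8 : 0 < kap / 8 by rewrite divr_gt0.
by rewrite -[8 / kap]invf_div ler_pdivlMl //; lra.
Qed.

Let speed_majorant (t : R) := speed_from1 t + (expR (1 - t) + 4 / c * - energy_rate t).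
Let speed_majorant_primitive (t : R) := L t + (- expR (1 - t) + 4 / c * - energy_at t).

(** From time 1 on the first term is the speed itself. Before, |v| <= 1 + |v|^2, where the
    exponential is at least 1 and the dissipation term is at least |v|^2. *)
Lemma speed_le_majorant (t : R) : 0 < t -> enorm (v t) <= speed_majorant t.
Proof.
move=> t0; have c4 : 0 < 4 / c by rewrite divr_gt0.
have h1 : enorm (v t) ^+ 2 <= 4 / c * - energy_rate t.
  have := energy_rate_le_velocity t0; rewrite -enorm_sqr -(ler_pM2l c4) mulrA.
  by rewrite (_ : 4 / c * (c / 4) = 1) ?mul1r //; field; rewrite gt_eqF.
have h2 := expR_ge0 (1 - t); have h3 := sqr_ge0 (enorm (v t)).
have h4 : 0 <= speed_from1 t by apply: enorm_ge0.
have [t1|t1] := leP 1 t; first by rewrite /speed_majorant (speed_from1E t1); set q := _ * -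
    energy_rate t in h1 *; lra.
have h5 : 1 <= expR (1 - t) by rewrite -[leLHS]expR0 ler_expR; lra.
have h6 := sqr_ge0 (enorm (v t) - 1); rewrite sqrrB1 mulr2n in h6.
have h7 : enorm (v t) <= 1 + enorm (v t) ^+ 2 by lra.
by apply: le_trans h7 _; rewrite /speed_majorant; lra.
Qed.

Lemma speed_majorant_primitive_derive (t : R) : 0 < t -> is_derive t 1 speed_majorant_primitive
    (speed_majorant t).
Proof.
move=> t0.
have d1 : is_derive t 1 (fun s : R => 1 - s) (0 - 1).
  exact: is_deriveB (is_derive_cst (1 : R) t 1) (is_derive_id t 1).
have d2 := is_deriveN (@is_derive1_comp R expR (fun s => 1 - s) t _ _ (is_derive_expR (1 - t)) d1).
rewrite sub0r mulrN1 opprK in d2.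
have d3 := is_deriveZ (4 / c) (is_deriveN (energy_at_derive t0)).
exact: is_deriveD (dL t) (is_deriveD d2 d3).
Qed.

Lemma speed_majorant_cts (t : R) : 0 < t -> {for t, continuous speed_majorant}.
Proof.
move=> t0.
apply: (@continuousD _ _ _ speed_from1 (fun s => expR (1 - s) + 4 / c * - energy_rate s)); first
    exact: speed_from1_cts.
apply: continuousD.
  apply: (@continuous_comp _ _ _ (fun s : R => 1 - s) expR); last exact: continuous_expR.
  exact: is_derive_cts (is_deriveB (is_derive_cst (1 : R) t 1) (is_derive_id t 1)).
apply: (@continuousM _ _ (fun=> 4 / c) (fun t => - energy_rate t)); first exact: cst_continuous.
by apply: continuousN; apply: energy_rate_cts.
Qed.

Lemma speed_majorant_primitive_bounded : exists K, forall t : R, 0 < t ->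
    `|speed_majorant_primitive t| <= K.
Proof.
have [K hK] := arclength_bounded; exists (K + (expR 1 + 4 / c * (`|m| + `|B|))) => t t0.
apply: le_trans (ler_normD _ _) _; apply: lerD; first exact: hK.
apply: le_trans (ler_normD _ _) _; apply: lerD.
  by rewrite normrN ger0_norm ?expR_ge0 // ler_expR; lra.
rewrite normrM gtr0_norm ?divr_gt0 // ler_pM2l ?divr_gt0 // normrN.
have := energy_at_ge t; have := EB t0; have := ler_norm B; have := ler_norm (- m).
have := normr_ge0 B; have := normr_ge0 m; rewrite normrN ler_norml => *.
by apply/andP; split; lra.
Qed.

Lemma L1_velocity : Lp_Rplus 1 v.
Proof.
have [K hK] := speed_majorant_primitive_bounded.
apply: (@integrable_of_primitive R (fun t => enorm (v t)) speed_majorant speed_majorant_primitive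
    K _ _ speed_majorant_cts speed_majorant_primitive_derive hK).
- by move=> t t0; rewrite enorm_ge0 speed_le_majorant.
- by move=> t t0; apply: continuous_enorm => i; apply: is_derive_cts (dv t0 i).
Qed.

(** Each coordinate plus the primitive of the majorant is nondecreasing and bounded, because |v_i|
    is below the majorant; the primitive alone converges for the same reasons, and so does the
    difference. The limit is critical because the partial derivatives tend to 0 along [x]. *)
Lemma trajectory_cvg_critical : exists u, grad f u = 0 /\ (x t @[t --> +oo] --> u).
Proof.
have [K hK] := speed_majorant_primitive_bounded.
have Hm (s t : R) : 0 < s -> s <= t -> speed_majorant_primitive s <= speed_majorant_primitive t.
  move=> s0 st; rewrite -lerN2.
  apply: (@derive_le0_nonincr _ (fun r => - speed_majorant_primitive r) (fun r => -
      speed_majorant r) s t st) => r /andP[r1 r2].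
    by apply: is_deriveN (speed_majorant_primitive_derive _); lra.
  by rewrite oppr_le0; apply: le_trans (speed_le_majorant _); rewrite ?enorm_ge0 //; lra.
have [lH hH] := nondecr_cvg Hm hK.
have hi i : exists l : R, x t 0 i @[t --> +oo] --> l.
  have [||l hl] := @nondecr_cvg R (fun t => x t 0 i + speed_majorant_primitive t) (M + K).
  - move=> s t s0 st; rewrite -lerN2.
    apply: (@derive_le0_nonincr _ (fun r => - (x r 0 i + speed_majorant_primitive r))
      (fun r => - (v r 0 i + speed_majorant r)) s t st) => r /andP[r1 r2].
      have r0 : 0 < r by lra.
      exact: is_deriveN (is_deriveD (dx r0 i) (speed_majorant_primitive_derive r0)).
    have r0 : 0 < r by lra.
    rewrite oppr_le0; have := speed_le_majorant r0; have := coord_le_enorm (v r) i.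
    by have := ler_norm (- v r 0 i); rewrite normrN; lra.
  - move=> t t0; apply: le_trans (ler_normD _ _) _; apply: lerD; last exact: hK.
    by apply: le_trans (mxnorm_ge_coord _ _ _) (xM t0).
  exists (l - lH).
  have e : (fun t => x t 0 i) = (fun t => (x t 0 i + speed_majorant_primitive t) -
      speed_majorant_primitive t).
    by apply/funext => t; rewrite addrK.
  by rewrite e; exact: cvgB hl hH.
have [u hu] := choice hi.
have xu : x t @[t --> +oo] --> (\row_i u i : 'rV[R]_d).
  by apply: cvg_mx_pinfty => i; rewrite mxE.
exists (\row_i u i); split => //; apply/rowP => i; rewrite !mxE.
case: fC2 => [_ [_ [c1 _]]].
have h1 : partial i f (x t) @[t --> +oo] --> partial i f (\row_i u i).
  by apply: (cvg_comp _ _ xu); apply: c1.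
exact: (cvg_unique _ h1 (@partial_cvg0 i)).
Qed.

End Trajectory.

(** * Boundedness of the energy near the initial time *)

Section InitialEnergy.
Variable R : realType.
Implicit Types g h : R -> R.

Definition bounded_near0 g := exists B, rgt (fun t => `|g t| <= B) 0.

Lemma bounded_near0_cvg g (l : R) : g t @[t --> 0^'+] --> l -> bounded_near0 g.
Proof.
move=> /cvgrPdist_le /(_ _ ltr01); rewrite near_withinE => H.
have [dl dl0 hdl] := (near_normP _ _).1 H.
exists (`|l| + 1); exists dl => // t /andP[t0 td].
have := hdl t; rewrite subr0 gtr0_norm // => /(_ _ t0) h.
have {}h : `|l - g t| <= 1 by apply: h; lra.
have := ler_normB l (l - g t); rewrite opprB addrC subrK; lra.
Qed.

Lemma bounded_near0D g h : bounded_near0 g -> bounded_near0 h -> bounded_near0 (fun t => g t + h t).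
Proof.
move=> [A hA] [B hB]; exists (A + B); apply: rgt_imp (rgtI hA hB) => t [h1 h2].
by apply: le_trans (ler_normD _ _) _; apply: lerD.
Qed.

Lemma bounded_near0M g h : bounded_near0 g -> bounded_near0 h -> bounded_near0 (fun t => g t * h t).
Proof.
move=> [A hA] [B hB]; exists (A * B); apply: rgt_imp (rgtI hA hB) => t [h1 h2].
by rewrite normrM; apply: ler_pM.
Qed.

Lemma bounded_near0_cst (a : R) : bounded_near0 (fun=> a).
Proof. by exists `|a|; exists 1. Qed.

Lemma bounded_near0_sum n (F : 'I_n -> R -> R) : (forall i, bounded_near0 (F i)) ->
  bounded_near0 (fun t => \sum_i F i t).
Proof.
move=> h; elim: (index_enum _) => [|i r IH].
  rewrite (_ : (fun t => _) = fun=> 0); first exact: bounded_near0_cst.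
  by apply/funext => t; rewrite big_nil.
rewrite (_ : (fun t => _) = fun t => F i t + \sum_(j <- r) F j t); first exact: bounded_near0D.
by apply/funext => t; rewrite big_cons.
Qed.

Variables (d : nat) (f : 'rV[R]_d -> R) (beta : R) (x : R -> 'rV[R]_d).
Hypothesis fC2 : C2 f.
Hypothesis x1 : C1_Rplus x.

(** The one-sided limits of [x] and its derivative at 0 suffice for this. As the energy is
    nonincreasing on ]0, +oo[, a bound near 0 becomes one for all positive times. *)
Lemma energy_bounded_near0 : bounded_near0 (energy_at f beta x (derive1 x)).
Proof.
case: x1 => [_ [xc [_ /cvg_ex[l hl]]]]; case: fC2 => [fc [_ [c1 _]]].
have [_ x0] := (continuous_within_itvcyP _ _).1 xc.
have hg (g : 'rV[R]_d -> R) : continuous g -> bounded_near0 (fun t => g (x t)).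
  by move=> cg; apply: (@bounded_near0_cvg _ (g (x 0))); exact: (@cvg_comp _ _ _ x g _ _ _ x0 (cg
      (x 0))).
have hv i : bounded_near0 (fun t => derive1 x t 0 i).
  by apply: (@bounded_near0_cvg _ (l 0 i)); exact: (@cvg_comp _ _ _ (derive1 x) (fun w : 'rV[R]_d
      => w 0 i) _ _ _ hl (@coord_continuous _ _ _ 0 i l)).
apply: bounded_near0D; first exact: hg.
apply: bounded_near0M; first exact: bounded_near0_cst.
apply: (@bounded_near0_sum _ (fun i t => shifted_velocity f beta x (derive1 x) t 0 i ^+ 2)) => i.
have hy : bounded_near0 (fun t => shifted_velocity f beta x (derive1 x) t 0 i).
  rewrite (_ : (fun t => _) = fun t => derive1 x t 0 i + beta * partial i f (x t)).
    by apply: bounded_near0D => //; apply: bounded_near0M; [apply: bounded_near0_cst | apply: hg].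
  by apply/funext => t; rewrite shifted_velocityE.
exact: (bounded_near0M hy hy).
Qed.

End InitialEnergy.

(** * Proof of the four statements *)

Unset Implicit Arguments. Set Strict Implicit. Set Printing Implicit Defensive.

Theorem mainTheorem1 (R : realType) (d : nat) (f : 'rV[R]_d -> R)
  (gamma : R -> R) (c C beta : R) (x0 v0 : 'rV[R]_d) :
  C2 f ->
  (exists m : R, forall u, m <= f u) ->
  C1_Rplus gamma ->
  0 < c -> c <= C ->
  (forall t, 0 <= t -> c <= gamma t <= C) ->
  0 < beta -> beta < 2 * c / C ^+ 2 ->
  (* (i) existence of a global C^2 solution *)
  (exists x : R -> 'rV[R]_d, ISEHD_solution f gamma beta x0 v0 x) /\
  (forall x : R -> 'rV[R]_d, ISEHD_solution f gamma beta x0 v0 x ->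
    (* (ii) *)
    (Lp_Rplus 2 (fun t => grad f (x t)) /\ Lp_Rplus 2 (derive1 x)) /\
    (* (iii) *)
    ((exists M : R, forall t, 0 <= t -> enorm (x t) <= M) ->
       (enorm (grad f (x t)) @[t --> +oo] --> 0) /\
       (enorm ((derive1 x) t) @[t --> +oo] --> 0) /\
       cvg (f (x t) @[t --> +oo])) /\
    (* (iv) *)
    ((exists M : R, forall t, 0 <= t -> enorm (x t) <= M) ->
       definable f ->
       Lp_Rplus 1 (derive1 x) /\
       exists u : 'rV[R]_d, grad f u = 0 /\ (x t @[t --> +oo] --> u))).
Proof.
move=> fC2 [m fm] g1 c0 cC gcC b0 bC.
have C0 : 0 < C by lra.
(* Dividing beta C^2 < 2 c <= 2 C by C; the dissipation estimate uses the hypothesis on [beta] in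
   this form. *)
have bC2 : beta * C <= 2.
  have : beta * C ^+ 2 < 2 * c by rewrite -ltr_pdivlMr ?exprn_gt0.
  move=> h; rewrite -(ler_pM2r C0) -mulrA -expr2; lra.
have gc (t : R) : 0 <= t -> c <= gamma t by move=> /gcC /andP[].
have gC (t : R) : 0 <= t -> gamma t <= C by move=> /gcC /andP[].
have bg (t : R) : 0 <= t -> beta * gamma t <= 2.
  by move=> /gC h; apply: le_trans bC2; rewrite ler_pM2l.
have gcts := g1.2.1.
split; first exact: ISEHD_exists x0 v0 fC2 fm gcts c0 gc b0 bg.
move=> x [[x1 [dv1 _]] [_ [_ hODE]]].
have gct (t : R) : 0 < t -> {for t, continuous gamma}.
  move=> t0; have [h _] := (continuous_within_itvcyP _ _).1 gcts.
  by apply: h; rewrite in_itv /= andbT.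
have dx (t : R) : 0 < t -> forall i, is_derive t 1 (fun s => x s 0 i) (derive1 x t 0 i).
  by move=> t0 i; apply: derive_rV_coord; apply: x1.1.
have dv (t : R) : 0 < t -> forall i, is_derive t 1 (fun s => derive1 x s 0 i)
  (- gamma t * derive1 x t 0 i - beta * (\sum_j partial j (partial i f) (x t) * derive1 x t 0 j)
   - partial i f (x t)).
  move=> t0 i; have := derive_rV_coord i (dv1 t t0).
  rewrite (_ : derive1 (derive1 x) t 0 i = - gamma t * derive1 x t 0 i -
     beta * (\sum_j partial j (partial i f) (x t) * derive1 x t 0 j) - partial i f (x t)) //.
  have := congr1 (fun w : 'rV[R]_d => w 0 i) (hODE t t0).
  rewrite derive1nS derive1n1.
  have -> : (0 : 'rV[R]_d) 0 i = 0 by rewrite mxE.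
  move=> e; apply/eqP; rewrite -subr_eq0 -[X in _ == X]e; apply/eqP.
  rewrite -hess_appE; move: (hess_app _ _ _) (derive1 (derive1 x) t) => H a.
  by rewrite !mxE; ring.
have gc' (t : R) : 0 < t -> c <= gamma t by move=> /ltW /gc.
have gC' (t : R) : 0 < t -> gamma t <= C by move=> /ltW /gC.
have bg' (t : R) : 0 < t -> beta * gamma t <= 2 by move=> /ltW /bg.
have [B [dl dl0 hB]] := energy_bounded_near0 beta fC2 x1.
have EB (t : R) : 0 < t -> energy_at f beta x (derive1 x) t <= B.
  (* The energy at [t] is compared with that at an earlier time [s] inside the neighbourhood of 0
     where it is bounded. *)
  move=> t0; pose s := Num.min t (dl / 2).
  have s0 : 0 < s by rewrite lt_min t0 divr_gt0.
  have st : s <= t by rewrite ge_min lexx.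
  have sd : s <= dl / 2 by rewrite ge_min lexx orbT.
  apply: le_trans (energy_at_nonincr fC2 c0 gc' b0 bg' dx dv s0 st) _.
  by apply: le_trans (ler_norm _) (hB s _); rewrite s0 add0r; lra.
split.
  split.
    exact: L2_grad fC2 fm gct c0 gc' b0 bg' dx dv EB.
  exact: L2_velocity fC2 fm gct c0 gc' b0 bg' dx dv EB.
have xM (M : R) : (forall t, 0 <= t -> enorm (x t) <= M) ->
    forall t : R, 0 < t -> `|x t| <= M.
  by move=> h t t0; apply: le_trans (norm_le_enorm _) _; apply: h; apply: ltW.
split.
  move=> [M /xM hM]; split; last split.
  - apply: enorm_cvg0 => i.
    rewrite (_ : (fun t => _) = (fun t => partial i f (x t))).
      by have h := partial_cvg0 fC2 fm c0 gc' b0 bg' dx dv EB hM i; exact: h.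
    by apply/funext => t; rewrite mxE.
  - apply: enorm_cvg0 => i.
    by have h := velocity_cvg0 fC2 fm c0 gc' gC' b0 bg' dx dv EB hM i; exact: h.
  - by have h := value_cvg fC2 fm c0 gc' gC' b0 bg' dx dv EB hM; exact: h.
move=> [M /xM hM] [S [HS Sf]].
have [L [L0 dL]] := primitive_exists (speed_from1_cts dv).
split.
  by have h := L1_velocity fC2 fm gct c0 gc' b0 bg' dx dv EB hM L0 dL HS Sf; exact: h.
by have h := trajectory_cvg_critical fC2 fm c0 gc' b0 bg' dx dv EB hM L0 dL HS Sf; exact: h.
Qed.
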